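(* Let $A>0$, $\alpha>0$, $2\alpha+3\beta\ge 0$ and $1<\min\{\gamma,\delta\}\le 2$. Let the initial data $(\rho_0,u_0)$ satisfy $\rho_0\ge 0$ and $\big(\rho_0^{\frac{\gamma-1}{2}},\rho_0^{\frac{\delta-1}{2}},u_0\big)\in H^3(\mathbb{R}^3)$, and assume $|\mathbb{P}(0)|>0$, where $\mathbb{P}(t)=\int_{\mathbb{R}^3}\rho u\,\mathrm{d}x$ is the total momentum. Then there is no global regular solution $(\rho,u)$ (i.e. a pair defined on $[0,\infty)\times\mathbb{R}^3$ which is a regular solution on $[0,T]\times\mathbb{R}^3$ for every $T>0$) of the Cauchy problem described in the context which satisfies the decay $$\limsup_{t\to+\infty}\|u(t,\cdot)\|_{L^\infty(\mathbb{R}^3)}=0 .$$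
   Context: The Cauchy problem is: find $\rho\ge0$ and $u=(u^{(1)},u^{(2)},u^{(3)})^\top$ on $[0,T]\times\mathbb{R}^3$ with $$\rho_t+\mathrm{div}(\rho u)=0,\qquad (\rho u)_t+\mathrm{div}(\rho u\otimes u)+\nabla P=\mathrm{div}\,\mathbb{T},$$ $P=A\rho^\gamma$, $\mathbb{T}=\alpha\rho^\delta\big(\nabla u+(\nabla u)^\top\big)+\beta\rho^\delta\,\mathrm{div}u\,\mathbb{I}_3$, $(\rho,u)|_{t=0}=(\rho_0,u_0)$, and $\rho(t,x)\to0$ as $|x|\to\infty$ for $t\ge 0$. A pair $(\rho,u)$ is here called a regular solution on $[0,T]\times\mathbb{R}^3$ if it satisfies this problem in the sense of distributions and: (A) $\rho\ge0$, $\rho^{\frac{\delta-1}{2}}\in C([0,T];H^3)$, $\rho^{\frac{\gamma-1}{2}}\in C([0,T];H^3)$; (B) $u\in C([0,T];H^{s'})\cap L^\infty([0,T];H^3)$ for every $s'\in[2,3)$, and $\rho^{\frac{\delta-1}{2}}\nabla^4u\in L^2([0,T];L^2)$; (C) $u_t+u\cdot\nabla u=0$ wherever $\rho(t,x)=0$. All function spaces in $x$ are over $\mathbb{R}^3$. *)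

(* Defs.v *)
From HB Require Import structures.
From mathcomp Require Import all_boot all_order all_algebra.
From mathcomp Require Import all_classical all_reals all_analysis.

Set Implicit Arguments.
Unset Strict Implicit.
Unset Printing Implicit Defensive.

Import Order.TTheory GRing.Theory Num.Theory.
Import numFieldNormedType.Exports.

Local Open Scope classical_set_scope.
Local Open Scope ring_scope.

(* Elements of function spaces are represented by functions.  Apart from the   *)
(* sign conditions on the densities, which are imposed at every point, all     *)
(* conditions below are insensitive to a change of representative on a null    *)
(* set of the space variable.  A vector field is the family of its components. *)

Notation timeline R := (measurableTypeR R).
Notation space3 R :=
  (measurableTypeR R * measurableTypeR R * measurableTypeR R)%type.
Notation leb R := (@lebesgue_measure R).
Notation vol R := (leb R \x leb R \x leb R)%E.

Definition coord3 {R : realType} (x : space3 R) (i : 'I_3) : R :=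
  nth 0 [:: x.1.1; x.1.2; x.2] i.

Definition basis3 {R : realType} (i : 'I_3) : space3 R :=
  ((i == 0%N :> nat)%:R, (i == 1%N :> nat)%:R, (i == 2%N :> nat)%:R).

(* Euclidean norm; the library norm on a product type is the maximum norm. *)
Definition enorm {R : realType} (v : 'I_3 -> R) : R :=
  Num.sqrt (\sum_i v i ^+ 2).

Section TestFunctions.
Context {R : realType} {V : normedModType R}.

Fixpoint Ck (n : nat) (f : V -> R) : Prop :=
  continuous f /\
  if n is n'.+1 then forall v, (forall x, derivable f x v) /\ Ck n' ('D_v f)
  else True.

Definition test_fun (D : set V) (phi : V -> R) : Prop :=
  (forall n, Ck n phi) /\
  exists K, [/\ compact K, K `<=` D & forall x, ~ K x -> phi x = 0].

End TestFunctions.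

Section Sobolev.
Context {R : realType}.
Implicit Types f g : space3 R -> R.

Definition loc_integrable f : Prop :=
  forall K : set (space3 R), compact K -> (vol R).-integrable K (EFin \o f).

Definition is_weak_partial (i : 'I_3) f g : Prop :=
  [/\ loc_integrable f, loc_integrable g &
    forall phi : space3 R -> R, test_fun setT phi ->
      (\int[vol R]_x (f x * 'D_(basis3 i) phi x)
        = - \int[vol R]_x (g x * phi x))%R].

(* Meaningful, up to a null set, only when a weak derivative exists. *)
Definition weak_partial (i : 'I_3) f : space3 R -> R :=
  xget (cst 0) [set g | is_weak_partial i f g].

Definition weak_partials (s : seq 'I_3) f : space3 R -> R :=
  foldr weak_partial f s.

(* Squared Slobodeckij seminorm of exponent 0 < th < 1. *)
Definition slobodeckij2 (th : R) f : \bar R :=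
  (\int[vol R]_x \int[vol R]_y
    ((f x - f y) ^+ 2 / enorm (coord3 (x - y)) `^ (3 + 2 * th))%:E)%E.

(* With L the seminorm applied at order k, this is                             *)
(*   \sum_(j <= k) \| nabla^j f \|_{L^2}^2 + L (nabla^k f).                    *)
Fixpoint sobolev_sq (L : (space3 R -> R) -> \bar R) (k : nat) f : \bar R :=
  ('N[vol R]_2%:E[EFin \o f] ^+ 2 +
   if k is k'.+1 then \sum_(i < 3) sobolev_sq L k' (weak_partial i f)
   else L f)%E.

Fixpoint sobolev_mem (L : (space3 R -> R) -> \bar R) (k : nat) f : Prop :=
  f \in Lfun (vol R) 2%:E /\
  if k is k'.+1 then
    forall i, is_weak_partial i f (weak_partial i f) /\
              sobolev_mem L k' (weak_partial i f)
  else (L f < +oo)%E.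

Definition top_seminorm (th : R) : (space3 R -> R) -> \bar R :=
  if th == 0 then fun=> 0%E else slobodeckij2 th.

(* H^s for s >= 0 is the Sobolev-Slobodeckij space: s = k + th with k the      *)
(* integer part of s; for th = 0 this is the space of functions with weak      *)
(* derivatives up to order k in L^2.                                           *)
Definition in_H (s : R) f : Prop :=
  sobolev_mem (top_seminorm (s - (Num.truncn s)%:R)) (Num.truncn s) f.

Definition H_norm (s : R) f : \bar R :=
  sqrte (sobolev_sq (top_seminorm (s - (Num.truncn s)%:R)) (Num.truncn s) f).

Definition in_C_H (T s : R) (f : timeline R -> space3 R -> R) : Prop :=
  forall t, t \in `[0, T] ->
    in_H s (f t) /\
    H_norm s (fun x => f r x - f t x)
      @[r --> within [set` `[0, T]] (nbhs (t : R))] --> 0%E.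

Definition in_Linfty_H (T s : R) (f : timeline R -> space3 R -> R) : Prop :=
  exists M : R, \forall t \ae leb R, t \in `[0, T] ->
    in_H s (f t) /\ (H_norm s (f t) <= M%:E)%E.

(* g \nabla^4 v \in L^2([0, T]; L^2), for g in H^3 and v in L^\infty(H^3).     *)
(* The fourth derivatives of v are only distributions, so the product is the   *)
(* distribution g \d_i z := \d_i (g z) - (\d_i g) z, with z a third-order      *)
(* derivative of v, and it is required to be a function w.                     *)
Definition weighted_D4_in_L2_L2 (T : R) (g v : timeline R -> space3 R -> R) : Prop :=
  forall (i : 'I_3) (s : 3.-tuple 'I_3), exists w : timeline R * space3 R -> R,
    [/\ measurable_fun setT w,
        (\int[leb R]_(t in [set` `[0%R, T]]) \int[vol R]_x (w (t, x) ^+ 2)%:E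
           < +oo)%E &
        \forall t \ae leb R, t \in `[0, T] ->
          let z := weak_partials s (v t) in
          is_weak_partial i (fun x => g t x * z x)
            (fun x => w (t, x) + weak_partial i (g t) x * z x)].

End Sobolev.

Section Flow.
Context {R : realType}.
Implicit Types (rho : timeline R -> space3 R -> R)
  (u : 'I_3 -> timeline R -> space3 R -> R) (T : R).

Definition open_slab T : set (timeline R * space3 R) :=
  [set z | z.1 \in `]0, T[].

Definition dt (phi : timeline R * space3 R -> R) (t : timeline R) (x : space3 R) : R :=
  'D_((1, 0) : timeline R * space3 R) phi (t, x).

Definition dx (j : 'I_3) (phi : timeline R * space3 R -> R)
    (t : timeline R) (x : space3 R) : R :=
  'D_((0, basis3 j) : timeline R * space3 R) phi (t, x).

Definition spacetime_int T (F : timeline R -> space3 R -> R) : R :=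
  \int[leb R]_(t in [set` `]0, T[]) \int[vol R]_x F t x.

Definition divergence u (t : timeline R) (x : space3 R) : R :=
  \sum_j weak_partial j (u j t) x.

Definition stress (alpha beta delta : R) rho u (i j : 'I_3)
    (t : timeline R) (x : space3 R) : R :=
  alpha * rho t x `^ delta *
    (weak_partial j (u i t) x + weak_partial i (u j t) x) +
  beta * rho t x `^ delta * divergence u t x * (i == j)%:R.

Definition continuity_eq T rho u : Prop :=
  forall phi, test_fun (open_slab T) phi ->
    spacetime_int T (fun t x =>
      rho t x * dt phi t x + \sum_j rho t x * u j t x * dx j phi t x) = 0.

Definition momentum_eq (A alpha beta gamma delta T : R) rho u : Prop :=
  forall i phi, test_fun (open_slab T) phi ->
    spacetime_int T (fun t x =>
      rho t x * u i t x * dt phi t x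
      + \sum_j rho t x * u i t x * u j t x * dx j phi t x
      + A * rho t x `^ gamma * dx i phi t x
      - \sum_j stress alpha beta delta rho u i j t x * dx j phi t x) = 0.

Definition is_weak_dt T (f : timeline R -> space3 R -> R)
    (ft : timeline R * space3 R -> R) : Prop :=
  (forall K : set (timeline R * space3 R), compact K -> K `<=` open_slab T ->
     (leb R \x vol R)%E.-integrable K (EFin \o ft)) /\
  forall phi, test_fun (open_slab T) phi ->
    spacetime_int T (fun t x => f t x * dt phi t x)
      = - spacetime_int T (fun t x => ft (t, x) * phi (t, x)).

Definition vacuum_eq T rho u : Prop :=
  forall i, exists2 ut, is_weak_dt T (u i) ut &
    \forall t \ae leb R, t \in `]0, T[ ->
      \forall x \ae vol R, rho t x = 0 ->
        ut (t, x) + \sum_j u j t x * weak_partial j (u i t) x = 0.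

Definition vanishes_at_infinity (f : space3 R -> R) : Prop :=
  forall e : R, 0 < e -> exists M : R,
    \forall x \ae vol R, M <= enorm (coord3 x) -> `|f x| <= e.

Record regular_solution (A alpha beta gamma delta : R)
    (rho0 : space3 R -> R) (u0 : 'I_3 -> space3 R -> R) (T : R)
    rho u : Prop := RegularSolution {
  rs_continuity : continuity_eq T rho u;
  rs_momentum : momentum_eq A alpha beta gamma delta T rho u;
  rs_init_rho : \forall x \ae vol R, rho 0 x = rho0 x;
  rs_init_u : forall i, \forall x \ae vol R, u i 0 x = u0 i x;
  rs_far_field : forall t, t \in `[0, T] -> vanishes_at_infinity (rho t);
  rs_rho_ge0 : forall t x, t \in `[0, T] -> 0 <= rho t x;
  rs_rho_delta : in_C_H T 3 (fun t x => rho t x `^ ((delta - 1) / 2));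
  rs_rho_gamma : in_C_H T 3 (fun t x => rho t x `^ ((gamma - 1) / 2));
  rs_u_C : forall i s, 2 <= s < 3 -> in_C_H T s (u i);
  rs_u_Linfty : forall i, in_Linfty_H T 3 (u i);
  rs_u_D4 : forall i,
    weighted_D4_in_L2_L2 T (fun t x => rho t x `^ ((delta - 1) / 2)) (u i);
  rs_vacuum : vacuum_eq T rho u
}.

Definition total_momentum (rho : space3 R -> R) (u : 'I_3 -> space3 R -> R)
    (i : 'I_3) : R :=
  \int[vol R]_x (rho x * u i x).

Definition speed_Linfty u (t : timeline R) : \bar R :=
  ('N[vol R]_(+oo)[EFin \o (fun x => enorm (fun i => u i t x))])%E.

End Flow.

(* Main.v *)
Require Import Defs.
From HB Require Import structures.
From mathcomp Require Import all_boot all_order all_algebra.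
From mathcomp Require Import all_classical all_reals all_analysis.
From mathcomp Require Import measurable_realfun ess_sup_inf.
From mathcomp Require Import ring lra.
Import Order.TTheory GRing.Theory Num.Theory.
Import numFieldNormedType.Exports.
Local Open Scope classical_set_scope.
Local Open Scope ring_scope.
Set Implicit Arguments.
Unset Strict Implicit.
Unset Printing Implicit Defensive.

(** Along a regular solution the total mass m(t), the integral of rho, and the
    total momentum P(t) are conserved. Since |P_i(t)| is at most m(t) times the
    L^oo norm of u(t), a velocity that decays to 0 forces the constant momentum
    to be 0, against the hypothesis on the initial data.

    The equations hold only in the sense of distributions on the open slab
    ]0, T[ x R^3, and they have to be integrated over the whole space and up to
    time 0. This is possible for every law q_t + div J = 0 whose density and
    flux are in C([0, T]; L^1) ([conservation]): tested against a spatial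
    cut-off at distance n, the density has a time derivative of order 1/n.

    It remains to see that rho, rho u_i and their fluxes are in C([0, T]; L^1).
    Let m = min(gamma, delta) and f = rho^((m-1)/2), which is in C([0, T]; H^3).
    Then rho^s = f^(2s/(m-1)), with an exponent at least 2 for s >= 1, because
    m <= 2. As H^3 is contained in L^oo ([sobolev_Linfty]) and powers of
    exponent at least 1 are locally Lipschitz, rho^s is in C([0, T]; L^oo), in
    C([0, T]; L^2) and in C([0, T]; L^1) ([density_classes]). With u_i and its
    first derivatives in C([0, T]; L^2), the momentum density, the convective
    flux, the pressure and the viscous stress are products of two elements of
    C([0, T]; L^2) ([C_L2_mul], [momentum_flux_C_L1]).

    The embedding of H^3 is proved with the mixed derivative of order three: for
    a smooth bump b, the value of b f at x is, up to the sign, the integral of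
    d_0 d_1 d_2 (b f) over the octant above x ([bump_representation]). For weak
    derivatives this is checked by integrating both sides over boxes, which
    amounts to an integration by parts against piecewise linear ramps, and the
    integral is bounded by the L^2 norms of derivatives of f because b has a
    compact support ([dcut_L1]). The fundamental lemma [weak_zero] gives the
    uniqueness of weak derivatives, hence their linearity almost everywhere,
    which is needed to differentiate the increments in time. *)

(** * Smooth functions *)

Section SmoothCalculus.
Context {R : realType} {V : normedModType R}.
Implicit Types (f g : V -> R) (n : nat).

Definition smooth f := forall n, Ck n f.

Lemma Ck_continuous n f : Ck n f -> continuous f.
Proof. by case: n => [[]|n []]. Qed.

Lemma Ck_derivable n f x v : Ck n.+1 f -> derivable f x v.
Proof. by case=> _ /(_ v)[]. Qed.

Lemma Ck_derive n f v : Ck n.+1 f -> Ck n ('D_v f).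
Proof. by case=> _ /(_ v)[]. Qed.

Lemma CkW n f : Ck n.+1 f -> Ck n f.
Proof.
elim: n f => [|n IH] f; first by case.
by case=> cf df; split => // v; have [d1 d2] := df v; split => //; exact: IH.
Qed.

(** An explicit formula for the directional derivatives reduces the class C^(n+1)
of f to the class C^n of these formulas; this is the induction step of all
the stability properties. *)
Lemma CkS n f (df : V -> V -> R) : continuous f ->
  (forall v x, is_derive x v f (df v x)) -> (forall v, Ck n (df v)) -> Ck n.+1 f.
Proof.
move=> cf fdf dfn; split => // v; split; first by move=> x; have [] := fdf v x.
have -> : 'D_v f = df v by apply/funext => x; have [_ ->] := fdf v x.
exact: dfn.
Qed.

Lemma Ck_is_derive n f x v : Ck n.+1 f -> is_derive x v f ('D_v f x).
Proof. by move=> Cf; apply: derivableP; apply: Ck_derivable Cf. Qed.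

Lemma Ck_cst n (c : R) : Ck n (fun _ : V => c).
Proof.
elim: n c => [|n IH] c; first by split=> // x; exact: cst_continuous.
apply: (@CkS _ _ (fun _ _ => 0)) => //; first exact: cst_continuous.
Qed.

Lemma CkD n f g : Ck n f -> Ck n g -> Ck n (fun x => f x + g x).
Proof.
elim: n f g => [|n IH] f g Cf Cg.
  by split=> // x; apply: cvgD; [have := Ck_continuous Cf|have := Ck_continuous Cg]; exact.
apply: (@CkS _ _ (fun v x => 'D_v f x + 'D_v g x)).
- by move=> x; apply: cvgD; [have := Ck_continuous Cf|have := Ck_continuous Cg]; exact.
- by move=> v x; apply: is_deriveD; apply: Ck_is_derive; eassumption.
- by move=> v; apply: IH; exact: Ck_derive.
Qed.

Lemma CkM n f g : Ck n f -> Ck n g -> Ck n (fun x => f x * g x).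
Proof.
elim: n f g => [|n IH] f g Cf Cg.
  by split=> // x; apply: cvgM; [have := Ck_continuous Cf|have := Ck_continuous Cg]; exact.
apply: (@CkS _ _ (fun v x => f x * 'D_v g x + g x * 'D_v f x)).
- by move=> x; apply: cvgM; [have := Ck_continuous Cf|have := Ck_continuous Cg]; exact.
- by move=> v x; apply: is_deriveM; apply: Ck_is_derive; eassumption.
- by move=> v; apply: CkD; apply: IH; (exact: CkW || exact: Ck_derive).
Qed.

Lemma CkV n f : (forall x, f x != 0) -> Ck n f -> Ck n (fun x => (f x)^-1).
Proof.
move=> f0; elim: n => [|n IH] Cf.
  by split=> // x; apply: cvgV => //; apply: (Ck_continuous Cf).
apply: (@CkS _ _ (fun v x => (-1) * ((f x)^-1 * (f x)^-1) * 'D_v f x)).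
- by move=> x; apply: cvgV => //; apply: (Ck_continuous Cf).
- move=> v x; have dfx : derivable f x v by exact: Ck_derivable Cf.
  apply: DeriveDef; first exact: derivableV.
  by rewrite deriveV// mulN1r -invfM -expr2.
- move=> v; apply: CkM; last exact: Ck_derive.
  by apply: CkM; [exact: Ck_cst|apply: CkM; apply: IH; exact: CkW].
Qed.

Lemma smooth_cst (c : R) : smooth (fun _ => c).
Proof. by move=> n; exact: Ck_cst. Qed.

Lemma smoothD f g : smooth f -> smooth g -> smooth (fun x => f x + g x).
Proof. by move=> sf sg n; exact: CkD. Qed.

Lemma smoothM f g : smooth f -> smooth g -> smooth (fun x => f x * g x).
Proof. by move=> sf sg n; exact: CkM. Qed.

Lemma smoothV f : (forall x, f x != 0) -> smooth f -> smooth (fun x => (f x)^-1).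
Proof. by move=> f0 sf n; exact: CkV. Qed.

Lemma smooth_continuous f : smooth f -> continuous f.
Proof. by move=> /(_ 0%N)[]. Qed.

Lemma smooth_is_derive f x v : smooth f -> is_derive x v f ('D_v f x).
Proof. by move=> /(_ 1%N) /Ck_is_derive. Qed.

Lemma smooth_derive f v : smooth f -> smooth ('D_v f).
Proof. by move=> sf n; exact: (Ck_derive v (sf n.+1)). Qed.

End SmoothCalculus.

Section SmoothLine.
Context {R : realType}.
Implicit Types (g : R -> R).

(** On the line, the derivative in the direction 1 determines the others. *)
Lemma is_derive_dir g (x df v : R) : is_derive x 1 g df -> is_derive x v g (v * df).
Proof.
move=> [/derivable1_diffP dg <-]; apply: DeriveDef; first exact: diff_derivable.
by rewrite !deriveE// -[v in LHS]mulr1 -[_ * 1]/(v *: 1) linearZ.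
Qed.

Lemma CkS_line n g (dg : R -> R) :
  (forall x : R, is_derive x 1 g (dg x)) -> Ck n dg -> Ck n.+1 g.
Proof.
move=> gdg Cdg; apply: (@CkS R _ n g (fun v x : R => v * dg x)).
- move=> x; apply/differentiable_continuous/derivable1_diffP.
  by case: (gdg x).
- by move=> v x; exact: is_derive_dir.
- by move=> v; apply: CkM => //; exact: Ck_cst.
Qed.

Lemma derive_comp_affine {V W : normedModType R} (L : {linear V -> W}) (c : W)
    (g : W -> R) x v :
  (derivable g (L x + c) (L v) -> derivable (fun y => g (L y + c)) x v) /\
  'D_v (fun y => g (L y + c)) x = 'D_(L v) g (L x + c).
Proof.
rewrite /derivable /derive.
have -> : (fun h : R => h^-1 *: (((fun y => g (L y + c)) \o shift x) (h *: v) - g (L x + c)))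
        = (fun h : R => h^-1 *: ((g \o shift (L x + c)) (h *: L v) - g (L x + c))).
  apply/funext => h /=; rewrite addrA; congr (_ *: (g (_ + c) - _)); exact: linearP.
by split.
Qed.

Lemma Ck_comp_affine {V W : normedModType R} (L : {linear V -> W}) (c : W) n
    (g : W -> R) :
  continuous L -> Ck n g -> Ck n (fun y => g (L y + c)).
Proof.
move=> cL; have cc (h : W -> R) : continuous h -> continuous (fun y => h (L y + c)).
  move=> ch x; apply: (@continuous_comp _ _ _ (fun y => L y + c) h); last exact: ch.
  by apply: cvgD; [exact: cL|exact: cvg_cst].
elim: n g => [|n IH] g Cg; first by split=> //; exact/cc/(Ck_continuous Cg).
apply: (@CkS _ _ _ _ (fun v x => 'D_(L v) g (L x + c))).
- exact/cc/(Ck_continuous Cg).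
- move=> v x; have [d1 d2] := derive_comp_affine L c g x v.
  by apply: DeriveDef => //; apply: d1; apply: Ck_derivable Cg.
- by move=> v; apply: (IH ('D_(L v) g)); exact: Ck_derive.
Qed.

End SmoothLine.

Section Flat.
Context {R : realType}.
Implicit Types (p : {poly R}).

(** The functions p(1/x) exp(-1/x) on the positive half-line form a family that
is stable under differentiation, so that all of them are shown to be smooth at
once, by an induction in which p varies. The basic cut-off is [flat 1]. *)
Definition flat p (x : R) : R := if 0 < x then p.[x^-1] * expR (- x^-1) else 0.

Lemma poly_expR_bounded p : exists2 C : R, 0 < C & forall y, 0 <= y -> `|p.[y] * expR (- y)| <= C.
Proof.
exists (1 + \sum_(i < size p) `|p`_i| * i`!%:R) => [|y y0].
  by rewrite ltr_pwDl// sumr_ge0// => i _; rewrite mulr_ge0.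
rewrite horner_coef mulr_suml (le_trans (ler_norm_sum _ _ _))//.
rewrite ler_wpDl// ler_sum// => i _.
rewrite !normrM -mulrA ler_wpM2l// (ger0_norm (expR_ge0 _)) expRN.
rewrite ler_pdivrMr ?expR_gt0// normrX ger0_norm//.
case: (nat_of_ord i) => [|k]; first by rewrite expr0 fact0 mul1r; apply: le_trans (expR_ge1Dx y); rewrite lerDl.
rewrite -ler_pdivrMl ?ltr0n ?fact_gt0// mulrC.
by apply: le_trans (expR_ge1Dxn k y0); rewrite lerDr.
Qed.

Lemma flat_bounded p : exists2 C : R, 0 < C & forall x, `|flat p x| <= C.
Proof.
have [C C0 pC] := poly_expR_bounded p; exists C => // x; rewrite /flat.
by case: ifPn => x0; [apply: pC; rewrite invr_ge0 ltW|rewrite normr0 ltW].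
Qed.

Lemma flatXM p x : x * flat ('X * p) x = flat p x.
Proof.
rewrite /flat; case: ifPn => x0; last by rewrite mulr0.
by rewrite hornerM hornerX !mulrA divff ?mul1r// gt_eqF.
Qed.

(** At a point x > 0 the formula is the chain rule. At 0 the difference quotient
is flat p h / h = h * flat (X^2 p) h, and the last factor is bounded. *)
Lemma flat_is_derive p (x : R) : is_derive x 1 (flat p) (flat ('X ^+ 2 * (p - p^`())) x).
Proof.
have [x0|x0|->] := ltgtP x 0.
- apply: (@near_eq_is_derive _ _ _ (cst 0)).
    near=> y; rewrite /flat /= ifF//; apply/negbTE; rewrite -leNgt ltW//.
    by near: y; exact: lt_nbhsl.
  by rewrite /flat lt_gtF//; exact: is_derive_cst.
- apply: (@near_eq_is_derive _ _ _ (fun y : R => p.[y^-1] * expR (- y^-1) : R^o)).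
    near=> y; rewrite /flat /= ifT//.
    by near: y; exact: lt_nbhsr.
  rewrite /flat x0.
  have xn0 : x != 0 by rewrite gt_eqF.
  have dV : is_derive x 1 (fun y : R => y^-1) (- x ^- 2).
    apply: DeriveDef; first exact: derivableV.
    by rewrite (@deriveV _ _ id)// derive_id [LHS]mulr1.
  have dp : is_derive x 1 (fun y => p.[y^-1]) (p^`().[x^-1] * - x ^- 2).
    apply: DeriveDef.
      apply/derivable1_diffP.
      apply: (@differentiable_comp _ _ _ _ (fun y : R => y^-1) (horner p)).
        exact/derivable1_diffP.
      exact/derivable1_diffP.
    rewrite -derive1E derive1_comp//; first by rewrite -derivE derive1E derive_val.
  have dN : is_derive x 1 (fun y : R => - y^-1) (x ^- 2).
    by apply: (is_derive_eq (is_deriveN dV)); rewrite opprK.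
  have de : is_derive x 1 (fun y => expR (- y^-1)) (expR (- x^-1) * x ^- 2).
    apply: DeriveDef.
      apply/derivable1_diffP.
      apply: (@differentiable_comp _ _ _ _ (fun y : R => - y^-1) expR).
        exact/derivable1_diffP.
      exact/derivable1_diffP.
    rewrite -derive1E derive1_comp//; first by rewrite !derive1E !derive_val.
  apply: (is_derive_eq (is_deriveM dp de)).
  rewrite !hornerE /GRing.scale /= exprVn; ring.
- rewrite [X in is_derive _ _ _ X](_ : _ = 0); last by rewrite /flat ltxx.
  have [C C0 pC] := flat_bounded ('X * ('X * p)).
  have lim : (fun h : R => h^-1 *: ((flat p \o shift 0) (h *: 1) - flat p 0)) @ 0^' --> (0:R).
    apply/cvgrPdist_le => e e0; near=> h.
    rewrite sub0r normrN /= addr0 [X in flat p X]mulr1.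
    rewrite [X in _ - X](_ : _ = 0) ?subr0; last by rewrite /flat ltxx.
    have -> : h^-1 *: flat p h = h * flat ('X * ('X * p)) h.
      by rewrite -(flatXM p h) -(flatXM ('X * p) h) [LHS]mulrA mulVf ?mul1r//; near: h; exact: nbhs_dnbhs_neq.
    rewrite normrM.
    have : `|h| <= e / C.
      near: h; apply: nbhs_dnbhs.
      by apply: (@nbhs0_le _ R); rewrite divr_gt0.
    rewrite ler_pdivlMr//; apply: le_trans.
    exact: ler_wpM2l.
  by apply: DeriveDef; [apply/cvg_ex; exists 0|exact: cvg_lim lim].
Unshelve. all: by end_near. Qed.

Lemma flat_smooth p : smooth (flat p).
Proof.
move=> n; elim: n p => [|n IH] p; last exact: (CkS_line (flat_is_derive p)).
split=> // x; apply/differentiable_continuous/derivable1_diffP.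
by case: (flat_is_derive p x).
Qed.

Lemma flat0 p x : x <= 0 -> flat p x = 0.
Proof. by rewrite /flat ltNge => ->. Qed.

End Flat.

(** * Borel sets of a product *)

Section Generators.

(** The coverings by generators serve to write a cylinder A x T2 as a countable
union of products of generators. *)
Lemma measurable_prodE d1 d2 (T1 : measurableType d1) (T2 : measurableType d2)
    (G1 : set (set T1)) (G2 : set (set T2)) (g1 : (set T1)^nat) (g2 : (set T2)^nat) :
  measurable = <<s G1>> -> measurable = <<s G2>> ->
  (forall n, G1 (g1 n)) -> (forall n, G2 (g2 n)) ->
  \bigcup_n g1 n = setT -> \bigcup_n g2 n = setT ->
  (@measurable _ (T1 * T2)%type) = <<s [set A `*` B | A in G1 & B in G2] >>.
Proof.
move=> GE1 GE2 Gg1 Gg2 cov1 cov2; rewrite eqEsubset; split; last first.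
  apply: smallest_sub; first exact: sigma_algebra_measurable.
  by move=> _ [A GA [B GB <-]]; apply: measurableX;
    [rewrite GE1|rewrite GE2]; exact: sub_sigma_algebra.
set GG := <<s [set A `*` B | A in G1 & B in G2] >>.
have sGG : sigma_algebra setT GG by exact: smallest_sigma_algebra.
have sub_preim (T : Type) (p : T1 * T2 -> T) (G : set (set T)) :
    (forall A, G A -> GG (p @^-1` A)) -> forall A, <<s G>> A -> GG (p @^-1` A).
  move=> GGG; apply: smallest_sub => //; split.
  - by rewrite /= preimage_set0; case: sGG.
  - by move=> A /= GA; rewrite setTD -preimage_setC -setTD; case: sGG => _ + _; apply.
  - by move=> F /= GF; rewrite preimage_bigcup; case: sGG => _ _; apply.
apply: smallest_sub => //; rewrite subUset; split.
- move=> _ [A mA <-]; rewrite setTI; move: mA; rewrite GE1; apply: sub_preim => B GB.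
  have -> : fst @^-1` B = \bigcup_n (B `*` g2 n).
    by rewrite -setX_bigcupr cov2; apply/seteqP; split => [x|x []].
  case: sGG => _ _; apply => n; apply: sub_sigma_algebra.
  by exists B => //; exists (g2 n).
- move=> _ [A mA <-]; rewrite setTI; move: mA; rewrite GE2; apply: sub_preim => B GB.
  have -> : snd @^-1` B = \bigcup_n (g1 n `*` B).
    by rewrite -setX_bigcupl cov1; apply/seteqP; split => [x|x []].
  case: sGG => _ _; apply => n; apply: sub_sigma_algebra.
  by exists (g1 n) => //; exists B.
Qed.

Lemma setI_closed_prod (T1 T2 : Type) (G1 : set (set T1)) (G2 : set (set T2)) :
  setI_closed G1 -> setI_closed G2 -> setI_closed [set A `*` B | A in G1 & B in G2].
Proof.
move=> I1 I2 _ _ [A GA [B GB <-]] [A' GA' [B' GB' <-]].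
by rewrite -setXI; exists (A `&` A'); [exact: I1|exists (B `&` B'); [exact: I2|]].
Qed.

(** The sets over which h has integral 0 form a Dynkin system. *)
Lemma integral_pi_lambda d (T : measurableType d) (R : realType)
    (mu : {measure set T -> \bar R}) (G : set (set T)) (h : T -> \bar R) :
  measurable = <<s G>> -> setI_closed G -> mu.-integrable setT h ->
  (\int[mu]_x h x = 0)%E -> (forall A, G A -> (\int[mu]_(x in A) h x = 0)%E) ->
  forall A, measurable A -> (\int[mu]_(x in A) h x = 0)%E.
Proof.
move=> GE GI ih hT hG A; rewrite GE.
have iS B : measurable B -> mu.-integrable B h.
  by move=> mB; apply: integrableS ih.
apply: (dynkin_induction (P := fun A => \int[mu]_(x in A) h x = 0)%E) => //.
- move=> S mS S0.
  have : (\int[mu]_(x in S `|` ~` S) h x = 0)%E by rewrite setUv.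
  rewrite integral_setU//; last 3 first.
  + exact: measurableC.
  + by apply: measurable_funS (measurable_int _ ih) => //.
  + by apply/disj_setPS; rewrite setICr.
  by rewrite S0 add0e.
- move=> F mF tF F0; rewrite integral_bigcup//; last exact/iS/bigcup_measurable.
  by rewrite eseries0.
Qed.

End Generators.

Section MeasurableBase.

(** A countable base of the topology of U, pulled back along c and made of
measurable sets. It transfers to products, and it forces open sets to be
measurable: the sigma-algebra of a product is generated by rectangles, while
an open set is only a union of open rectangles, possibly uncountable. *)
Definition measurable_base d (T : measurableType d) (U : topologicalType)
   (c : T -> U) := exists I : countType, exists B : I -> set T,
  (forall i, measurable (B i)) /\
  forall (O : set U) x, open O -> O (c x) -> exists2 i, B i x & B i `<=` c @^-1` O.
Arguments measurable_base {d T U} c.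

Lemma measurable_base_open d (T : measurableType d) (U : topologicalType) (c : T -> U) O :
  measurable_base c -> open O -> measurable (c @^-1` O).
Proof.
move=> [I [B [mB BU]]] oU.
pose F n := if unpickle n is Some i then
  (if `[< B i `<=` c @^-1` O >] then B i else set0) else set0.
rewrite (_ : c @^-1` O = \bigcup_n F n).
  by apply: bigcup_measurable => n _; rewrite /F; case: unpickle => // i; case: ifPn.
apply/seteqP; split => [x Ux|x [n _]].
  have [i Bx BO] := BU _ _ oU Ux; exists (pickle i) => //.
  by rewrite /F pickleK; case: asboolP.
by rewrite /F; case: unpickle => // i; case: asboolP => // + Bx; exact.
Qed.

Lemma measurable_base_prod d1 d2 (T1 : measurableType d1) (T2 : measurableType d2)
    (U1 U2 : topologicalType) (c1 : T1 -> U1) (c2 : T2 -> U2) :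
  measurable_base c1 -> measurable_base c2 ->
  @measurable_base _ (T1 * T2)%type (U1 * U2)%type (fun x => (c1 x.1, c2 x.2)).
Proof.
move=> [I1 [B1 [mB1 BU1]]] [I2 [B2 [mB2 BU2]]].
exists (I1 * I2)%type, (fun i => B1 i.1 `*` B2 i.2); split.
  by move=> i; exact: measurableX.
move=> O x oO Ox.
have [[/= V1 V2] [/= nV1 nV2] VO] : nbhs (c1 x.1, c2 x.2) O by exact: open_nbhs_nbhs.
move: nV1 nV2; rewrite !nbhsE => -[W1 [oW1 W1x] WV1] [W2 [oW2 W2x] WV2].
have [i1 B1x B1W] := BU1 _ _ oW1 W1x.
have [i2 B2x B2W] := BU2 _ _ oW2 W2x.
exists (i1, i2) => // -[y1 y2] [/= y1B y2B]; apply: VO; split => /=.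
  exact/WV1/B1W.
exact/WV2/B2W.
Qed.

Lemma measurable_base_line (R : realType) :
  @measurable_base _ (measurableTypeR R) R id.
Proof.
exists (rat * rat)%type, (fun q => `]ratr q.1, ratr q.2[%classic); split.
  by move=> q; exact: measurable_itv.
move=> O x oO Ox.
have : nbhs x O by exact: open_nbhs_nbhs.
move=> /nbhs_ballP[e /= e0 xeO].
have [p /itvP px] := @rat_in_itvoo R (x - e) x (ltac:(by rewrite ltrBlDr ltrDl)).
have [q /itvP qx] := @rat_in_itvoo R x (x + e) (ltac:(by rewrite ltrDl)).
exists (p, q) => /=; first by rewrite in_itv /= px qx.
move=> y /=; rewrite in_itv /= => /andP[py yq]; apply: xeO.
rewrite /ball /= ltr_distlC; apply/andP; split.
  by apply: lt_trans py; rewrite px.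
by apply: (lt_trans yq); rewrite qx.
Qed.

End MeasurableBase.

Section Space.
Context {R : realType}.

Lemma open_measurable_space3 (O : set (space3 R)) : open O -> measurable O.
Proof.
move=> oO.
have b : @measurable_base _ (space3 R) (space3 R) (fun x => ((x.1.1, x.1.2), x.2)).
  apply: (@measurable_base_prod _ _ (timeline R * timeline R)%type (timeline R) (R * R)%type R (fun x => (x.1, x.2)) id).
    apply: (@measurable_base_prod _ _ (timeline R) (timeline R) R R id id); exact: measurable_base_line.
  exact: measurable_base_line.
have := measurable_base_open b oO.
by rewrite (_ : _ @^-1` O = O)//; apply/seteqP; split => -[[x y] z].
Qed.

Lemma compact_measurable_space3 (K : set (space3 R)) : compact K -> measurable K.
Proof.
move=> cK; have : closed K by apply: compact_closed.
by move=> /closed_openC/open_measurable_space3/measurableC; rewrite setCK.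
Qed.

End Space.

(** * Tensor products of functions of one variable *)

Definition o0 : 'I_3 := @Ordinal 3 0 isT.
Definition o1 : 'I_3 := @Ordinal 3 1 isT.
Definition o2 : 'I_3 := @Ordinal 3 2 isT.

Lemma ord3_ind (P : 'I_3 -> Prop) : P o0 -> P o1 -> P o2 -> forall i, P i.
Proof.
move=> P0 P1 P2 [[|[|[|//]]] p].
- by rewrite (_ : Ordinal p = o0)//; exact: val_inj.
- by rewrite (_ : Ordinal p = o1)//; exact: val_inj.
- by rewrite (_ : Ordinal p = o2)//; exact: val_inj.
Qed.

Section Tens.
Context {R : realType}.
Implicit Types (g : 'I_3 -> R -> R) (x : space3 R).

Definition tens g : space3 R -> R := fun x => g o0 x.1.1 * g o1 x.1.2 * g o2 x.2.

Definition upd {T : Type} (g : 'I_3 -> T) (j : 'I_3) (h : T) : 'I_3 -> T :=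
  fun i => if i == j then h else g i.

Definition ccube (M : R) : set (space3 R) :=
  `[- M, M]%classic `*` `[- M, M]%classic `*` `[- M, M]%classic.

Lemma compact_ccube M : compact (ccube M).
Proof. by apply: compact_setX; first apply: compact_setX; exact: segment_compact. Qed.

Lemma measurable_ccube M : measurable (ccube M).
Proof. exact: compact_measurable_space3 (compact_ccube (M := M)). Qed.

Lemma continuous_coord0 : continuous (fst \o fst : space3 R -> R).
Proof. by move=> x; apply: continuous_comp; exact: cvg_fst. Qed.

Lemma continuous_coord1 : continuous (snd \o fst : space3 R -> R).
Proof. by move=> x; apply: continuous_comp; [exact: cvg_fst|exact: cvg_snd]. Qed.

Lemma continuous_coord2 : continuous (snd : space3 R -> R).
Proof. by move=> x; exact: cvg_snd. Qed.

Lemma smooth_comp_affine {V W : normedModType R} (L : {linear V -> W}) (c : W) (g : W -> R) :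
  continuous L -> smooth g -> smooth (fun y => g (L y + c)).
Proof. by move=> cL sg n; exact: Ck_comp_affine. Qed.

Lemma smooth_comp_linear {V W : normedModType R} (L : {linear V -> W}) (g : W -> R) :
  continuous L -> smooth g -> smooth (fun y => g (L y)).
Proof.
move=> cL sg; have := smooth_comp_affine 0 cL sg.
by under [X in smooth X -> _]eq_fun do rewrite addr0.
Qed.

Lemma smooth_tens g : (forall i, smooth (g i)) -> smooth (tens g).
Proof.
move=> sg; apply: smoothM; first apply: smoothM.
- exact: (@smooth_comp_linear _ R (fst \o fst) _ continuous_coord0).
- exact: (@smooth_comp_linear _ R (snd \o fst) _ continuous_coord1).
- exact: (@smooth_comp_linear _ R snd _ continuous_coord2).
Qed.

Lemma is_derive_comp_linear {V : normedModType R} (L : {linear V -> R}) (g : R -> R) (x v : V) :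
  smooth g -> is_derive x v (fun y => g (L y)) (L v * 'D_1 g (L x)).
Proof.
move=> sg; have [d1 d2] := derive_comp_affine L 0 g x v.
have -> : (fun y => g (L y)) = (fun y => g (L y + 0)).
  by apply/funext => y; rewrite addr0.
rewrite addr0 in d1 d2.
have := is_derive_dir (L v) (smooth_is_derive (L x) 1 sg).
by case=> dg <-; rewrite -d2; apply: DeriveDef => //; exact: d1.
Qed.

(** Only the factor of index j depends on the j-th coordinate. *)
Lemma derive_tens g j x : (forall i, smooth (g i)) ->
  'D_(basis3 j) (tens g) x = tens (upd g j ('D_1 (g j))) x.
Proof.
move=> sg.
have d0 := @is_derive_comp_linear _ (fst \o fst) (g o0) x (basis3 j) (sg o0).
have d1 := @is_derive_comp_linear _ (snd \o fst) (g o1) x (basis3 j) (sg o1).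
have d2 := @is_derive_comp_linear _ snd (g o2) x (basis3 j) (sg o2).
have [_ ->] := is_deriveM (is_deriveM d0 d1) d2.
have scE (a b : R) : a *: b = a * b by [].
rewrite !scE /tens [X in X * ((basis3 j).2 * _)](_ : _ = g o0 x.1.1 * g o1 x.1.2)//.
elim/ord3_ind: j {d0 d1 d2}; rewrite /basis3 /upd /=.
- by rewrite mul0r mulr0 mul0r mulr0 !add0r mul1r; ring.
- by rewrite mul0r mulr0 mul0r mulr0 add0r addr0 mul1r; ring.
- by rewrite !mul0r !mulr0 addr0 mulr0 addr0 mul1r.
Qed.

Lemma measurable_tens g : (forall i, measurable_fun setT (g i)) ->
  measurable_fun setT (tens g).
Proof.
move=> mg; apply: measurable_funM; first apply: measurable_funM.
- by apply: (measurableT_comp (mg o0)); apply: measurableT_comp.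
- by apply: (measurableT_comp (mg o1)); apply: measurableT_comp.
- by apply: (measurableT_comp (mg o2)).
Qed.

Lemma tens_eq0 g x : (exists i, g i (coord3 x i) = 0) -> tens g x = 0.
Proof.
by rewrite /tens => -[]; elim/ord3_ind => /= ->; rewrite ?(mul0r, mulr0).
Qed.

Lemma tens_norm_le g x (c : 'I_3 -> R) : (forall i, `|g i (coord3 x i)| <= c i) ->
  `|tens g x| <= c o0 * c o1 * c o2.
Proof.
move=> h; rewrite /tens !normrM.
have h0 := h o0; have h1 := h o1; have h2 := h o2.
by rewrite ler_pM ?mulr_ge0// ler_pM.
Qed.

Lemma tensM g g' x : tens g x * tens g' x = tens (fun i y => g i y * g' i y) x.
Proof. by rewrite /tens; ring. Qed.

Definition supported (M : R) (g : R -> R) := forall y : R, M < `|y| -> g y = 0.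

Lemma not_ccube M x : ~ ccube M x -> exists i, M < `|coord3 x i|.
Proof.
move=> nx; apply: contra_notP nx => /forallNP h.
by split; first split; rewrite /= in_itv /= -ler_norml leNgt; apply/negP;
  [exact: (h o0)|exact: (h o1)|exact: (h o2)].
Qed.

Lemma tens_out M g x : (forall i, supported M (g i)) -> ~ ccube M x -> tens g x = 0.
Proof.
by move=> sM /not_ccube[i iM]; apply: tens_eq0; exists i; exact: sM.
Qed.

Lemma test_fun_tens M g : (forall i, smooth (g i)) -> (forall i, supported M (g i)) ->
  test_fun setT (tens g).
Proof.
move=> sg sM; split; first exact: smooth_tens.
by exists (ccube M); split=> // [|x]; [exact: compact_ccube|exact: tens_out].
Qed.

End Tens.

(** * The volume and its generating boxes *)

Section Vol.
Context {R : realType}.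

Lemma vol_prod (A B C : set R) : measurable A -> measurable B -> measurable C ->
  vol R (A `*` B `*` C) = (leb R A * leb R B * leb R C)%E.
Proof.
move=> mA mB mC; rewrite product_measure1E//; last exact: measurableX.
by congr (_ * _)%E; exact: product_measure1E.
Qed.

Lemma vol_ccube (M : R) : 0 <= M -> vol R (ccube M) = ((2 * M) ^+ 3)%:E.
Proof.
move=> M0; rewrite vol_prod//.
have -> : leb R (`[- M, M]%classic : set R) = (2 * M)%:E.
  rewrite lebesgue_measure_itv /= lte_fin; case: ltP => [MM|MM].
    by rewrite -EFinD opprK mulr_natl mulr2n.
  have -> : M = 0 by apply/eqP; rewrite eq_le M0 andbT; lra.
    by rewrite mulr0.
by rewrite -!EFinM exprS expr2 mulrA.
Qed.

Lemma in_ccube (x : space3 R) M : ccube M x <-> forall i, `|coord3 x i| <= M.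
Proof.
rewrite /ccube /=; split => [[[]]|h].
  by rewrite /= !in_itv /= -!ler_norml => ? ? ?; elim/ord3_ind.
by rewrite !in_itv /= -!ler_norml; split; first split;
  [exact: (h o0)|exact: (h o1)|exact: (h o2)].
Qed.

Lemma ccube_exhaust (x : space3 R) : exists N : nat, forall n, (N <= n)%N -> ccube n%:R x.
Proof.
pose M := `|coord3 x o0| + `|coord3 x o1| + `|coord3 x o2|.
have M0 : 0 <= M by rewrite !addr_ge0.
exists (Num.truncn M).+1 => n Nn; apply/in_ccube => i.
have iM : `|coord3 x i| <= M.
  have h0 := normr_ge0 (coord3 x o0); have h1 := normr_ge0 (coord3 x o1).
  have h2 := normr_ge0 (coord3 x o2).
  by elim/ord3_ind: i; rewrite /M; lra.
apply: (le_trans iM); apply: (le_trans (ltW (truncnS_gt M))).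
by rewrite ler_nat.
Qed.

Lemma bigcup_ccube : \bigcup_n (@ccube R n%:R) = setT.
Proof.
apply/seteqP; split => // x _; have [N h] := ccube_exhaust x.
by exists N => //; exact: h.
Qed.

Lemma vol_sigma_finite : sigma_finite setT (vol R).
Proof.
exists (fun n => ccube n%:R); first by rewrite bigcup_ccube.
by move=> n; split; [exact: measurable_ccube|rewrite vol_ccube// ltry].
Qed.

(** The same measure under a name that can carry the sigma-finiteness required
by the theorems of Fubini and Tonelli. *)
Definition volume : set (space3 R) -> \bar R := vol R.
HB.instance Definition _ := Measure.on volume.
HB.instance Definition _ := Measure_isSigmaFinite.Build _ _ _ volume vol_sigma_finite.

(** Left-open right-closed boxes are stable under intersection and generate the
Borel sets, so they determine a measure. *)
Definition ocboxes : set (set (space3 R)) :=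
  [set A `*` B | A in [set A `*` B | A in @ocitv R & B in @ocitv R] & B in @ocitv R].

Lemma measurable_space3E : (@measurable _ (space3 R)) = <<s ocboxes>>.
Proof.
pose g1 (n : nat) : set R := `]- n%:R, n%:R]%classic.
have og n : ocitv (g1 n) by exists (- n%:R, n%:R).
have cov : \bigcup_n g1 n = setT.
  apply/seteqP; split => // x _; exists (Num.truncn `|x|).+1 => //=.
  rewrite /g1 /= in_itv /=; have := truncnS_gt `|x|; rewrite ltr_norml => /andP[-> /ltW ->].
  by [].
apply: (@measurable_prodE _ _ _ _ _ _ (fun n => g1 n `*` g1 n) g1) => //.
- by apply: (@measurable_prodE _ _ _ _ _ _ g1 g1).
- by move=> n; exists (g1 n) => //; exists (g1 n).
- apply/seteqP; split => // -[x y] _.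
  have [n _ nx] : (\bigcup_n g1 n) x by rewrite cov.
  have [m _ my] : (\bigcup_n g1 n) y by rewrite cov.
  have gm i j : (i <= j)%N -> g1 i `<=` g1 j.
    move=> ij z; rewrite /g1 /= !in_itv /= => /andP[zi zi'].
    have := ij; rewrite -(ler_nat R) => ijR; apply/andP; split; lra.
  by exists (maxn n m) => //; split => /=;
    [apply: gm nx; exact: leq_maxl|apply: gm my; exact: leq_maxr].
Qed.

Lemma ocboxesI : setI_closed ocboxes.
Proof.
by apply: setI_closed_prod; [apply: setI_closed_prod|]; exact: ocitvI.
Qed.

Lemma ocboxes_measurable A : ocboxes A -> measurable A.
Proof. by rewrite measurable_space3E => ?; exact: sub_sigma_algebra. Qed.

Lemma integral_mul_indic d (T : measurableType d) (mu : {measure set T -> \bar R})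
  (A : set T) (f : T -> R) :
  (\int[mu]_(x in A) (f x)%:E = \int[mu]_x (f x * \1_A x)%:E)%E.
Proof.
rewrite integral_mkcond; apply: eq_integral => x _.
by rewrite patchE indicE; case: ifPn; rewrite ?mulr1// mulr0.
Qed.

(** Restricted to a bounded box, h has integral 0 over the boxes, hence over all
Borel sets by the Dynkin argument, hence it vanishes almost everywhere; the
bounded boxes of integer size exhaust the space. *)
Lemma boxes_ae0 (h : space3 R -> R) :
  (forall n : nat, (vol R).-integrable (ccube n%:R) (EFin \o h)) ->
  (forall A, ocboxes A -> \int[vol R]_x (h x * \1_A x) = 0) ->
  \forall x \ae vol R, h x = 0.
Proof.
move=> ih h0.
pose B (n : nat) : set (space3 R) :=
  (`]- n%:R, n%:R] `*` `]- n%:R, n%:R] `*` `]- n%:R, n%:R])%classic.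
have oB n : ocboxes (B n).
  by eexists; last (eexists; [by exists (- n%:R, n%:R)|]); last first;
     [reflexivity|eexists; last (eexists; [by exists (- n%:R, n%:R)|])];
     last first; [reflexivity|by exists (- n%:R, n%:R)].
have mB n : measurable (B n) by exact: ocboxes_measurable.
have Bc n : B n `<=` ccube n%:R.
  by move=> x [[/= + +] +]; rewrite !in_itv /= => /andP[/ltW ? ?] /andP[/ltW ? ?] /andP[/ltW ? ?];
    split; first split; rewrite /= in_itv /=; apply/andP.
have iB n : (vol R).-integrable setT (fun x => (h x * \1_(B n) x)%:E).
  have : (vol R).-integrable (B n) (EFin \o h).
    by apply: integrableS (ih n) => //; exact: measurable_ccube.
  move/(integrable_mkcond _ (mB n)) => /=; apply: eq_integrable => // x _.
  by rewrite patchE indicE; case: ifPn; rewrite ?mulr1// mulr0.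
have int0 n A : ocboxes A -> (\int[vol R]_(x in A) (h x * \1_(B n) x)%:E = 0)%E.
  move=> oA; rewrite integral_mul_indic.
  under eq_integral do rewrite -mulrA -[_ * \1_A _]/((\1_(B n) \* \1_A)%R _) -indicI.
  have oBA : ocboxes (B n `&` A) by exact: ocboxesI.
  have := h0 _ oBA; rewrite /Rintegral => f0.
  rewrite -[LHS]fineK ?f0//; apply: integrable_fin_num => //.
  move: (iB n) => /(integrableS measurableT (ocboxes_measurable oA)) => /(_ (@subsetT _ _)).
  move/(integrable_mkcond _ (ocboxes_measurable oA)) => /=; apply: eq_integrable => // x _.
  rewrite patchE indicI /=; rewrite [\1_A x]indicE; case: ifPn; rewrite ?mulr1//= !mulr0//.
have ae0 n : \forall x \ae vol R, h x * \1_(B n) x = 0.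
  have : ae_eq (vol R) setT (fun x => (h x * \1_(B n) x)%:E) (cst 0%E).
    apply: integral_ae_eq => // E _ mE.
    rewrite [RHS]integral0 (integral_pi_lambda measurable_space3E ocboxesI (iB n))//.
    - by rewrite -(int0 n _ (oB n)) [RHS]integral_mul_indic; apply: eq_integral => x _;
        rewrite -mulrA [\1_(B n) x]indicE; case: (_ \in _); rewrite ?mulr1// !mulr0.
    - exact: int0.
  by apply: filterS => x /(_ I) [].
have : \forall x \ae vol R, forall n : nat, h x * \1_(B n) x = 0 by apply: ae_foralln.
apply: filterS => x hx; have [N h1] := ccube_exhaust x.
have := hx N.+1; rewrite indicE mem_set ?mulr1//.
have /in_ccube cx := h1 N (leqnn N).
have hN (i : 'I_3) : - N.+1%:R < coord3 x i <= N.+1%:R.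
  have := cx i; rewrite ler_norml => /andP[? ?].
  by rewrite -natr1; apply/andP; split; lra.
by split; first split; rewrite /= in_itv /=; [exact: (hN o0)|exact: (hN o1)|exact: (hN o2)].
Qed.

End Vol.

(** * The fundamental lemma of the calculus of variations *)

Section Dct.
Context d (T : measurableType d) (R : realType) (mu : {measure set T -> \bar R}).

Lemma integrable_le (f g : T -> R) : measurable_fun setT f ->
  mu.-integrable setT (EFin \o g) -> (forall x, `|f x| <= g x) ->
  mu.-integrable setT (EFin \o f).
Proof.
move=> mf ig fg; apply: le_integrable ig => //; first exact/measurable_EFinP.
by move=> x _ /=; rewrite lee_fin (le_trans (fg x))// ler_norm.
Qed.

Lemma integrable_mul_indic (f : T -> R) (A : set T) : measurable A ->
  mu.-integrable A (EFin \o f) <-> mu.-integrable setT (EFin \o (fun x => f x * \1_A x)).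
Proof.
move=> mA; have -> : EFin \o (fun x => f x * \1_A x) = (EFin \o f) \_ A.
  by apply/funext => x; rewrite patchE /= indicE; case: ifPn; rewrite ?mulr1// mulr0.
exact: integrable_mkcond.
Qed.

Lemma Rintegral_dct (F_ : nat -> T -> R) (F G : T -> R) :
  (forall n, measurable_fun setT (F_ n)) ->
  (forall x, F_ n x @[n --> \oo] --> F x) ->
  mu.-integrable setT (EFin \o G) -> (forall n x, `|F_ n x| <= G x) ->
  mu.-integrable setT (EFin \o F) /\
  (\int[mu]_x F_ n x @[n --> \oo] --> \int[mu]_x F x).
Proof.
move=> mF cF iG FG.
have mFF : measurable_fun setT F by apply: (measurable_fun_cvg mF) => x _; exact: cF.
have [] := @dominated_convergence _ _ _ mu setT measurableT
  (fun n => EFin \o F_ n) (EFin \o F) (EFin \o G).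
- by move=> n; exact/measurable_EFinP.
- exact/measurable_EFinP.
- by apply: aeW => x _; apply: cvg_EFin; [exact: nearW|exact: cF].
- exact: iG.
- by apply: aeW => x n _ /=; rewrite lee_fin.
move=> iF _ cv; split => //.
have fF : (\int[mu]_x (EFin \o F) x \is a fin_num)%E by exact: integrable_fin_num.
by rewrite -(fineK fF) in cv; exact: (fine_cvg cv).
Qed.

End Dct.

Section Appr.
Context {R : realType}.

(** Multiplication by a scalar as a linear map, for the composition of a smooth
function with an affine function. *)
Definition scal (c : R) : R -> R := fun x => c * x.
Lemma scal_linear c : linear (scal c).
Proof. by move=> k x y; rewrite /scal /= mulrDr; congr (_ + _); rewrite mulrCA. Qed.
HB.instance Definition _ c := GRing.isLinear.Build R R R _ (scal c) (scal_linear c).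

Lemma scal_continuous c : continuous (scal c).
Proof. by move=> x; apply: cvgM; [exact: cvg_cst|exact: cvg_id]. Qed.

Lemma smooth_affine (g : R -> R) (c d : R) : smooth g -> smooth (fun x : R => g (c * x + d)).
Proof. exact: (@smooth_comp_affine _ R R (scal c) d g (scal_continuous (c := c))). Qed.

Lemma flat1_ge0 (x : R) : 0 <= flat 1 x.
Proof. by rewrite /flat; case: ifP => //; rewrite hornerE mul1r expR_ge0. Qed.

Lemma flat1_le1 (x : R) : flat 1 x <= 1.
Proof.
by rewrite /flat; case: ifP => // x0; rewrite hornerE mul1r expR_le1 oppr_le0 invr_ge0 ltW.
Qed.

Lemma flat1_cvg (u : nat -> R) (c : R) : 0 < c -> (forall n, n.+1%:R * c <= u n) ->
  flat 1 (u n) @[n --> \oo] --> (1 : R).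
Proof.
move=> c0 cu.
apply: (@squeeze_cvgr _ _ _ _ (fun n => 1 - harmonic n * c^-1) (cst 1)).
- apply: nearW => n; rewrite flat1_le1 andbT /flat.
  have un0 : 0 < u n by apply: lt_le_trans (cu n); rewrite mulr_gt0.
  rewrite un0 hornerE mul1r; apply: le_trans (expR_ge1Dx _).
  by rewrite lerD2l lerN2 /= -invfM lef_pV2// posrE// mulr_gt0.
- rewrite -[X in _ --> X]subr0; apply: cvgB; first exact: cvg_cst.
  by rewrite -[X in _ --> X](mul0r c^-1); apply: cvgMl; exact: cvg_harmonic.
- exact: cvg_cst.
Qed.

(** Smooth functions with a compact support that does not depend on n, and which
tend pointwise to the indicator of ]a, b]. The first factor vanishes up to a.
The second one is switched off only at b + 1/(n+1), so that its value at b
still tends to 1; this is why its slope is the square of the other slope. *)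
Definition ivl_approx (a b : R) (n : nat) (x : R) : R :=
  flat 1 (n.+1%:R * x - n.+1%:R * a) *
  flat 1 (- n.+1%:R ^+ 2 * x + (n.+1%:R ^+ 2 * b + n.+1%:R)).

Lemma ivl_approx_smooth a b n : smooth (ivl_approx a b n).
Proof. by apply: smoothM; apply: smooth_affine; exact: flat_smooth. Qed.

Lemma ivl_approx_bound a b n x : `|ivl_approx a b n x| <= 1.
Proof.
by rewrite normrM !ger0_norm ?flat1_ge0// mulr_ile1 ?flat1_ge0 ?flat1_le1.
Qed.

Lemma ivl_approx_supported a b n : supported (`|a| + `|b| + 1) (ivl_approx a b n).
Proof.
move=> x; rewrite ltr_normr => /orP[] xM; rewrite /ivl_approx.
  rewrite [X in _ * X]flat0 ?mulr0//.
  have bx : b + 1 <= x.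
    have := ler_norm b; have := normr_ge0 a; lra.
  have n1 : 1 <= n.+1%:R :> R by rewrite ler1n.
  have : n.+1%:R <= n.+1%:R ^+ 2 * (x - b) :> R.
    rewrite expr2 -mulrA ler_peMr// ?ler0n//; apply: (le_trans n1).
    by rewrite ler_peMr//; lra.
  rewrite mulrBr; lra.
rewrite [X in X * _]flat0 ?mul0r//.
rewrite -mulrBr mulr_ge0_le0//.
have := ler_norm (- a); rewrite normrN; have := normr_ge0 b; lra.
Qed.

Lemma ivl_approx_cvg a b x : ivl_approx a b n x @[n --> \oo] --> (\1_(`]a, b]%classic) x : R).
Proof.
rewrite indicE.
have [ax|xa] := ltP a x; last first.
  rewrite memNset; last by rewrite /= in_itv /= ltNge xa.
  apply: cvg_near_cst; apply: nearW => n; rewrite /ivl_approx [X in X * _]flat0 ?mul0r//.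
  by rewrite -mulrBr mulr_ge0_le0// subr_le0.
have [xb|bx] := leP x b.
  rewrite mem_set; last by rewrite /= in_itv /= ax.
  rewrite -[X in _ --> X]mulr1; apply: cvgM.
    apply: (@flat1_cvg _ (x - a)); first by rewrite subr_gt0.
    by move=> n; rewrite mulrBr.
  apply: (@flat1_cvg _ 1) => // n; rewrite mulr1 addrA lerDr mulNr addrC -mulrBr.
  by rewrite mulr_ge0 ?sqr_ge0// subr_ge0.
rewrite memNset; last by rewrite /= in_itv /= ax /= leNgt bx.
apply: cvg_near_cst.
near=> n; rewrite /ivl_approx [X in _ * X]flat0 ?mulr0//.
have : (x - b)^-1 <= n.+1%:R.
  near: n; exists (Num.truncn (x - b)^-1) => // n /= hn.
  by apply: (le_trans (ltW (truncnS_gt _))); rewrite ler_nat ltnS.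
rewrite -[X in X <= _]mul1r ler_pdivrMr ?subr_gt0// => h.
have : n.+1%:R <= n.+1%:R ^+ 2 * (x - b) by rewrite expr2 -mulrA ler_peMr.
rewrite mulrBr mulNr; lra.
Unshelve. all: by end_near. Qed.

End Appr.

Section Fundamental.
Context {R : realType}.
Implicit Types f g h : space3 R -> R.

Lemma loc_integrable_ccube h M : loc_integrable h -> (vol R).-integrable (ccube M) (EFin \o h).
Proof. by apply; exact: compact_ccube. Qed.

Lemma loc_integrable_measurable h : loc_integrable h -> measurable_fun setT h.
Proof.
move=> lh; rewrite -bigcup_ccube; apply/measurable_fun_bigcup => n.
  exact: measurable_ccube.
by have /measurable_int/measurable_EFinP := loc_integrable_ccube n%:R lh.
Qed.

(** Every compact set lies in a cube. *)
Lemma loc_integrableP h : measurable_fun setT h ->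
  (forall M, 0 <= M -> (vol R).-integrable (ccube M) (EFin \o h)) -> loc_integrable h.
Proof.
move=> mh ih K cK.
have bd (f : space3 R -> R) : continuous f -> exists2 M, 0 <= M & forall x, K x -> `|f x| <= M.
  move=> cf; have /compact_bounded [M [_ hM]] : compact (f @` K).
    by apply: continuous_compact => //; exact: continuous_subspaceT.
  exists (`|M| + 1) => [|x Kx]; first by rewrite addr_ge0.
  apply: (hM (`|M| + 1)); last by exists x.
  by rewrite (le_lt_trans (ler_norm M))// ltrDl.
have [M0 M00 h0] := bd _ continuous_coord0.
have [M1 M10 h1] := bd _ continuous_coord1.
have [M2 M20 h2] := bd _ continuous_coord2.
have M3 : 0 <= M0 + M1 + M2 by rewrite !addr_ge0.
apply: integrableS (ih _ M3) => //; [exact: measurable_ccube|exact: compact_measurable_space3|].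
move=> x Kx; apply/in_ccube; elim/ord3_ind; rewrite /coord3 /=.
- apply: (le_trans (h0 x Kx)); lra.
- apply: (le_trans (h1 x Kx)); lra.
- apply: (le_trans (h2 x Kx)); lra.
Qed.

Lemma smooth_measurable (g : R -> R) : smooth g -> measurable_fun setT g.
Proof.
move=> /smooth_continuous cg; apply: continuous_measurable_fun.
exact: cg.
Qed.

Definition box (a b : 'I_3 -> R) : set (space3 R) :=
  `]a o0, b o0]%classic `*` `]a o1, b o1]%classic `*` `]a o2, b o2]%classic.

Lemma ocboxesP A : ocboxes A -> exists a b, A = box a b.
Proof.
move=> [_ [_ [[a0 b0] _ <-] [_ [[a1 b1] _ <-] <-]] [_ [[a2 b2] _ <-] <-]] /=.
by exists (fun i : 'I_3 => nth 0 [:: a0; a1; a2] i), (fun i : 'I_3 => nth 0 [:: b0; b1; b2] i).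
Qed.

Lemma indic_box a b x :
  \1_(box a b) x = tens (fun i => \1_(`]a i, b i]%classic) : R -> R) x.
Proof.
rewrite /tens !indicE -!natrM !mulnb; congr (nat_of_bool _)%:R.
by apply/idP/idP => [/set_mem[[? ?] ?]|/andP[/andP[/set_mem ? /set_mem ?] /set_mem ?]];
  [rewrite !mem_set|rewrite mem_set].
Qed.

(** A tensor product of smooth approximations of three interval indicators is a
test function that approximates the indicator of a box; by dominated
convergence the integrals of h over the boxes vanish. *)
Lemma weak_zero h : loc_integrable h ->
  (forall phi, test_fun setT phi -> \int[vol R]_x (h x * phi x) = 0) ->
  \forall x \ae vol R, h x = 0.
Proof.
move=> lh h0; apply: boxes_ae0 => [n|]; first exact: loc_integrable_ccube.
move=> _ /ocboxesP[a [b ->]].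
pose M := (`|a o0| + `|b o0| + 1) + (`|a o1| + `|b o1| + 1) + (`|a o2| + `|b o2| + 1).
pose g n (i : 'I_3) := ivl_approx (a i) (b i) n.
have sg n i : supported M (g n i).
  move=> x Mx; apply: ivl_approx_supported; apply: le_lt_trans Mx.
  have := (normr_ge0 (a o0), normr_ge0 (a o1), normr_ge0 (a o2)).
  have := (normr_ge0 (b o0), normr_ge0 (b o1), normr_ge0 (b o2)).
  by move=> [[? ?] ?] [[? ?] ?]; elim/ord3_ind: i; rewrite /M; lra.
have smg n i : smooth (g n i) by exact: ivl_approx_smooth.
have mh := loc_integrable_measurable lh.
have [] := @Rintegral_dct _ _ _ (vol R) (fun n x => h x * tens (g n) x)
  (fun x => h x * \1_(box a b) x) (fun x => `|h x| * \1_(ccube M) x).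
- move=> n; apply: measurable_funM => //; apply: measurable_tens => i.
  exact: smooth_measurable.
- move=> x; apply: cvgM; first exact: cvg_cst.
  by rewrite indic_box; apply: cvgM; first apply: cvgM; exact: ivl_approx_cvg.
- apply/(integrable_mul_indic _ _ (@measurable_ccube R M)).
  by have /integrable_abse := loc_integrable_ccube M lh.
- move=> n x; rewrite normrM ler_wpM2l// indicE.
  case: (boolP (x \in ccube M)) => [_|/negP xM].
    by have := @tens_norm_le _ (g n) x (fun=> 1) (fun i => ivl_approx_bound _ _ _ _); rewrite !mulr1.
  by rewrite (@tens_out _ M) ?normr0// => xc; apply: xM; rewrite inE.
move=> _; under eq_cvg do rewrite (h0 _ (test_fun_tens (smg _) (sg _))).
by move=> /cvg_lim <-//; rewrite lim_cst.
Qed.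
End Fundamental.

(** * Weak partial derivatives *)

Section TestFun.
Context {R : realType}.
Implicit Types f g h phi : space3 R -> R.

Lemma continuous_measurable_space3 f : continuous f -> measurable_fun setT f.
Proof.
move=> /continuousP cf; apply: (measurability _ (RGenOpens.measurableE R)).
move=> _ [_ [a [b ->] <-]]; rewrite setTI; apply: open_measurable_space3.
exact/cf/interval_open.
Qed.

Lemma test_fun_continuous D phi : test_fun D phi -> continuous phi.
Proof. by move=> [/(_ 0%N)[]]. Qed.

Lemma test_fun_measurable D phi : test_fun D phi -> measurable_fun setT phi.
Proof. by move/test_fun_continuous/continuous_measurable_space3. Qed.

Lemma test_fun_bounded D phi : test_fun D phi -> exists K M,
  [/\ compact K, 0 <= M & forall x, `|phi x| <= M * \1_K x].
Proof.
move=> tp; have cp := test_fun_continuous tp; case: tp => _ [K [cK _ K0]].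
have /compact_bounded [M [_ hM]] : compact (phi @` K).
  by apply: continuous_compact => //; exact: continuous_subspaceT.
exists K, (`|M| + 1); split => //.
move=> x; rewrite indicE; case: (boolP (x \in K)) => [/set_mem Kx|/negP Kx].
  rewrite mulr1; apply: (hM (`|M| + 1)); last by exists x.
  by rewrite (le_lt_trans (ler_norm M))// ltrDl.
by rewrite K0 ?normr0 ?mulr0// => xK; apply: Kx; rewrite inE.
Qed.

Lemma integrable_mul_test D f phi : loc_integrable f -> test_fun D phi ->
  (vol R).-integrable setT (EFin \o (fun x => f x * phi x)).
Proof.
move=> lf tp; have [K [M [cK M0 pK]]] := test_fun_bounded tp.
have mK := compact_measurable_space3 cK.
have mf := loc_integrable_measurable lf.
apply: (@integrable_le _ _ _ _ _ (fun x => M * `|f x| * \1_K x)).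
- by apply: measurable_funM => //; exact: test_fun_measurable tp.
- apply/(integrable_mul_indic _ _ mK).
  have /integrable_abse := lf _ cK.
  by move=> /(integrableZl mK M); apply: eq_integrable.
- by move=> x; rewrite normrM mulrC mulrAC ler_wpM2r.
Qed.

Lemma test_fun_derive phi v : test_fun setT phi -> test_fun setT ('D_v phi).
Proof.
move=> [sp [K [cK KT K0]]]; split; first exact: smooth_derive.
exists K; split => // x Kx.
have cl : closed K by exact: compact_closed.
rewrite (@near_eq_derive _ _ _ _ (cst 0)); first by rewrite derive_cst.
by apply: filterS (open_nbhs_nbhs (conj (closed_openC cl) Kx)) => y; exact: K0.
Qed.

Lemma loc_integrableB f g : loc_integrable f -> loc_integrable g ->
  loc_integrable (fun x => f x - g x).
Proof.
move=> lf lg K cK; have mK := compact_measurable_space3 cK.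
by have := integrableB mK (lf _ cK) (lg _ cK); apply: eq_integrable.
Qed.

Lemma RintegralB_mul_test D f g phi : loc_integrable f -> loc_integrable g -> test_fun D phi ->
  \int[vol R]_x ((f x - g x) * phi x) =
  \int[vol R]_x (f x * phi x) - \int[vol R]_x (g x * phi x).
Proof.
move=> lf lg tp; rewrite -RintegralB//; [|exact: integrable_mul_test tp..].
by apply: eq_Rintegral => x _; rewrite mulrBl.
Qed.

Lemma is_weak_partial_unique i f g g' : is_weak_partial i f g -> is_weak_partial i f g' ->
  \forall x \ae vol R, g x = g' x.
Proof.
move=> [_ lg fg] [_ lg' fg'].
have : \forall x \ae vol R, g x - g' x = 0.
  apply: weak_zero => [|phi tphi]; first exact: loc_integrableB.
  rewrite (RintegralB_mul_test lg lg' tphi).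
  by apply/eqP; rewrite -eqr_opp opprB oppr0 addrC -fg// fg'// addNr.
by apply: filterS => x /eqP; rewrite subr_eq0 => /eqP.
Qed.

Lemma is_weak_partialB i f g df dg : is_weak_partial i f df -> is_weak_partial i g dg ->
  is_weak_partial i (fun x => f x - g x) (fun x => df x - dg x).
Proof.
move=> [lf ldf fE] [lg ldg gE]; split; [exact: loc_integrableB..|].
move=> phi tphi; rewrite (RintegralB_mul_test lf lg (test_fun_derive (basis3 i) tphi)).
by rewrite (RintegralB_mul_test ldf ldg tphi) fE// gE// opprB opprK addrC.
Qed.

Lemma weak_partialP i f g : is_weak_partial i f g -> is_weak_partial i f (weak_partial i f).
Proof. by move=> fg; rewrite /weak_partial; case: xgetP => [h -> //|/(_ g)/(_ fg)]. Qed.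

(** The weak derivative in use is a representative chosen for each function
separately, so it respects linear operations only almost everywhere. *)
Lemma weak_partialB i f g df dg : is_weak_partial i f df -> is_weak_partial i g dg ->
  is_weak_partial i (fun x => f x - g x) (weak_partial i (fun x => f x - g x)) /\
  \forall x \ae vol R, weak_partial i (fun x => f x - g x) x = df x - dg x.
Proof.
move=> wf wg; have w := is_weak_partialB wf wg; have w' := weak_partialP w.
by split => //; exact: is_weak_partial_unique w' w.
Qed.

Lemma loc_integrable_ae f g : measurable_fun setT g -> (\forall x \ae vol R, f x = g x) ->
  loc_integrable f -> loc_integrable g.
Proof.
move=> mg fg lf K cK; have mK := compact_measurable_space3 cK.
have mgK : measurable_fun K (EFin \o g) by exact/measurable_EFinP/measurable_funTS.
apply/integrableP; split => //.
have /integrableP[mf] := lf K cK; apply: le_lt_trans; rewrite le_eqVlt; apply/orP; left.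
apply/eqP; apply: ae_eq_integral => //.
- exact: measurableT_comp.
- exact: measurableT_comp.
- by apply: filterS fg => x /= ->.
Qed.

Lemma Rintegral_ae_eq f g : measurable_fun setT f -> measurable_fun setT g ->
  (\forall x \ae vol R, f x = g x) -> \int[vol R]_x f x = \int[vol R]_x g x.
Proof.
move=> mf mg fg; congr fine; apply: ae_eq_integral => //.
- exact/measurable_EFinP.
- exact/measurable_EFinP.
- by apply: filterS fg => x /= ->.
Qed.

Lemma is_weak_partial_ae i f f' g : measurable_fun setT f' ->
  (\forall x \ae vol R, f x = f' x) -> is_weak_partial i f g -> is_weak_partial i f' g.
Proof.
move=> mf' ff' [lf lg fg]; split => //; first exact: loc_integrable_ae lf.
move=> phi tphi; rewrite -fg//; have tD := test_fun_derive (basis3 i) tphi.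
apply: Rintegral_ae_eq.
- by apply: measurable_funM => //; exact: test_fun_measurable tD.
- apply: measurable_funM; last exact: test_fun_measurable tD.
  exact: loc_integrable_measurable.
- by apply: filterS ff' => x ->.
Qed.

(** Both functions have the same set of weak derivatives, hence the same chosen
representative: the equality holds at every point. *)
Lemma weak_partial_ae i f f' : measurable_fun setT f -> measurable_fun setT f' ->
  (\forall x \ae vol R, f x = f' x) -> weak_partial i f = weak_partial i f'.
Proof.
move=> mf mf' ff'; congr xget; apply/seteqP; split => g /=.
  exact: is_weak_partial_ae.
by apply: is_weak_partial_ae => //; apply: filterS ff' => x ->.
Qed.

End TestFun.

(** * Square integrable functions and Sobolev spaces of integer order *)

Section L2.
Context {R : realType}.
Implicit Types f g h : space3 R -> R.

(** The square of the L^2 norm. *)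
Definition sqint f : \bar R := (\int[vol R]_x (f x ^+ 2)%:E)%E.
Definition L2 f := measurable_fun setT f /\ (sqint f < +oo)%E.

Lemma sqint_ge0 f : (0 <= sqint f)%E.
Proof. by apply: integral_ge0 => x _; rewrite lee_fin sqr_ge0. Qed.

Lemma Lnorm2_sqr f : ('N[vol R]_2%:E[EFin \o f] ^+ 2)%E = sqint f.
Proof.
rewrite unlock poweR12_sqrt; last by apply: integral_ge0 => x _; exact: poweR_ge0.
rewrite sqr_sqrte; last by apply: integral_ge0 => x _; exact: poweR_ge0.
apply: eq_integral => x _ /=.
by rewrite powR_mulrn// -normrX ger0_norm ?sqr_ge0.
Qed.

Lemma Lfun2P f : f \in Lfun (vol R) 2%:E <-> L2 f.
Proof.
rewrite inE /=; split.
  move=> /andP[/[!inE]/= mf]; rewrite /finite_norm => ff; split => //.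
  rewrite -Lnorm2_sqr expe2 lte_mul_pinfty ?Lnorm_ge0// ge0_fin_numE ?Lnorm_ge0//.
move=> [mf ff]; apply/andP; split; rewrite inE /= // /finite_norm.
rewrite ltey; apply: contraTN ff => /eqP e.
by rewrite -Lnorm2_sqr e expe2 mulyy ltxx.
Qed.

Lemma sqint_ae f g : measurable_fun setT f -> measurable_fun setT g ->
  (\forall x \ae vol R, f x = g x) -> sqint f = sqint g.
Proof.
move=> mf mg fg; apply: ae_eq_integral => //.
- by apply/measurable_EFinP; exact: measurable_funX.
- by apply/measurable_EFinP; exact: measurable_funX.
- by apply: filterS fg => x /= ->.
Qed.

Lemma L2_measurable f : L2 f -> measurable_fun setT f.
Proof. by case. Qed.

Lemma L2_sqr f : L2 f -> (vol R).-integrable setT (EFin \o (fun x => f x ^+ 2)).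
Proof. by move=> /Lfun2P; exact: Lfun2_integrable_sqr. Qed.

Lemma normM_le_sqrD (a b : R) : `|a * b| <= a ^+ 2 + b ^+ 2.
Proof.
have h1 := sqr_ge0 (a - b); have h2 := sqr_ge0 (a + b).
have h3 := sqr_ge0 a; have h4 := sqr_ge0 b.
by rewrite ler_norml; apply/andP; split; nra.
Qed.

Lemma L2_mul f g : L2 f -> L2 g -> (vol R).-integrable setT (EFin \o (fun x => f x * g x)).
Proof.
move=> Lf Lg; apply: (@integrable_le _ _ _ _ _ (fun x => f x ^+ 2 + g x ^+ 2)).
- by apply: measurable_funM; exact: L2_measurable.
- by have := integrableD measurableT (L2_sqr Lf) (L2_sqr Lg); apply: eq_integrable.
- by move=> x; exact: normM_le_sqrD.
Qed.

Lemma L2_loc_integrable f : L2 f -> loc_integrable f.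
Proof.
move=> Lf; apply: loc_integrableP => [|M M0]; first exact: L2_measurable.
apply/(integrable_mul_indic _ _ (@measurable_ccube R M)).
apply: L2_mul => //; split; first exact: measurable_indic (measurable_ccube _).
rewrite (_ : sqint _ = vol R (ccube M)); first by rewrite vol_ccube// ltry.
have := integral_indic (vol R) measurableT (@measurable_ccube R M).
rewrite setIT => <-.
by apply: eq_integral => x _; rewrite indicE; case: (_ \in _); rewrite ?expr1n ?expr0n.
Qed.

Lemma sqint_measurable f : measurable_fun setT f -> measurable_fun setT (fun x => (f x ^+ 2)%:E).
Proof. by move=> mf; apply/measurable_EFinP; exact: measurable_funX. Qed.

Lemma sqintB_le f g : measurable_fun setT f -> measurable_fun setT g ->
  (sqint (fun x => f x - g x)%R <= 2%:E * sqint f + 2%:E * sqint g)%E.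
Proof.
move=> mf mg; rewrite /sqint -!ge0_integralZl//; last 4 first.
- exact: sqint_measurable.
- by move=> x _; rewrite lee_fin sqr_ge0.
- exact: sqint_measurable.
- by move=> x _; rewrite lee_fin sqr_ge0.
rewrite -ge0_integralD//; last 4 first.
- by move=> x _; rewrite lee_fin mulr_ge0 ?sqr_ge0.
- by apply/measurable_EFinP; apply: measurable_funM => //; exact: measurable_funX.
- by move=> x _; rewrite lee_fin mulr_ge0 ?sqr_ge0.
- by apply/measurable_EFinP; apply: measurable_funM => //; exact: measurable_funX.
apply: ge0_le_integral => //.
- by move=> x _; rewrite lee_fin sqr_ge0.
- by apply: sqint_measurable; exact: measurable_funB.
- by apply: emeasurable_funD; apply/measurable_EFinP; apply: measurable_funM => //;
    exact: measurable_funX.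
move=> x _; rewrite -!EFinM -EFinD lee_fin -subr_ge0.
by rewrite (_ : _ - _ = (f x + g x) ^+ 2) ?sqr_ge0//; ring.
Qed.

Lemma L2B f g : L2 f -> L2 g -> L2 (fun x => f x - g x).
Proof.
move=> [mf ff] [mg gg]; split; first exact: measurable_funB.
apply: le_lt_trans (sqintB_le mf mg) _.
by rewrite lte_add_pinfty// lte_mul_pinfty// ?ge0_fin_numE ?sqint_ge0.
Qed.

End L2.

Section Hk.
Context {R : realType}.
Implicit Types f g h : space3 R -> R.

(** For an integer order the top seminorm vanishes and [in_H] is the usual space
H^k, with the sum over all strings of at most k partial derivatives as the
squared norm. *)
Definition Hk_mem (k : nat) f := sobolev_mem (fun=> 0%E) k f.
Definition Hk_sq (k : nat) f : \bar R := sobolev_sq (fun=> 0%E) k f.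

Lemma top_seminorm_nat (k : nat) :
  @top_seminorm R (k%:R - (Num.truncn (k%:R : R))%:R) = fun=> 0%E.
Proof.
by rewrite /top_seminorm truncnK ?subrr ?eqxx// natr_nat.
Qed.

Lemma truncn_natr (k : nat) : Num.truncn (k%:R : R) = k.
Proof. by apply/eqP; rewrite -(eqr_nat R) truncnK// natr_nat. Qed.

Lemma in_H_nat (k : nat) f : in_H k%:R f = Hk_mem k f.
Proof. by rewrite /in_H top_seminorm_nat truncn_natr. Qed.

Lemma H_norm_nat (k : nat) f : H_norm k%:R f = sqrte (Hk_sq k f).
Proof. by rewrite /H_norm top_seminorm_nat truncn_natr. Qed.

Lemma Hk_mem_L2 k f : Hk_mem k f -> L2 f.
Proof. by case: k => [|k] [/Lfun2P]. Qed.

Lemma Hk_mem_wp k f i : Hk_mem k.+1 f -> is_weak_partial i f (weak_partial i f).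
Proof. by case=> _ /(_ i)[]. Qed.

Lemma Hk_mem_weak_partial k f i : Hk_mem k.+1 f -> Hk_mem k (weak_partial i f).
Proof. by case=> _ /(_ i)[]. Qed.

Lemma Hk_sq0E f : Hk_sq 0 f = sqint f.
Proof. by rewrite -Lnorm2_sqr -[RHS]adde0. Qed.

Lemma Hk_sqSE k f : Hk_sq k.+1 f = (sqint f + \sum_(i < 3) Hk_sq k (weak_partial i f))%E.
Proof. by rewrite -Lnorm2_sqr. Qed.

Lemma Hk_sq_ge0 k f : (0 <= Hk_sq k f)%E.
Proof.
elim: k f => [|k IH] f; first by rewrite Hk_sq0E sqint_ge0.
by rewrite Hk_sqSE adde_ge0 ?sqint_ge0// sume_ge0// => i _; exact: IH.
Qed.

Lemma sqint_le_Hk_sq k f : (sqint f <= Hk_sq k f)%E.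
Proof.
case: k => [|k]; first by rewrite Hk_sq0E.
by rewrite Hk_sqSE leeDl// sume_ge0// => i _; exact: Hk_sq_ge0.
Qed.

Lemma Hk_sq_weak_partial k f i : (Hk_sq k (weak_partial i f) <= Hk_sq k.+1 f)%E.
Proof.
rewrite Hk_sqSE (bigD1 i)//= addeCA leeDl//.
by rewrite adde_ge0 ?sqint_ge0// sume_ge0// => j _; exact: Hk_sq_ge0.
Qed.

Lemma Hk_sq_fin k f : Hk_mem k f -> (Hk_sq k f < +oo)%E.
Proof.
elim: k f => [|k IH] f Hf; first by rewrite Hk_sq0E; case: (Hk_mem_L2 Hf).
rewrite Hk_sqSE; apply: lte_add_pinfty; first by case: (Hk_mem_L2 Hf).
by apply: lte_sum_pinfty => i _; apply: IH; exact: Hk_mem_weak_partial.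
Qed.

Lemma Hk_mem_ae k f g : measurable_fun setT g -> (\forall x \ae vol R, f x = g x) ->
  Hk_mem k f -> Hk_mem k g.
Proof.
move=> mg fg Hf; have [mf ff] := Hk_mem_L2 Hf.
have Lg : g \in Lfun (vol R) 2%:E.
  by apply/Lfun2P; split => //; rewrite -(sqint_ae mf mg).
case: k Hf => [|k] Hf; first by split.
split => // i; rewrite -(weak_partial_ae i mf mg fg); split.
  exact: is_weak_partial_ae fg (Hk_mem_wp i Hf).
exact: Hk_mem_weak_partial.
Qed.

(** The chosen derivatives of f - g agree almost everywhere with the differences
of the chosen derivatives, and membership does not see null sets. *)
Lemma Hk_memB k f g : Hk_mem k f -> Hk_mem k g -> Hk_mem k (fun x => f x - g x).
Proof.
elim: k f g => [|k IH] f g Hf Hg.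
  by split=> //; apply/Lfun2P; exact: (L2B (Hk_mem_L2 Hf) (Hk_mem_L2 Hg)).
split; first by apply/Lfun2P; exact: (L2B (Hk_mem_L2 Hf) (Hk_mem_L2 Hg)).
move=> i; have [wfg fgE] := weak_partialB (Hk_mem_wp i Hf) (Hk_mem_wp i Hg).
split => //.
have := IH _ _ (Hk_mem_weak_partial i Hf) (Hk_mem_weak_partial i Hg).
apply: Hk_mem_ae; last by apply: filterS fgE => x ->.
by case: wfg => _ /loc_integrable_measurable.
Qed.

Lemma in_C_H_nat T (k : nat) (f : timeline R -> space3 R -> R) : in_C_H T k%:R f ->
  forall t : R, t \in `[0, T] -> Hk_mem k (f t) /\
    forall e : R, 0 < e -> exists2 d : R, 0 < d & forall r : R, r \in `[0, T] -> `|r - t| < d ->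
      (Hk_sq k (fun x => f r x - f t x)%R <= e%:E)%E.
Proof.
move=> Cf t tT; have [Hf cf] := Cf t tT; split; first by rewrite -in_H_nat.
move=> e e0.
have : nbhs 0%E [set y : \bar R | (y < (Num.sqrt e)%:E)%E].
  by apply: open_ereal_lt'; rewrite lte_fin sqrtr_gt0.
move=> /cf; rewrite nbhs_filterE => -[d /= d0 hd]; exists d => // r rT rd.
have := hd r; rewrite /= /ball /= distrC => /(_ rd rT).
rewrite H_norm_nat => /ltW; rewrite -[(Num.sqrt e)%:E]/(sqrte e%:E) lee_sqrt//.
by rewrite lee_fin ltW.
Qed.

End Hk.

(** * Smooth ramps and bumps *)

Section Ramp.
Context {R : realType}.
Implicit Types (a b x z : R) (n : nat).

(** Smooth approximation of the positive part of x. *)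
Definition smooth_pos n (x : R) : R := x * flat 1 (n.+1%:R * x + 0).

Lemma smooth_id : smooth (fun x : R => x).
Proof.
case=> [|n]; first by split=> // x; exact: cvg_id.
by apply: (@CkS_line _ n _ (fun=> 1)) => //; exact: Ck_cst.
Qed.

Lemma smooth_pos_smooth n : smooth (smooth_pos n).
Proof. by apply: smoothM; [exact: smooth_id|apply: smooth_affine; exact: flat_smooth]. Qed.

Lemma is_derive_affine (g : R -> R) (c d x dg : R) : is_derive (c * x + d) 1 g dg ->
  is_derive x 1 (fun y : R => g (c * y + d)) (c * dg).
Proof.
move=> h; have [d1 d2] := @derive_comp_affine _ R R (scal c) d g x 1.
have [h1 h2] := @is_derive_dir _ g (c * x + d) dg (c * 1) h.
rewrite mulr1 in h1 h2.
have sc1 : scal c 1 = c by exact: mulr1.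
apply: DeriveDef; first by apply: d1; move: h1; rewrite -{2}sc1.
by rewrite -h2; apply: (etrans d2); exact: (congr1 (fun v => 'D_v g (c * x + d)) sc1).
Qed.

(** The derivative of [smooth_pos]. *)
Definition smooth_heaviside n (x : R) : R := flat (1 + 'X) (n.+1%:R * x).

Lemma smooth_pos_is_derive n (x : R) : is_derive x 1 (smooth_pos n) (smooth_heaviside n x).
Proof.
have h := is_derive_affine (flat_is_derive 1 (n.+1%:R * x + 0)).
apply: (is_derive_eq (is_deriveM (is_derive_id x 1) h)).
rewrite !addr0 derivC subr0 mulr1 expr2.
have scE (u v : R) : u *: v = u * v by [].
rewrite !scE mulr1 mulrA [x * _]mulrC flatXM /smooth_heaviside /flat.
by case: ifP => _; rewrite ?addr0// !hornerE; ring.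
Qed.

Lemma smooth_heaviside_ge0 n x : 0 <= smooth_heaviside n x.
Proof.
rewrite /smooth_heaviside /flat; case: ifP => // x0; rewrite !hornerE mulr_ge0 ?expR_ge0//.
by rewrite addr_ge0// invr_ge0 ltW.
Qed.

Lemma smooth_heaviside_le1 n x : smooth_heaviside n x <= 1.
Proof.
rewrite /smooth_heaviside /flat; case: ifP => // x0; rewrite !hornerE expRN.
by rewrite ler_pdivrMr ?expR_gt0// mul1r expR_ge1Dx.
Qed.

Lemma smooth_heaviside_cvg x : smooth_heaviside n x @[n --> \oo] --> (\1_(`]0, +oo[%classic) x : R).
Proof.
rewrite indicE; have [x0|x0] := ltP 0 x; last first.
  rewrite memNset; last by rewrite /= in_itv /= andbT ltNge x0.
  by apply: cvg_near_cst; apply: nearW => n; rewrite /smooth_heaviside flat0// mulr_ge0_le0.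
rewrite mem_set; last by rewrite /= in_itv /= x0.
apply: (@squeeze_cvgr _ _ _ _ (fun n => flat 1 (n.+1%:R * x)) (cst 1)).
- apply: nearW => n; rewrite smooth_heaviside_le1 andbT /smooth_heaviside /flat.
  case: ifP => // nx; apply: ler_wpM2r; first exact: expR_ge0.
  by rewrite hornerD hornerX lerDl invr_ge0 ltW.
- by apply: (@flat1_cvg _ _ x).
- exact: cvg_cst.
Qed.

Lemma smooth_pos_cvg x : smooth_pos n x @[n --> \oo] --> Num.max x 0.
Proof.
have [x0|x0] := ltP 0 x.
  rewrite -[X in _ --> X]mulr1; apply: cvgM; first exact: cvg_cst.
  by apply: (@flat1_cvg _ _ x) => // n; rewrite addr0.
by apply: cvg_near_cst; apply: nearW => n; rewrite /smooth_pos flat0 ?mulr0// addr0 mulr_ge0_le0.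
Qed.

Lemma smooth_pos_bound n x : `|smooth_pos n x| <= `|x|.
Proof. by rewrite normrM [X in _ * X]ger0_norm ?flat1_ge0// ler_piMr// flat1_le1. Qed.

Definition smooth_ramp a b n (x : R) : R := smooth_pos n (1 * x + - a) - smooth_pos n (1 * x + - b).
Definition smooth_indic a b n (x : R) : R := smooth_heaviside n (x - a) - smooth_heaviside n (x - b).
(** The primitive of the indicator of ]a, b] that vanishes at -oo. *)
Definition ramp a b (x : R) : R := Num.max (x - a) 0 - Num.max (x - b) 0.

Lemma smoothB (f g : R -> R) : smooth f -> smooth g -> smooth (fun x => f x - g x).
Proof.
move=> sf sg; rewrite (_ : (fun x => _) = (fun x => f x + (-1) * g x)).
  by apply: smoothD => //; apply: smoothM => //; exact: smooth_cst.
by apply/funext => x; rewrite mulN1r.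
Qed.

Lemma smooth_ramp_smooth a b n : smooth (smooth_ramp a b n).
Proof. by apply: smoothB; apply: smooth_affine; exact: smooth_pos_smooth. Qed.

Lemma derive_smooth_ramp a b n : 'D_1 (smooth_ramp a b n) = smooth_indic a b n.
Proof.
apply/funext => x.
have h c := is_derive_affine (smooth_pos_is_derive n (1 * x + - c)).
have [_ ->] := is_deriveB (h a) (h b).
by rewrite /smooth_indic !mul1r.
Qed.

Lemma smooth_indic_bound a b n x : `|smooth_indic a b n x| <= 1.
Proof.
have := smooth_heaviside_ge0 n (x - a); have := smooth_heaviside_ge0 n (x - b).
have := smooth_heaviside_le1 n (x - a); have := smooth_heaviside_le1 n (x - b).
by move=> ? ? ? ?; rewrite ler_norml /smooth_indic; apply/andP; split; lra.
Qed.

Lemma smooth_indic_cvg a b x : a <= b ->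
  smooth_indic a b n x @[n --> \oo] --> (\1_(`]a, b]%classic) x : R).
Proof.
move=> ab; rewrite (_ : \1_(_) x = \1_(`]0, +oo[%classic) (x - a) - \1_(`]0, +oo[%classic) (x - b)).
  by apply: cvgB; exact: smooth_heaviside_cvg.
rewrite !indicE !mem_setE /= !in_itv /= !andbT !subr_gt0.
case: (ltP a x) => ax; case: (leP x b) => bx /=; rewrite ?subr0 ?subrr//.
by have := lt_le_trans bx (le_trans ax ab); rewrite ltxx.
Qed.

Lemma smooth_ramp_cvg a b x : smooth_ramp a b n x @[n --> \oo] --> ramp a b x.
Proof. by rewrite /smooth_ramp !mul1r; apply: cvgB; exact: smooth_pos_cvg. Qed.

Lemma smooth_ramp_bound a b n x : `|smooth_ramp a b n x| <= `|x| *+ 2 + `|a| + `|b|.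
Proof.
rewrite /smooth_ramp !mul1r (le_trans (ler_normB _ _))//.
have := smooth_pos_bound n (x - a); have := smooth_pos_bound n (x - b).
have := ler_normB x a; have := ler_normB x b; rewrite mulr2n; lra.
Qed.

(** A smooth function supported in [z - 1, z + 1]. *)
Definition bump z (x : R) : R := flat 1 (1 * x + (1 - z)) * flat 1 (-1 * x + (z + 1)).

Lemma bump_smooth z : smooth (bump z).
Proof. by apply: smoothM; apply: smooth_affine; exact: flat_smooth. Qed.

Lemma derive_bump z x : 'D_1 (bump z) x =
  flat 1 (1 * x + (1 - z)) * - flat ('X ^+ 2) (-1 * x + (z + 1)) +
  flat 1 (-1 * x + (z + 1)) * flat ('X ^+ 2) (1 * x + (1 - z)).
Proof.
have h c d := is_derive_affine (flat_is_derive 1 (c * x + d)).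
have [_ ->] := is_deriveM (h 1 (1 - z)) (h (-1) (z + 1)).
have scE (u v : R) : u *: v = u * v by [].
by rewrite derivC subr0 mulr1 !scE; ring.
Qed.

(** The bounds do not depend on the centre, since the bumps are translates of
one another. *)
Lemma bump_bounded : exists2 B : R, 1 <= B & forall z x,
  `|bump z x| <= B /\ `|'D_1 (bump z) x| <= B.
Proof.
have [C C0 hC] := @flat_bounded R ('X ^+ 2).
have b1 (x : R) : `|flat 1 x| <= 1 by rewrite ger0_norm ?flat1_ge0 ?flat1_le1.
exists (1 + C + C); first by lra.
move=> z x; split.
  by rewrite /bump normrM; apply: (@le_trans _ _ 1); [exact: mulr_ile1|lra].
rewrite derive_bump (le_trans (ler_normD _ _))// !normrM normrN.
have h1 : `|flat 1 (1 * x + (1 - z))| * `|flat ('X ^+ 2) (-1 * x + (z + 1))| <= 1 * C.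
  by apply: ler_pM.
have h2 : `|flat 1 (-1 * x + (z + 1))| * `|flat ('X ^+ 2) (1 * x + (1 - z))| <= 1 * C.
  by apply: ler_pM.
lra.
Qed.

Lemma bump_out z x : 1 < `|x - z| -> bump z x = 0 /\ 'D_1 (bump z) x = 0.
Proof.
rewrite derive_bump /bump ltr_normr => /orP[] h.
  have h0 : -1 * x + (z + 1) <= 0 by lra.
  by rewrite !(flat0 _ h0) oppr0 !mulr0 mul0r addr0.
have h0 : 1 * x + (1 - z) <= 0 by lra.
by rewrite !(flat0 _ h0) !mul0r mulr0 addr0.
Qed.

Lemma bump_center : exists2 c : R, 0 < c & forall z x, `|x - z| <= 1 / 2 -> c <= bump z x.
Proof.
have mono (x : R) : 1 / 2 <= x -> expR (- 2) <= flat 1 x.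
  move=> x2; have x0 : 0 < x by lra.
  rewrite /flat x0 hornerE mul1r ler_expR lerN2 -[2]invrK lef_pV2 ?posrE ?invr_gt0//.
  by rewrite -div1r.
exists (expR (- 2) * expR (- 2)); first by rewrite mulr_gt0 ?expR_gt0.
move=> z x; rewrite ler_norml => /andP[h1 h2].
by apply: ler_pM; rewrite ?expR_ge0//; apply: mono; lra.
Qed.

End Ramp.

(** * Integration by parts in all three variables *)

Section Ibp.
Context {R : realType}.
Implicit Types (f F dF : space3 R -> R) (b K : R -> R) (c : 'I_3 -> R -> R).

(** Integrating f * (b * K') by parts produces two terms, in which the derivative
falls on f or on b. The boolean e records the choice: [dpart e] acts on f and
[wgt b e] is what remains of b. *)
Definition wgt b (e : bool) : R -> R := if e then b else 'D_1 b.
Definition dpart (e : bool) (j : 'I_3) f := if e then weak_partial j f else f.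

Lemma supported_derive M b : supported M b -> supported M ('D_1 b).
Proof.
move=> sb x Mx; rewrite (@near_eq_derive _ _ _ _ (cst 0)) ?derive_cst//.
have nM : nbhs (`|x| : R) [set y : R | M < y] by exact: lt_nbhsr.
have : \forall y \near x, M < `|y| := @norm_continuous _ R x _ nM.
by apply: filterS => y; exact: sb.
Qed.

Lemma supportedM M b K : supported M b -> supported M (fun x => b x * K x).
Proof. by move=> sb x Mx; rewrite sb ?mul0r. Qed.

Lemma wgt_smooth b e : smooth b -> smooth (wgt b e).
Proof. by case: e => // sb; exact: smooth_derive. Qed.

Lemma wgt_supported M b e : supported M b -> supported M (wgt b e).
Proof. by case: e => // sb; exact: supported_derive. Qed.

Lemma updP (P : (R -> R) -> Prop) c j (h : R -> R) :
  (forall i, P (c i)) -> P h -> forall i, P (upd c j h i).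
Proof. by move=> Pc Ph i; rewrite /upd; case: eqP. Qed.

(** The definition of the weak derivative tested with the function b K in the
j-th variable. Only b is assumed to have a compact support, since K will be a
ramp. *)
Lemma integration_by_parts_wgt M j F dF c b K : is_weak_partial j F dF ->
  (forall i, smooth (c i)) -> (forall i, supported M (c i)) ->
  smooth b -> supported M b -> smooth K ->
  \int[vol R]_x (F x * tens (upd c j (fun y => b y * 'D_1 K y)) x) =
  - (\int[vol R]_x (dF x * tens (upd c j (fun y => b y * K y)) x)
     + \int[vol R]_x (F x * tens (upd c j (fun y => 'D_1 b y * K y)) x)).
Proof.
move=> [lF ldF FdF] sc suc sb sub sK.
have t h : smooth h -> supported M h -> test_fun setT (tens (upd c j h)).
  by move=> sh suh; apply: (test_fun_tens (M := M)); exact: updP.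
have sbK : smooth (fun y => b y * K y) by exact: smoothM.
have tbK := t _ sbK (supportedM _ sub).
have tb'K : test_fun setT (tens (upd c j (fun y => 'D_1 b y * K y))).
  by apply: t; [apply: smoothM => //; exact: smooth_derive|exact/supportedM/supported_derive].
have tbK' : test_fun setT (tens (upd c j (fun y => b y * 'D_1 K y))).
  by apply: t; [apply: smoothM => //; exact: smooth_derive|exact: supportedM].
rewrite opprD -FdF// -[X in _ = X - _](_ : \int[vol R]_x
    (F x * tens (upd c j (fun y => b y * 'D_1 K y)) x +
     F x * tens (upd c j (fun y => 'D_1 b y * K y)) x) = _).
  have i1 := integrable_mul_test lF tbK'; have i2 := integrable_mul_test lF tb'K.
  by rewrite RintegralD// addrK.
apply: eq_Rintegral => x _; rewrite derive_tens; last exact: updP.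
have -> : 'D_1 (upd c j (fun y => b y * K y) j) =
    (fun y => b y * 'D_1 K y + 'D_1 b y * K y).
  rewrite /upd eqxx; apply/funext => y.
  have [_ ->] := is_deriveM (smooth_is_derive y 1 sb) (smooth_is_derive y 1 sK).
  by congr (_ + _); exact: mulrC.
by rewrite /tens; elim/ord3_ind: j {FdF t tbK tb'K tbK'}; rewrite /upd /=; ring.
Qed.

Lemma ibp_step M j F c b K : is_weak_partial j F (weak_partial j F) ->
  (forall i, smooth (c i)) -> (forall i, supported M (c i)) ->
  smooth b -> supported M b -> smooth K ->
  \int[vol R]_x (F x * tens (upd c j (fun y => b y * 'D_1 K y)) x) =
  - \sum_(e : bool) \int[vol R]_x (dpart e j F x * tens (upd c j (fun y => wgt b e y * K y)) x).
Proof.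
move=> wF sc suc sb sub sK; rewrite big_bool.
exact: (integration_by_parts_wgt wF sc suc sb sub sK).
Qed.

Lemma Hk_memW k f : Hk_mem k.+1 f -> Hk_mem k f.
Proof.
elim: k f => [|k IH] f Hf; first by split => //; apply/Lfun2P; exact: Hk_mem_L2 Hf.
split; first by apply/Lfun2P; exact: Hk_mem_L2 Hf.
by move=> i; split; [exact: Hk_mem_wp Hf|apply: IH; exact: Hk_mem_weak_partial].
Qed.

Lemma Hk_sqW k f : (Hk_sq k f <= Hk_sq k.+1 f)%E.
Proof.
elim: k f => [|k IH] f; first by rewrite Hk_sq0E sqint_le_Hk_sq.
by rewrite !(Hk_sqSE _ f) leeD// lee_sum.
Qed.

Lemma Hk_mem_dpart k e j f : Hk_mem k.+1 f -> Hk_mem k (dpart e j f).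
Proof. by case: e => Hf; [exact: Hk_mem_weak_partial|exact: Hk_memW]. Qed.

Lemma Hk_sq_dpart k e j f : (Hk_sq k (dpart e j f) <= Hk_sq k.+1 f)%E.
Proof. by case: e; [exact: Hk_sq_weak_partial|exact: Hk_sqW]. Qed.

(** The partial derivatives are always taken in the same order, so that weak
derivatives need not be commuted. *)
Definition mixed_partial (e0 e1 e2 : bool) f := dpart e2 o2 (dpart e1 o1 (dpart e0 o0 f)).

Lemma Hk_mem_mixed_partial e0 e1 e2 f : Hk_mem 3 f -> L2 (mixed_partial e0 e1 e2 f).
Proof. by move=> Hf; apply: (@Hk_mem_L2 _ 0); do 3 apply: Hk_mem_dpart. Qed.

Lemma sqint_mixed_partial e0 e1 e2 f : (sqint (mixed_partial e0 e1 e2 f) <= Hk_sq 3 f)%E.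
Proof.
rewrite -Hk_sq0E; apply: le_trans (Hk_sq_dpart _ _ _ _) _.
by apply: le_trans (Hk_sq_dpart _ _ _ _) _; exact: Hk_sq_dpart.
Qed.

Definition vec3 {T} (u0 u1 u2 : T) : 'I_3 -> T := fun i => nth u0 [:: u0; u1; u2] i.

Lemma dpart_wp k e j i f : Hk_mem k.+2 f ->
  is_weak_partial i (dpart e j f) (weak_partial i (dpart e j f)).
Proof. by move=> Hf; apply: (@Hk_mem_wp _ k); exact: Hk_mem_dpart. Qed.

Lemma ibp3 M f (b K : 'I_3 -> R -> R) : Hk_mem 3 f ->
  (forall i, smooth (b i)) -> (forall i, supported M (b i)) -> (forall i, smooth (K i)) ->
  \int[vol R]_x (f x * tens (fun i y => b i y * 'D_1 (K i) y) x) =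
  - \sum_(e0 : bool) \sum_(e1 : bool) \sum_(e2 : bool)
    \int[vol R]_x (mixed_partial e0 e1 e2 f x *
       tens (fun i y => wgt (b i) (vec3 e0 e1 e2 i) y * K i y) x).
Proof.
move=> Hf sb sub sK.
pose u (s : option bool) i := if s is Some e then (fun y => wgt (b i) e y * K i y)
  else (fun y => b i y * 'D_1 (K i) y).
have su s i : smooth (u s i).
  by case: s => [e|]; apply: smoothM => //; [exact: wgt_smooth|exact: smooth_derive].
have suu s i : supported M (u s i).
  by case: s => [e|]; apply: supportedM => //; exact: wgt_supported.
pose c s0 s1 s2 : 'I_3 -> R -> R := vec3 (u s0 o0) (u s1 o1) (u s2 o2).
have sc s0 s1 s2 i : smooth (c s0 s1 s2 i) by elim/ord3_ind: i; exact: su.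
have suc s0 s1 s2 i : supported M (c s0 s1 s2 i) by elim/ord3_ind: i; exact: suu.
have E0 := @ibp_step M o0 f (c None None None) (b o0) (K o0) (Hk_mem_wp o0 Hf)
  (sc _ _ _) (suc _ _ _) (sb _) (sub _) (sK _).
rewrite [LHS]E0; congr (- _); apply: eq_bigr => e0 _.
have E1 := @ibp_step M o1 (dpart e0 o0 f) (c (Some e0) None None) (b o1) (K o1)
  (dpart_wp e0 o0 o1 Hf) (sc _ _ _) (suc _ _ _) (sb _) (sub _) (sK _).
rewrite [LHS]E1 -sumrN; apply: eq_bigr => e1 _.
have E2 := @ibp_step M o2 (dpart e1 o1 (dpart e0 o0 f)) (c (Some e0) (Some e1) None) (b o2) (K o2)
  (dpart_wp e1 o1 o2 (Hk_mem_dpart e0 o0 Hf)) (sc _ _ _) (suc _ _ _) (sb _) (sub _) (sK _).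
by rewrite -[X in - X]/(\int[vol R]_x (dpart e1 o1 (dpart e0 o0 f) x * tens (upd (c (Some e0) (Some e1) None) o2 (fun y => b o2 y * 'D_1 (K o2) y)) x)) E2 opprK.
Qed.

End Ibp.

(** * The mixed derivative of a localized function *)

Section IntegralSums.
Context d (T : measurableType d) (R : realType) (mu : {measure set T -> \bar R}).

Lemma integrable_sum_real (I : Type) (s : seq I) (F : I -> T -> R) :
  (forall i, mu.-integrable setT (EFin \o F i)) ->
  mu.-integrable setT (EFin \o (fun x => \sum_(i <- s) F i x)).
Proof.
move=> iF; elim: s => [|i s IH].
  by have := @integrable0 _ _ _ mu setT; apply: eq_integrable => // x _; rewrite /= big_nil.
have := integrableD measurableT (iF i) IH; apply: eq_integrable => // x _.
by rewrite /= big_cons.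
Qed.

Lemma Rintegral_sum (I : Type) (s : seq I) (F : I -> T -> R) :
  (forall i, mu.-integrable setT (EFin \o F i)) ->
  \int[mu]_x (\sum_(i <- s) F i x) = \sum_(i <- s) \int[mu]_x F i x.
Proof.
move=> iF; elim: s => [|i s IH].
  by under eq_Rintegral do rewrite big_nil; rewrite big_nil /Rintegral integral0.
under eq_Rintegral do rewrite big_cons.
by rewrite RintegralD// ?big_cons ?IH//; exact: integrable_sum_real.
Qed.

End IntegralSums.

Section Representation.
Context {R : realType}.
Implicit Types (f : space3 R -> R) (K : 'I_3 -> R -> R) (z p q : 'I_3 -> R) (e : bool * bool * bool).

Definition dm e f := mixed_partial e.1.1 e.1.2 e.2 f.
Definition wt z e : 'I_3 -> R -> R := fun i => wgt (bump (z i)) (vec3 e.1.1 e.1.2 e.2 i).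
(** The mixed derivative of third order of the product of f with the bump centred
at z, expanded by the Leibniz rule. *)
Definition dcut z f : space3 R -> R := fun y => \sum_e dm e f y * tens (wt z e) y.

Lemma wt_smooth z e i : smooth (wt z e i).
Proof. by apply: wgt_smooth; exact: bump_smooth. Qed.

Definition zrad z := `|z o0| + `|z o1| + `|z o2| + 1.

Lemma zrad_ge z i : `|z i| + 1 <= zrad z.
Proof.
rewrite /zrad; have := (normr_ge0 (z o0), normr_ge0 (z o1), normr_ge0 (z o2)).
by move=> [[? ?] ?]; elim/ord3_ind: i; lra.
Qed.

Lemma bump_supported z i : supported (zrad z) (bump (z i)).
Proof.
move=> x Mx; apply: (bump_out _).1.
have := zrad_ge z i; have := lerB_dist x (z i); lra.
Qed.

Lemma wt_supported z e i : supported (zrad z) (wt z e i).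
Proof. by apply: wgt_supported; exact: bump_supported. Qed.

Lemma ibp_dcut f z K : Hk_mem 3 f -> (forall i, smooth (K i)) ->
  \int[vol R]_x (f x * tens (fun i y => bump (z i) y * 'D_1 (K i) y) x) =
  - \int[vol R]_x (dcut z f x * tens K x).
Proof.
move=> Hf sK.
rewrite (@ibp3 _ (zrad z) f (fun i => bump (z i)) K Hf)//; last 2 first.
- by move=> i; exact: bump_smooth.
- exact: bump_supported.
congr (- _); rewrite pair_bigA pair_bigA /= -Rintegral_sum.
  apply: eq_Rintegral => x _; rewrite /dcut mulr_suml; apply: eq_bigr => e _.
  by rewrite -mulrA tensM.
move=> e; apply: (@integrable_mul_test _ setT).
  by apply: L2_loc_integrable; exact: Hk_mem_mixed_partial.
apply: (@test_fun_tens _ (zrad z)) => i; last exact/supportedM/wt_supported.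
by apply: smoothM => //; exact: wt_smooth.
Qed.

Lemma dcut_measurable f z : Hk_mem 3 f -> measurable_fun setT (dcut z f).
Proof.
move=> Hf; apply: measurable_sum => e; apply: measurable_funM.
  by apply: L2_measurable; exact: Hk_mem_mixed_partial.
by apply: measurable_tens => i; apply: smooth_measurable; exact: wt_smooth.
Qed.

Lemma dcut_out f z x : ~ ccube (zrad z) x -> dcut z f x = 0.
Proof.
move=> xz; rewrite /dcut big1// => e _.
by rewrite (tens_out (@wt_supported z e) xz) mulr0.
Qed.

Lemma dcut_integrable f z : Hk_mem 3 f -> (vol R).-integrable setT (EFin \o dcut z f).
Proof.
move=> Hf; apply: (@integrable_sum_real _ _ _ (vol R)) => e.
apply: (@integrable_mul_test _ setT).
  by apply: L2_loc_integrable; exact: Hk_mem_mixed_partial.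
by apply: (@test_fun_tens _ (zrad z)); [exact: wt_smooth|exact: wt_supported].
Qed.

(** In the integration by parts take K a smooth ramp in each variable. In the
limit K is a ramp, and its derivative the indicator of an interval. *)
Lemma box_identity f z p q : Hk_mem 3 f -> (forall i, p i <= q i) ->
  \int[vol R]_x (f x * tens (fun i => bump (z i)) x * \1_(box p q) x) =
  - \int[vol R]_x (dcut z f x * tens (fun i => ramp (p i) (q i)) x).
Proof.
move=> Hf pq; have [mf _] := Hk_mem_L2 Hf.
have lf := L2_loc_integrable (Hk_mem_L2 Hf).
have mb : measurable_fun setT (tens (fun i => bump (z i))).
  by apply: measurable_tens => i; apply: smooth_measurable; exact: bump_smooth.
have sz : test_fun setT (tens (fun i => bump (z i))).
  by apply: (@test_fun_tens _ (zrad z)); [move=> i; exact: bump_smooth|exact: bump_supported].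
have smI n i : smooth (smooth_indic (p i) (q i) n).
  by rewrite -derive_smooth_ramp; apply: smooth_derive; exact: smooth_ramp_smooth.
have L1 : \int[vol R]_x (f x * tens (fun i => bump (z i)) x * tens (fun i => smooth_indic (p i) (q i) n) x)
    @[n --> \oo] --> \int[vol R]_x (f x * tens (fun i => bump (z i)) x * \1_(box p q) x).
  apply: (@Rintegral_dct _ _ _ (vol R) _ _ (fun x => `|f x * tens (fun i => bump (z i)) x|) _ _ _ _).2.
  - move=> n; apply: measurable_funM; first exact: measurable_funM.
    by apply: measurable_tens => i; exact: smooth_measurable.
  - move=> x; apply: cvgM; first exact: cvg_cst.
    by rewrite indic_box; apply: cvgM; first apply: cvgM; exact: smooth_indic_cvg.
  - by have /integrable_abse := integrable_mul_test lf sz.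
  - move=> n x; rewrite normrM ler_piMr//.
    have := @tens_norm_le _ (fun i => smooth_indic (p i) (q i) n) x (fun=> 1).
    by rewrite !mulr1; apply => i; exact: smooth_indic_bound.
pose c (i : 'I_3) : R := zrad z *+ 2 + `|p i| + `|q i|.
have L2 : \int[vol R]_x (dcut z f x * tens (fun i => smooth_ramp (p i) (q i) n) x)
    @[n --> \oo] --> \int[vol R]_x (dcut z f x * tens (fun i => ramp (p i) (q i)) x).
  apply: (@Rintegral_dct _ _ _ (vol R) _ _ (fun x => `|dcut z f x| * (c o0 * c o1 * c o2)) _ _ _ _).2.
  - move=> n; apply: measurable_funM; first exact: dcut_measurable.
    by apply: measurable_tens => i; apply: smooth_measurable; exact: smooth_ramp_smooth.
  - move=> x; apply: cvgM; first exact: cvg_cst.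
    by apply: cvgM; first apply: cvgM; exact: smooth_ramp_cvg.
  - have /integrable_abse := dcut_integrable z Hf.
    move=> /(integrableZr measurableT (c o0 * c o1 * c o2)); apply: eq_integrable => //.
  - move=> n x; rewrite normrM.
    have [xz|xz] := pselect (ccube (zrad z) x); last by rewrite dcut_out// normr0 !mul0r.
    apply: ler_wpM2l => //; apply: tens_norm_le => i.
    apply: (le_trans (smooth_ramp_bound _ _ _ _)); rewrite /c !lerD2r lerMn2r /=.
    by have /in_ccube := xz.
apply: (@cvg_unique _ _ _ _ _ _ L1); first exact: Rhausdorff.
rewrite (_ : (fun n => _) = (fun n => - \int[vol R]_x (dcut z f x * tens (fun i => smooth_ramp (p i) (q i) n) x))).
  exact: cvgN.
apply/funext => n; rewrite -ibp_dcut//; last by move=> i; exact: smooth_ramp_smooth.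
apply: eq_Rintegral => x _; rewrite -mulrA tensM; congr (_ * tens _ _).
apply/funext => i; apply/funext => y; congr (_ * _).
exact: (congr1 (fun g : R -> R => g y) (esym (derive_smooth_ramp (p i) (q i) n))).
Qed.

End Representation.

(** * Integration over octants *)

Lemma integrable_indic_fin d (T : measurableType d) (R : realType)
    (mu : {measure set T -> \bar R}) (A : set T) :
  measurable A -> (mu A < +oo)%E -> mu.-integrable setT (EFin \o \1_A).
Proof.
move=> mA Af; apply/integrableP; split; first exact/measurable_EFinP/measurable_indic.
rewrite (eq_integral (fun x => (\1_A x)%:E)).
  by rewrite integral_indic// setIT.
by move=> x _ /=; rewrite ger0_norm.
Qed.

Lemma measurable_box {R : realType} (p q : 'I_3 -> R) : measurable (box p q).
Proof. by apply: measurableX => //; exact: measurableX. Qed.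

Lemma vol_box_fin {R : realType} (p q : 'I_3 -> R) : (forall i, p i <= q i) ->
  (vol R (box p q) < +oo)%E.
Proof.
move=> pq.
have e (i : 'I_3) : leb R (`]p i, q i]%classic : set R) = (q i - p i)%:E.
  rewrite lebesgue_measure_itv /= lte_fin EFinB; case: ltP => // qp.
  have -> : p i = q i by apply/eqP; rewrite eq_le pq.
  by rewrite subee.
by rewrite vol_prod// !e -!EFinM ltry.
Qed.

Section Above.
Context {R : realType}.
Implicit Types (f : space3 R -> R) (z p q : 'I_3 -> R) (x y : space3 R).

Definition pos1 (t : R) : R := \1_(`]0, +oo[%classic) t.
(** The indicator of the octant above x, as a function of y. *)
Definition lt3 x y : R := pos1 (y.1.1 - x.1.1) * pos1 (y.1.2 - x.1.2) * pos1 (y.2 - x.2).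

Lemma pos1_01 t : 0 <= pos1 t <= 1.
Proof. by rewrite /pos1 indicE; case: (_ \in _); rewrite ?lexx ?ler01. Qed.

Lemma lt3_01 x y : 0 <= lt3 x y <= 1.
Proof.
have /andP[a0 a1] := pos1_01 (y.1.1 - x.1.1).
have /andP[b0 b1] := pos1_01 (y.1.2 - x.1.2).
have /andP[c0 c1] := pos1_01 (y.2 - x.2).
by apply/andP; split; [rewrite !mulr_ge0|rewrite mulr_ile1 ?mulr_ge0 ?mulr_ile1].
Qed.

Lemma measurable_pos1 : measurable_fun setT pos1.
Proof. exact: measurable_indic (measurable_itv _). Qed.

Lemma measurable_lt3 : measurable_fun setT (fun w : space3 R * space3 R => lt3 w.1 w.2).
Proof.
have m (c : space3 R -> R) : measurable_fun setT c ->
    measurable_fun setT (fun w : space3 R * space3 R => pos1 (c w.2 - c w.1)).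
  move=> mc; apply: (measurableT_comp measurable_pos1).
  by apply: measurable_funB; apply: (measurableT_comp mc).
apply: measurable_funM; first apply: measurable_funM.
- by apply: (m (fun x => x.1.1)); apply: continuous_measurable_space3; exact: continuous_coord0.
- by apply: (m (fun x => x.1.2)); apply: continuous_measurable_space3; exact: continuous_coord1.
- by apply: (m (fun x => x.2)); apply: continuous_measurable_space3; exact: continuous_coord2.
Qed.

Lemma measurable_lt3_fix x : measurable_fun setT (lt3 x).
Proof.
exact: (measurableT_comp measurable_lt3 (pair1_measurable x)).
Qed.

Lemma leb_ramp (p q y : R) : p <= q ->
  leb R (`]p, q]%classic `&` [set t | 0 < y - t]) = (ramp p q y)%:E.
Proof.
move=> pq; rewrite /ramp.
have [yp|py] := leP y p.
  rewrite (_ : _ `&` _ = set0); last first.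
    by rewrite -subset0 => t [] /=; rewrite in_itv /= => /andP[pt _]; lra.
  rewrite measure0 !max_r ?subrr//; lra.
have [yq|qy] := leP y q.
  rewrite (_ : _ `&` _ = `]p, y[%classic); last first.
    apply/seteqP; split => t /=; rewrite !in_itv /=.
      by move=> [/andP[pt _]] ty; apply/andP; split; lra.
    by move=> /andP[pt ty]; split; [apply/andP; split; lra|lra].
  rewrite lebesgue_measure_itv /= lte_fin py -EFinD max_l ?max_r ?subr0//; lra.
rewrite (_ : _ `&` _ = `]p, q]%classic); last first.
  by apply/seteqP; split => t /=; rewrite !in_itv /=; [case|move=> /andP[pt tq]; split; [apply/andP; split; lra|lra]].
rewrite lebesgue_measure_itv /= lte_fin.
have [pq'|qp] := ltP p q; first by rewrite -EFinD !max_l; [congr (_%:E); lra|lra|lra].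
have -> : p = q by apply/eqP; rewrite eq_le pq.
by rewrite subrr.
Qed.

(** In one variable, the part of ]p, q] below y has length [ramp p q y]. *)
Lemma integral_box_lt3 p q y : (forall i, p i <= q i) ->
  (\int[vol R]_x (\1_(box p q) x * lt3 x y)%:E = (tens (fun i => ramp (p i) (q i)) y)%:E)%E.
Proof.
move=> pq.
pose A (i : 'I_3) : set R := `]p i, q i]%classic `&` [set t | 0 < coord3 y i - t].
have mA i : measurable (A i).
  apply: measurableI => //.
  rewrite (_ : [set t | _] = `]-oo, (coord3 y i)[%classic)//.
  by apply/seteqP; split => t; rewrite /= in_itv /= subr_gt0.
rewrite (eq_integral (fun x => (\1_(A o0 `*` A o1 `*` A o2) x)%:E)); last first.
  move=> x _; rewrite indic_box /tens /lt3 /pos1 !indicE; congr (_%:E).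
  rewrite -!natrM !mulnb; congr (nat_of_bool _)%:R.
  apply/idP/idP.
    move=> /andP[/andP[/andP[/set_mem a0 /set_mem a1] /set_mem a2] /andP[/andP[/set_mem c0 /set_mem c1] /set_mem c2]].
    rewrite mem_set//; move: c0 c1 c2; rewrite /= !in_itv /= !andbT => *.
    by split; first split.
  move=> /set_mem[[[a0 c0] [a1 c1]] [a2 c2]].
  rewrite (mem_set a0) (mem_set a1) (mem_set a2) /=.
  by rewrite !mem_set //= in_itv /= andbT.
have mAA : measurable (A o0 `*` A o1 `*` A o2 : set (space3 R)).
  by apply: measurableX; [apply: measurableX|]; exact: mA.
rewrite integral_indic// setIT.
apply: (etrans (vol_prod (mA o0) (mA o1) (mA o2))).
by rewrite /A !leb_ramp// -!EFinM.
Qed.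

Context (f : space3 R -> R) (z : 'I_3 -> R) (Hf : Hk_mem 3 f).
Let G := dcut z f.
Let mG : measurable_fun setT G. Proof. exact: dcut_measurable. Qed.
Let iG : (vol R).-integrable setT (EFin \o G). Proof. exact: dcut_integrable. Qed.

(** For smooth f, integrating the mixed derivative over the octant above x gives
back, up to the sign, the value at x of the localized function. *)
Definition above x : R := \int[vol R]_y (dcut z f y * lt3 x y).

Lemma above_integrable x : (vol R).-integrable setT (EFin \o (fun y => G y * lt3 x y)).
Proof.
apply: (@integrable_le _ _ _ _ _ (fun y => `|G y|)).
- by apply: measurable_funM => //; exact: measurable_lt3_fix.
- by have /integrable_abse := iG.
- move=> y; rewrite normrM ler_piMr//; have /andP[h0 h1] := lt3_01 x y.
  by rewrite ger0_norm.
Qed.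

Lemma above_bound x : `|above x| <= \int[vol R]_y `|G y|.
Proof.
apply: (le_trans (le_normr_Rintegral _ (above_integrable x))) => //.
apply: le_Rintegral => //.
- by have /integrable_abse := above_integrable x.
- by have /integrable_abse := iG.
- move=> y _; rewrite normrM ler_piMr//; have /andP[h0 h1] := lt3_01 x y.
  by rewrite ger0_norm.
Qed.

(** The integrand for the exchange of the integrals in x, over A, and in y, over
the octant above x. *)
Let H (A : set (space3 R)) (w : space3 R * space3 R) : R := G w.2 * (\1_A w.1 * lt3 w.1 w.2).

Let mH A : measurable A -> measurable_fun setT (H A).
Proof.
move=> mA; apply: measurable_funM; first exact: (measurableT_comp mG).
apply: measurable_funM; last exact: measurable_lt3.
by apply: (measurableT_comp (measurable_indic mA)).
Qed.

Let iH A : measurable A -> (vol R A < +oo)%E ->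
  (volume (R := R) \x volume (R := R))%E.-integrable setT (EFin \o H A).
Proof.
move=> mA Afin.
have mEH : measurable_fun setT (EFin \o H A) by apply/measurable_EFinP; exact: mH.
apply/integrable21ltyP => //.
have Gfin : (\int[volume (R := R)]_y (`|G y|)%:E < +oo)%E by case/integrableP: iG.
have mN : measurable_fun setT (fun y => (`|G y|)%:E).
  by apply/measurable_EFinP; exact: measurableT_comp.
apply: (@le_lt_trans _ _ (\int[volume (R := R)]_y ((`|G y|)%:E * vol R A))%E); last first.
  rewrite ge0_integralZr// ?lte_mul_pinfty ?integral_ge0//.
  by rewrite ge0_fin_numE ?integral_ge0.
apply: ge0_le_integral => //.
- by move=> y _; exact: integral_ge0.
- apply: (measurable_fun_fubini_tonelli_G (abse \o (EFin \o H A))).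
    exact: measurableT_comp.
  by move=> w; exact: abse_ge0.
- by apply: emeasurable_funM.
move=> y _; have := integral_indic (volume (R := R)) measurableT mA.
rewrite setIT => <-.
rewrite -ge0_integralZl//; last exact/measurable_EFinP/measurable_indic.
apply: ge0_le_integral => //.
- apply: measurableT_comp => //; apply: (measurableT_comp mEH).
  exact: pair2_measurable.
- by apply: emeasurable_funM => //; exact/measurable_EFinP/measurable_indic.
move=> x _; rewrite -EFinM lee_fin /H /= normrM ler_wpM2l// normrM.
have /andP[h0 h1] := lt3_01 x y.
by rewrite (ger0_norm h0) ger0_norm ?ler_piMr.
Qed.

Let innerE A x : (\int[vol R]_y (H A (x, y))%:E = (above x * \1_A x)%:E)%E.
Proof.
rewrite /H /= (eq_integral (fun y => ((\1_A x)%:E * (G y * lt3 x y)%:E)%E)).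
  rewrite integralZl//; last exact: above_integrable.
  rewrite mulrC EFinM /above /Rintegral fineK//.
  by apply: integrable_fin_num => //; exact: above_integrable.
by move=> y _; rewrite -EFinM; congr (_%:E); ring.
Qed.

Lemma above_loc_integrable A : measurable A -> (vol R A < +oo)%E ->
  (vol R).-integrable setT (EFin \o (fun x => above x * \1_A x)).
Proof.
move=> mA Af; have := integrable_fubini_F (iH mA Af); apply: eq_integrable => // x _.
exact: innerE.
Qed.

(** The theorem of Fubini: the integral over the box of the octant indicators is
the product of the ramps. *)
Lemma integral_above p q : (forall i, p i <= q i) ->
  \int[vol R]_x (above x * \1_(box p q) x) = \int[vol R]_y (G y * tens (fun i => ramp (p i) (q i)) y).
Proof.
move=> pq.
have mB := measurable_box p q; have Bf := vol_box_fin pq.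
have := Fubini (iH mB Bf); rewrite /Rintegral => E; congr fine.
rewrite -[LHS](eq_integral _ _ (fun x _ => innerE (box p q) x)).
apply: (etrans E); apply: eq_integral => y _.
rewrite (eq_integral (fun x => ((G y)%:E * (\1_(box p q) x * lt3 x y)%:E)%E)); last first.
  by move=> x _; rewrite -EFinM.
have iBL : (vol R).-integrable setT (EFin \o (fun x => \1_(box p q) x * lt3 x y)).
  apply: (@integrable_le _ _ _ (vol R) _ (\1_(box p q))).
  - apply: measurable_funM; first exact: measurable_indic.
    exact: (measurableT_comp measurable_lt3 (pair2_measurable y)).
  - exact: integrable_indic_fin.
  - move=> x; have /andP[h0 h1] := lt3_01 x y.
    by rewrite normrM (ger0_norm h0) ger0_norm ?ler_piMr.
rewrite (integralZl measurableT iBL).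
by apply: (etrans (congr1 (fun t => (G y)%:E * t)%E (integral_box_lt3 y pq))).
Qed.

End Above.

(** * The embedding of H^3 in the bounded functions *)

Section Sobolev.
Context {R : realType}.
Implicit Types (f : space3 R -> R) (z p q : 'I_3 -> R) (x y : space3 R).

(** Both sides are locally integrable and have the same integrals over boxes: for
the left one integrate by parts, for the right one exchange the integrals. *)
Lemma bump_representation f z : Hk_mem 3 f ->
  \forall x \ae vol R, f x * tens (fun i => bump (z i)) x = - above f z x.
Proof.
move=> Hf; have lf := L2_loc_integrable (Hk_mem_L2 Hf).
have sz : test_fun setT (tens (fun i => bump (z i))).
  by apply: (@test_fun_tens _ (zrad z)); [move=> i; exact: bump_smooth|exact: bump_supported].
have ib := integrable_mul_test lf sz.
have ibA A : measurable A -> (vol R).-integrable setT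
    (EFin \o (fun x => f x * tens (fun i => bump (z i)) x * \1_A x)).
  by move=> mA; apply/(integrable_mul_indic _ _ mA); exact: integrableS ib.
suff : \forall x \ae vol R, f x * tens (fun i => bump (z i)) x + above f z x = 0.
  by apply: filterS => x /eqP; rewrite addr_eq0 => /eqP.
apply: boxes_ae0 => [n|A /ocboxesP[p [q ->]]].
  have mC := @measurable_ccube R n%:R.
  have fC : (vol R (ccube n%:R) < +oo)%E by rewrite vol_ccube// ltry.
  apply/(integrable_mul_indic _ _ mC).
  have := integrableD measurableT (ibA _ mC) (above_loc_integrable z Hf mC fC).
  by apply: eq_integrable => // x _; rewrite /= -EFinD mulrDl.
have [pq|/existsNP[i /negP]] := pselect (forall i, p i <= q i); last first.
  rewrite -ltNge => qp; rewrite (_ : box p q = set0).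
    by under eq_Rintegral do rewrite indic0 mulr0; rewrite /Rintegral integral0.
  rewrite -subset0 => x [[/= + +] +]; rewrite !in_itv /= => /andP[h0 h0'] /andP[h1 h1'] /andP[h2 h2'].
  elim/ord3_ind: i qp => qp.
  - by have := lt_le_trans h0 (le_trans h0' (ltW qp)); rewrite ltxx.
  - by have := lt_le_trans h1 (le_trans h1' (ltW qp)); rewrite ltxx.
  - by have := lt_le_trans h2 (le_trans h2' (ltW qp)); rewrite ltxx.
have mB := measurable_box p q.
under eq_Rintegral do rewrite mulrDl.
rewrite (RintegralD measurableT (ibA _ mB) (above_loc_integrable z Hf mB (vol_box_fin pq))).
by rewrite box_identity// integral_above// addNr.
Qed.

(** A box that supports the product of the bumps centred at the coordinates of z. *)
Definition ubox z : set (space3 R) :=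
  `[z o0 - 1, z o0 + 1]%classic `*` `[z o1 - 1, z o1 + 1]%classic `*` `[z o2 - 1, z o2 + 1]%classic.

Lemma vol_ubox z : vol R (ubox z) = 8%:E.
Proof.
have e (a : R) : leb R (`[a - 1, a + 1]%classic : set R) = 2%:E.
  by rewrite lebesgue_measure_itv /= lte_fin ifT; [rewrite -EFinD; congr (_%:E); ring|lra].
by rewrite vol_prod// !e -!EFinM; congr (_%:E); ring.
Qed.

Lemma measurable_ubox z : measurable (ubox z).
Proof. by apply: measurableX => //; exact: measurableX. Qed.

Lemma tens_wt_bound : exists2 B : R, 0 < B & forall z e x, `|tens (wt z e) x| <= B * \1_(ubox z) x.
Proof.
have [B B1 hB] := @bump_bounded R.
have B0 : 0 < B by exact: lt_le_trans B1.
exists (B * B * B); first by rewrite !mulr_gt0.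
move=> z e x; rewrite indicE.
have [xu|/negP xu] := boolP (x \in ubox z).
  rewrite mulr1; apply: (@tens_norm_le _ _ _ (fun=> B)) => i.
  by rewrite /wt /wgt; case: (vec3 _ _ _ _); have [] := hB (z i) (coord3 x i).
rewrite mulr0 tens_eq0 ?normr0//.
have [i iz] : exists i, 1 < `|coord3 x i - z i|.
  apply: contra_notP xu => /forallNP h; rewrite inE.
  have h' i : z i - 1 <= coord3 x i <= z i + 1.
    by have /negP := h i; rewrite -leNgt ler_distl.
  by split; first split; rewrite /= in_itv /=; [exact: (h' o0)|exact: (h' o1)|exact: (h' o2)].
exists i; have [b0 b0'] := bump_out iz.
by rewrite /wt /wgt; case: (vec3 _ _ _ _).
Qed.

(** Each of the eight terms of the Leibniz expansion is a square integrable
function d times a weight that is bounded by B and supported in [ubox z], of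
volume 8. Integrate |d| <= d^2 / e + e on this box. *)
Lemma dcut_L1 : exists2 C : R, 0 < C & forall f z e, Hk_mem 3 f -> 0 < e ->
  (Hk_sq 3 f <= (e ^+ 2)%:E)%E -> \int[vol R]_x `|dcut z f x| <= C * e.
Proof.
have [B B0 hB] := tens_wt_bound.
exists (8 * (B * 9)); first by rewrite !mulr_gt0.
move=> f z e Hf e0 fe.
pose F (k : bool * bool * bool) x := B * (e^-1 * dm k f x ^+ 2 + e * \1_(ubox z) x).
have Ldm k : L2 (dm k f) by exact: Hk_mem_mixed_partial.
have iu : (vol R).-integrable setT (EFin \o \1_(ubox z)).
  have fu : (vol R (ubox z) < +oo)%E by rewrite vol_ubox ltry.
  by apply: integrable_indic_fin; [exact: measurable_ubox|exact: fu].
have i1 k : (vol R).-integrable setT (EFin \o (fun x => e^-1 * dm k f x ^+ 2)).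
  by have := integrableZl measurableT e^-1 (L2_sqr (Ldm k)); apply: eq_integrable.
have i2 : (vol R).-integrable setT (EFin \o (fun x => e * \1_(ubox z) x)).
  by have := integrableZl measurableT e iu; apply: eq_integrable.
have i3 k : (vol R).-integrable setT (EFin \o (fun x => e^-1 * dm k f x ^+ 2 + e * \1_(ubox z) x)).
  by have := integrableD measurableT (i1 k) i2; apply: eq_integrable.
have iF k : (vol R).-integrable setT (EFin \o F k).
  by have := integrableZl measurableT B (i3 k); apply: eq_integrable.
apply: (@le_trans _ _ (\int[vol R]_x (\sum_k F k x))).
  apply: le_Rintegral => //.
  - by have /integrable_abse := dcut_integrable z Hf.
  - exact: integrable_sum_real.
  move=> x _; apply: (le_trans (ler_norm_sum _ _ _)); apply: ler_sum => k _.
  rewrite normrM /F; apply: (le_trans (ler_wpM2l (normr_ge0 _) (hB z k x))).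
  rewrite mulrCA ler_pM2l// indicE; case: (_ \in _); rewrite ?mulr1 ?mulr0 ?addr0; last first.
    by rewrite mulr_ge0 ?sqr_ge0// invr_ge0 ltW.
  rewrite -(ler_pM2l e0) mulrDr mulrA divff ?gt_eqF// mul1r -[dm k f x ^+ 2]real_normK ?num_real//.
  have h1 := sqr_ge0 (`|dm k f x| - e); have h2 := sqr_ge0 (`|dm k f x|); have h3 := sqr_ge0 e.
  nra.
rewrite Rintegral_sum//.
have FE k : \int[vol R]_x F k x <= B * 9 * e.
  rewrite /F (RintegralZl _ measurableT (i3 k)) -mulrA ler_pM2l//.
  rewrite (RintegralD measurableT (i1 k) i2) (RintegralZl _ measurableT (L2_sqr (Ldm k))).
  rewrite (RintegralZl _ measurableT iu).
  have -> : \int[vol R]_x (\1_(ubox z) x) = 8.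
    rewrite /Rintegral integral_indic//; last exact: measurable_ubox.
    by rewrite setIT; apply: (congr1 fine (vol_ubox z)).
  have sq : \int[vol R]_x (dm k f x ^+ 2) <= e ^+ 2.
    rewrite -lee_fin /Rintegral fineK; last by apply: integrable_fin_num => //; exact: L2_sqr.
    by apply: le_trans fe; exact: sqint_mixed_partial.
  have : e^-1 * \int[vol R]_x (dm k f x ^+ 2) <= e.
    by rewrite mulrC ler_pdivrMr// -expr2.
  lra.
apply: (le_trans (ler_sum _ (fun k _ => FE k))).
rewrite sumr_const (_ : #|_| = 8%N); last by rewrite !card_prod card_bool.
by rewrite -[X in X <= _]mulr_natl !mulrA lexx.
Qed.

(** Near its centre a bump is bounded below, so the representation formula bounds
f there by the L^1 norm of [dcut]. Every point is near a point with integer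
coordinates; these are countably many centres, hence one null set suffices. *)
Lemma sobolev_Linfty : exists2 C : R, 0 < C & forall f e, Hk_mem 3 f -> 0 < e ->
  (Hk_sq 3 f <= (e ^+ 2)%:E)%E -> \forall x \ae vol R, `|f x| <= C * e.
Proof.
have [C C0 hC] := dcut_L1; have [c c0 hc] := @bump_center R.
exists (C / (c * c * c)); first by rewrite divr_gt0 ?mulr_gt0.
move=> f e Hf e0 fe.
(* an enumeration of the points with integer coordinates *)
pose zz (n : nat) : 'I_3 -> R := if @unpickle (int * int * int)%type n is Some k then
  vec3 (k.1.1)%:~R (k.1.2)%:~R (k.2)%:~R else fun=> 0.
have : \forall x \ae vol R, forall n, f x * tens (fun i => bump (zz n i)) x = - above f (zz n) x.
  by apply: ae_foralln => n; exact: bump_representation.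
apply: filterS => x hx.
pose k (i : 'I_3) : int := Num.floor (coord3 x i + 1 / 2).
have kx i : `|coord3 x i - (k i)%:~R| <= 1 / 2.
  have /andP[h1 h2] := floor_itv (coord3 x i + 1 / 2).
  rewrite -/(k i) intrD in h1 h2.
  by rewrite ler_norml; apply/andP; split; lra.
have := hx (pickle (k o0, k o1, k o2)); set z := zz _ => hz.
have zE i : z i = (k i)%:~R by rewrite /z /zz pickleK; elim/ord3_ind: i.
have bz i : c <= bump (z i) (coord3 x i) by apply: hc; rewrite zE.
have tz : c * c * c <= tens (fun i => bump (z i)) x.
  have c0' := ltW c0.
  exact: (ler_pM (mulr_ge0 c0' c0') c0' (ler_pM c0' c0' (bz o0) (bz o1)) (bz o2)).
rewrite mulrAC ler_pdivlMr ?mulr_gt0//.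
apply: (@le_trans _ _ `|f x * tens (fun i => bump (z i)) x|).
  rewrite normrM ler_wpM2l// (le_trans tz)// ler_norm//.
rewrite hz normrN; apply: le_trans (hC f z e Hf e0 fe).
exact: above_bound.
Qed.

End Sobolev.

(** * Functions of time with a distributional derivative *)

Section Step.
Context {R : realType}.

Lemma step_den_gt0 (x : R) : 0 < flat 1 x + flat 1 (-1 * x + 1).
Proof.
have pos (y : R) : 0 < y -> 0 < flat 1 y.
  by move=> y0; rewrite /flat y0 hornerE mul1r expR_gt0.
have [x0|x0] := ltP 0 x; first by rewrite ltr_pwDl ?pos ?flat1_ge0.
by rewrite ltr_wpDl ?flat1_ge0// pos//; lra.
Qed.

(** A smooth function that increases from 0 at x = 0 to 1 at x = 1. *)
Definition step (x : R) : R := flat 1 x * (flat 1 x + flat 1 (-1 * x + 1))^-1.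

Lemma step_smooth : smooth step.
Proof.
apply: smoothM; first exact: flat_smooth.
apply: smoothV; first by move=> x; rewrite gt_eqF// step_den_gt0.
by apply: smoothD; [exact: flat_smooth|apply: smooth_affine; exact: flat_smooth].
Qed.

Lemma step_le0 (x : R) : x <= 0 -> step x = 0.
Proof. by move=> x0; rewrite /step flat0 ?mul0r. Qed.

Lemma step_ge1 (x : R) : 1 <= x -> step x = 1.
Proof.
move=> x1; rewrite /step [flat 1 (_ + _)]flat0 ?addr0; last by lra.
by rewrite divff// gt_eqF// /flat (lt_le_trans ltr01 x1) hornerE mul1r expR_gt0.
Qed.

Lemma step_01 (x : R) : 0 <= step x <= 1.
Proof.
rewrite /step; apply/andP; split.
  by rewrite mulr_ge0 ?flat1_ge0// invr_ge0 ltW// step_den_gt0.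
by rewrite ler_pdivrMr ?step_den_gt0// mul1r lerDl flat1_ge0.
Qed.

Lemma dstep_out (x : R) : x < 0 \/ 1 < x -> 'D_1 step x = 0.
Proof.
case=> x0.
  rewrite (@near_eq_derive _ _ _ _ (cst 0)) ?derive_cst//.
  by near=> y; rewrite step_le0//; apply: ltW; near: y; exact: lt_nbhsl.
rewrite (@near_eq_derive _ _ _ _ (cst (1 : R))) ?derive_cst//.
by near=> y; rewrite step_ge1//; apply: ltW; near: y; exact: lt_nbhsr.
Unshelve. all: by end_near. Qed.

Lemma smooth_bounded (g : R -> R) M : smooth g -> supported M g ->
  exists2 C, 0 < C & forall x, `|g x| <= C.
Proof.
move=> sg suM; have cg := smooth_continuous sg.
have /compact_bounded [C [_ hC]] : compact (g @` `[- M, M]).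
  by apply: continuous_compact; [exact: continuous_subspaceT|exact: segment_compact].
exists (`|C| + 1) => [|x]; first by rewrite ltr_wpDl.
have [xM|Mx] := leP `|x| M; last by rewrite suM// normr0 addr_ge0.
apply: (hC (`|C| + 1)); first by rewrite (le_lt_trans (ler_norm C))// ltrDl.
by exists x => //=; rewrite in_itv /= -ler_norml.
Qed.

Lemma dstep_bounded : exists2 C, 0 < C & forall x, `|'D_1 step x| <= C.
Proof.
apply: (@smooth_bounded _ 1); first by apply: smooth_derive; exact: step_smooth.
move=> x; rewrite ltr_normr => /orP[] h; apply: dstep_out; first by right.
by left; lra.
Qed.

(** Continuity on [0, T] without any condition outside of this interval. *)
Definition cont_on (T : R) (m : R -> R) := forall t, t \in `[0, T] ->
  forall e, 0 < e -> exists2 d, 0 < d & forall r, r \in `[0, T] -> `|r - t| < d -> `|m r - m t| <= e.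

Lemma cont_onP T m : cont_on T m -> {within `[0, T], continuous m}.
Proof.
move=> cm; apply/subspace_continuousP => t tT.
apply/cvgrPdist_le => e e0; have [d d0 hd] := cm t tT e e0.
rewrite near_withinE; near=> r => rT; rewrite distrC; apply: hd => //.
Unshelve. all: by end_near. Qed.

(** A smooth jump at time s; its derivative approximates the Dirac mass at s. *)
Definition rise (n : nat) (s r : R) : R := step (n.+1%:R * r + - (n.+1%:R * s)).

Lemma rise_smooth n s : smooth (rise n s).
Proof. by apply: smooth_affine; exact: step_smooth. Qed.

Lemma derive_rise n s r : 'D_1 (rise n s) r = n.+1%:R * 'D_1 step (n.+1%:R * r + - (n.+1%:R * s)).
Proof.
have h := smooth_is_derive (n.+1%:R * r + - (n.+1%:R * s)) 1 step_smooth.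
by have [_ ->] := is_derive_affine h.
Qed.

Lemma RintegralDrise T n s : 0 < T -> 0 <= s -> s + n.+1%:R^-1 <= T ->
  \int[leb R]_(r in `[0, T]) 'D_1 (rise n s) r = 1.
Proof.
move=> T0 s0 sT; have sr := rise_smooth n s.
have cr := smooth_continuous sr.
have cdr := smooth_continuous (smooth_derive (1 : R) sr).
have n0 : 0 < n.+1%:R :> R by rewrite ltr0n.
have dcr : derivable_oo_LRcontinuous (rise n s) 0 T.
  split; first by move=> x _; have [] := smooth_is_derive x 1 sr.
    by apply: cvg_at_right_filter; exact: cr.
  by apply: cvg_at_left_filter; exact: cr.
have cdT : {within `[0, T], continuous ('D_1 (rise n s))}.
  by apply: continuous_subspaceT => x; exact: cdr.
have d1E : {in `]0, T[, (rise n s)^`()%classic =1 'D_1 (rise n s)}.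
  by move=> x _; rewrite derive1E.
have := continuous_FTC2 T0 cdT dcr d1E; rewrite /Rintegral => ->.
rewrite -EFinB /= /rise step_ge1 ?step_le0 ?subr0//.
  by rewrite mulr0 add0r oppr_le0 mulr_ge0// ltW.
by rewrite -mulrBr -ler_pdivrMl// mulr1 lerBrDl.
Qed.

(** The derivative of the jump has integral 1 and is bounded by C * (n+1) on an
interval of length 1 / (n+1), outside of which it vanishes. *)
Lemma rise_delta C T m n s e : 0 < C -> (forall x : R, `|'D_1 step x| <= C) ->
  0 < T -> 0 <= s -> s + n.+1%:R^-1 <= T -> 0 <= e -> cont_on T m ->
  (forall r, r \in `[0, T] -> s <= r <= s + n.+1%:R^-1 -> `|m r - m s| <= e) ->
  `|\int[leb R]_(r in `[0, T]) ('D_1 (rise n s) r * m r) - m s| <= C * e.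
Proof.
move=> C0 hC T0 s0 sT e0 cm hm; have n0 : 0 < n.+1%:R :> R by rewrite ltr0n.
have cD r : {for r, continuous ('D_1 (rise n s))}.
  by have := smooth_continuous (smooth_derive (1 : R) (rise_smooth n s)); exact.
have mITV : measurable (`[0, T]%classic : set (timeline R)) by exact: measurable_itv.
have cI (g : R -> R) : {within `[0, T], continuous g} -> (leb R).-integrable `[0, T] (EFin \o g).
  by move=> cg; apply: continuous_compact_integrable => //; exact: segment_compact.
have i1 : (leb R).-integrable `[0, T] (EFin \o (fun r : R => 'D_1 (rise n s) r * m r)).
  apply: cI => r; apply: cvgM; last exact: cont_onP cm _.
  by have := @continuous_subspaceT _ _ `[0, T] _ cD r.
have i2 : (leb R).-integrable `[0, T] (EFin \o (fun r : R => 'D_1 (rise n s) r)).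
  by apply: cI; exact: continuous_subspaceT.
have i3 : (leb R).-integrable `[0, T] (EFin \o (fun r : R => 'D_1 (rise n s) r * m s)).
  by have := integrableZr mITV (m s) i2; apply: eq_integrable.
have -> : m s = \int[leb R]_(r in `[0, T]) ('D_1 (rise n s) r * m s).
  by rewrite RintegralZr// RintegralDrise// mul1r.
rewrite -RintegralB//.
have i4 : (leb R).-integrable `[0, T] (EFin \o (fun r : R => 'D_1 (rise n s) r * m r - 'D_1 (rise n s) r * m s)).
  by have := integrableB mITV i1 i3; apply: eq_integrable.
apply: (le_trans (le_normr_Rintegral mITV i4)).
pose I := `[s, s + n.+1%:R^-1]%classic : set (timeline R).
have mI : measurable I by exact: measurable_itv.
have lI : leb R I = (n.+1%:R^-1)%:E.
  rewrite lebesgue_measure_itv /= lte_fin ltrDl invr_gt0 n0 -EFinD.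
  by congr (_%:E); ring.
have lIf : (leb R I < +oo)%E by rewrite lI ltry.
have iI : (leb R).-integrable setT (EFin \o \1_I) := integrable_indic_fin mI lIf.
have i5 : (leb R).-integrable setT (EFin \o (fun r : R => n.+1%:R * C * e * \1_I r)).
  by have := integrableZl measurableT (n.+1%:R * C * e) iI; apply: eq_integrable.
have i6 : (leb R).-integrable `[0, T] (EFin \o (fun r : R => n.+1%:R * C * e * \1_I r)).
  exact: integrableS i5.
apply: (@le_trans _ _ (\int[leb R]_(r in `[0, T]) (n.+1%:R * C * e * \1_I r))).
  apply: le_Rintegral => //; first by have /integrable_abse := i4.
  move=> r rT; rewrite -mulrBr normrM derive_rise indicE.
  have [rI|/negP rI] := boolP (r \in I).
    rewrite mulr1; apply: ler_pM => //.
      by rewrite normrM ger0_norm ?ler_wpM2l// ltW.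
    by apply: hm => //; move/set_mem: rI; rewrite /I /= in_itv.
  rewrite dstep_out ?mulr0 ?normr0 ?mul0r//.
  have [rs|sr] := ltP r s.
    by left; rewrite -mulrBr pmulr_rlt0// subr_lt0.
  right; rewrite -mulrBr -ltr_pdivrMl// mulr1 ltrBrDl ltNge; apply/negP => rs.
  by apply: rI; rewrite inE /I /= in_itv /= sr.
rewrite /Rintegral; apply: (@le_trans _ _ (fine (\int[leb R]_r (n.+1%:R * C * e * \1_I r)%:E)%E)).
  apply: fine_le.
  - exact: integrable_fin_num i6.
  - exact: integrable_fin_num i5.
  - apply: ge0_subset_integral => //; last first.
      by move=> x _; rewrite lee_fin mulr_ge0// ?mulr_ge0// ltW.
    exact: (measurable_int _ i5).
have := RintegralZl (n.+1%:R * C * e) measurableT iI; rewrite {1}/Rintegral => ->.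
have EI : \int[leb R]_r (\1_I r) = n.+1%:R^-1.
  have := integral_indic (leb R) measurableT mI; rewrite setIT => EI.
  rewrite /Rintegral; apply: (etrans (congr1 fine EI)).
  exact: (congr1 fine lI).
apply: (@le_trans _ _ (n.+1%:R * C * e * n.+1%:R^-1)).
  apply: ler_wpM2l; first by rewrite !mulr_ge0// ltW.
  by rewrite -EI lexx.
move: n0; set N := n.+1%:R => N0.
by rewrite mulrC !mulrA mulVf ?mul1r// gt_eqF.
Qed.

Lemma dist_le_approx (a1 a2 a3 x y k e : R) : - a3 = a1 - a2 ->
  `|a1 - x| <= e / 2 -> `|a2 - y| <= e / 2 -> `|a3| <= k -> `|y - x| <= k + e.
Proof.
by rewrite !ler_norml => ? /andP[? ?] /andP[? ?] /andP[? ?]; apply/andP; split; lra.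
Qed.

(** Test the equation m' = c with the difference of two smooth jumps, at s and
at t: its derivative tends to the difference of the Dirac masses. *)
Lemma weak_lipschitz T m c K s t : cont_on T m -> cont_on T c ->
  (forall r, r \in `[0, T] -> `|c r| <= K) ->
  (forall eta : R -> R, test_fun `]0, T[%classic eta ->
     \int[leb R]_(r in `]0, T[) ('D_1 eta r * m r + eta r * c r) = 0) ->
  0 < s -> s <= t -> t < T -> `|m t - m s| <= K * T.
Proof.
move=> cm cc cK weak s0 st tT; have [CS CS0 hCS] := dstep_bounded.
have T0 : 0 < T by lra.
have K0 : 0 <= K.
  have c0K : `|c 0| <= K by apply: cK; rewrite in_itv /= lexx ltW.
  exact: le_trans (normr_ge0 _) c0K.
apply/ler_addgt0Pr => e' e'0.
pose e := e' / (2 * CS).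
have Ce : CS * e = e' / 2 by rewrite /e; field; rewrite gt_eqF.
have e0 : 0 < e by rewrite divr_gt0// mulr_gt0.
have sI : s \in `[0, T] by rewrite in_itv /= (ltW s0); lra.
have tI : t \in `[0, T] by rewrite in_itv /= (ltW tT) andbT; lra.
have [d1 d10 hd1] := cm s sI e e0; have [d2 d20 hd2] := cm t tI e e0.
pose d := Num.min d1 (Num.min d2 (T - t)).
have d0 : 0 < d by rewrite !lt_min d10 d20 subr_gt0 tT.
(* the two jumps must fit in the intervals of continuity and before time T *)
pose n := Num.truncn d^-1.
have nd : n.+1%:R^-1 < d.
  rewrite -[d]invrK ltf_pV2 ?posrE ?invr_gt0 ?ltr0n//; exact: truncnS_gt.
move: (nd); rewrite !lt_min => /and3P[nd1 nd2 nT].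
have n0 : 0 < n.+1%:R^-1 :> R by rewrite invr_gt0 ltr0n.
pose io : R := n.+1%:R^-1; rewrite -/io in nd nd1 nd2 nT n0.
have tio : t + io <= T by lra.
have sio : s + io <= T by lra.
have near_io a r : a <= r <= a + io -> `|r - a| <= io.
  by move=> /andP[ar ra]; rewrite ger0_norm; lra.
pose eta r := rise n s r - rise n t r.
have seta : smooth eta by apply: smoothB; exact: rise_smooth.
have tes : test_fun `]0, T[%classic eta.
  split => //; exists `[s, t + io]%classic; split.
  - exact: segment_compact.
  - by move=> r /=; rewrite !in_itv /= => /andP[sr rt]; apply/andP; split; lra.
  - move=> r /=; rewrite in_itv /= => /negP; rewrite negb_and -!ltNge => /orP[rs|tr].
      rewrite /eta /rise !step_le0 ?subrr// -mulrBr pmulr_rle0 ?ltr0n//; lra.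
    rewrite /eta /rise !step_ge1 ?subrr// -mulrBr -ler_pdivrMl ?ltr0n// mulr1 -/io; lra.
have deta r : 'D_1 eta r = 'D_1 (rise n s) r - 'D_1 (rise n t) r.
  have [_ ->] // := is_deriveB (smooth_is_derive r 1 (rise_smooth n s)) (smooth_is_derive r 1 (rise_smooth n t)).
have etab r : `|eta r| <= 1.
  have /andP[a0 a1] := step_01 (n.+1%:R * r + - (n.+1%:R * s)).
  have /andP[b0 b1] := step_01 (n.+1%:R * r + - (n.+1%:R * t)).
  by rewrite ler_norml /eta /rise; apply/andP; split; lra.
have mITV : measurable (`[0, T]%classic : set (timeline R)) by exact: measurable_itv.
have cI (g h : R -> R) : smooth g -> cont_on T h -> (leb R).-integrable `[0, T] (EFin \o (fun r : R => g r * h r)).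
  move=> sg ch; apply: continuous_compact_integrable; first exact: segment_compact.
  move=> r; apply: cvgM; last exact: cont_onP ch _.
  by have := @continuous_subspaceT _ _ `[0, T] _ (smooth_continuous sg) r.
have i1 := cI _ _ (smooth_derive (1 : R) (rise_smooth n s)) cm.
have i2 := cI _ _ (smooth_derive (1 : R) (rise_smooth n t)) cm.
have i3 := cI _ _ seta cc.
have i4 := cI _ _ (smooth_derive (1 : R) seta) cm.
have i5 : (leb R).-integrable `[0, T] (EFin \o (fun r : R => 'D_1 eta r * m r + eta r * c r)).
  by have := integrableD mITV i4 i3; apply: eq_integrable.
have := weak _ tes.
rewrite Rintegral_itv_bndo_bndc; last first.
  by apply: integrableS i5 => //; exact: subset_itv_oo_cc.
rewrite Rintegral_itv_obnd_cbnd; last first.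
  by apply: integrableS i5 => //; exact: subset_itv_oc_cc.
rewrite (RintegralD mITV i4 i3) => /eqP; rewrite addr_eq0 => /eqP E.
have : \int[leb R]_(r in `[0, T]) ('D_1 eta r * m r) =
    \int[leb R]_(r in `[0, T]) ('D_1 (rise n s) r * m r) -
    \int[leb R]_(r in `[0, T]) ('D_1 (rise n t) r * m r).
  rewrite -(RintegralB mITV i1 i2); apply: eq_Rintegral => r _.
  by rewrite deta mulrBl.
rewrite E => E'.
have bc : `|\int[leb R]_(r in `[0, T]) (eta r * c r)| <= K * T.
  apply: (le_trans (le_normr_Rintegral mITV i3)).
  apply: (@le_trans _ _ (\int[leb R]_(r in `[0, T]) K)).
    apply: le_Rintegral => //.
    - by have /integrable_abse := i3.
    - by apply: continuous_compact_integrable; [exact: segment_compact|exact: continuous_subspaceT (@cst_continuous _ _ _)].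
    - move=> r rT; rewrite normrM -[K]mul1r; apply: ler_pM => //; exact: cK.
  have lT : leb R (`[0, T]%classic : set R) = T%:E.
    by rewrite lebesgue_measure_itv /= lte_fin T0 oppr0 adde0.
  rewrite (_ : Rintegral _ _ _ = K * T)//.
  apply: (etrans (Rintegral_cst _ mITV K)); congr (_ * _).
  exact: (congr1 fine lT).
have h1 := rise_delta (m := m) (n := n) (s := s) (e := e) CS0 hCS T0 (ltW s0) _ (ltW e0) cm _.
have h2 := rise_delta (m := m) (n := n) (s := t) (e := e) CS0 hCS T0 _ _ (ltW e0) cm _.
rewrite -/io in h1 h2.
have {}h1 : `|\int[leb R]_(r in `[0, T]) ('D_1 (rise n s) r * m r) - m s| <= CS * e.
  apply: h1 => // r rT /near_io rs; apply: hd1 => //; exact: le_lt_trans rs nd1.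
have {}h2 : `|\int[leb R]_(r in `[0, T]) ('D_1 (rise n t) r * m r) - m t| <= CS * e.
  apply: h2 => //; first exact: le_trans (ltW s0) st.
  by move=> r rT /near_io rs; apply: hd2 => //; exact: le_lt_trans rs nd2.
rewrite Ce in h1 h2.
exact: dist_le_approx E' h1 h2 bc.
Qed.

End Step.

(** * Densities continuous in time with values in L^1 *)

Section CL1.
Context {R : realType}.
Implicit Types (F q : timeline R -> space3 R -> R) (T : R).

(** The space C([0, T]; L^1). *)
Definition C_L1 T F := forall t : R, t \in `[0, T] ->
  (vol R).-integrable setT (EFin \o F t) /\
  forall e : R, 0 < e -> exists2 d : R, 0 < d & forall r : R, r \in `[0, T] -> `|r - t| < d ->
    \int[vol R]_x `|F r x - F t x| <= e.

Lemma integrable_measurable (f : space3 R -> R) :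
  (vol R).-integrable setT (EFin \o f) -> measurable_fun setT f.
Proof. by move=> /measurable_int/measurable_EFinP. Qed.

Lemma integrable_norm (f : space3 R -> R) :
  (vol R).-integrable setT (EFin \o f) -> (vol R).-integrable setT (EFin \o (fun x => `|f x|)).
Proof. by move=> /integrable_abse. Qed.

Lemma integrable_sub (f g : space3 R -> R) :
  (vol R).-integrable setT (EFin \o f) -> (vol R).-integrable setT (EFin \o g) ->
  (vol R).-integrable setT (EFin \o (fun x => f x - g x)).
Proof. by move=> h1 h2; have := integrableB measurableT h1 h2; apply: eq_integrable. Qed.

Lemma integrable_mul_bounded (f g : space3 R -> R) M :
  (vol R).-integrable setT (EFin \o f) -> measurable_fun setT g -> (forall x, `|g x| <= M) ->
  (vol R).-integrable setT (EFin \o (fun x => f x * g x)).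
Proof.
move=> fi mg gM; apply: (@integrable_le _ _ _ _ _ (fun x => `|f x| * M)).
- by apply: measurable_funM => //; exact: integrable_measurable.
- by have := integrableZr measurableT M (integrable_norm fi); apply: eq_integrable.
- by move=> x; rewrite normrM ler_wpM2l.
Qed.

Lemma Rintegral_mul_le (f g : space3 R -> R) M :
  (vol R).-integrable setT (EFin \o f) -> measurable_fun setT g -> (forall x, `|g x| <= M) ->
  `|\int[vol R]_x (f x * g x)| <= M * \int[vol R]_x `|f x|.
Proof.
move=> fi mg gM; have ifg := integrable_mul_bounded fi mg gM.
apply: (le_trans (le_normr_Rintegral measurableT ifg)).
rewrite -(RintegralZl _ measurableT (integrable_norm fi)).
apply: le_Rintegral => //; first exact: integrable_norm.
  by have := integrableZl measurableT M (integrable_norm fi); apply: eq_integrable.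
by move=> x _; rewrite normrM mulrC ler_wpM2r.
Qed.

Lemma C_L1_pairing T F (g : space3 R -> R) (M : R) : C_L1 T F -> measurable_fun setT g -> (forall x, `|g x| <= M) ->
  cont_on T (fun t => \int[vol R]_x (F t x * g x)).
Proof.
move=> CF mg gM t tT e e0; have [iF cF] := CF t tT.
have M0 : 0 <= M by exact: le_trans (normr_ge0 _) (gM (0, 0, 0)).
have M1 : 0 < M + 1 by rewrite ltr_wpDl.
have [d d0 hd] := cF (e / (M + 1)) (divr_gt0 e0 M1).
exists d => // r rT rd; have [iFr _] := CF r rT.
have i1 := integrable_mul_bounded iF mg gM; have i2 := integrable_mul_bounded iFr mg gM.
rewrite -(RintegralB measurableT i2 i1).
under eq_Rintegral do rewrite -mulrBl.
apply: (le_trans (Rintegral_mul_le (integrable_sub iFr iF) mg gM)).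
apply: (@le_trans _ _ (M * (e / (M + 1)))); first by rewrite ler_wpM2l// hd.
rewrite mulrA ler_pdivrMr// mulrC ler_pM2l//; lra.
Qed.

Lemma C_L1_norm T F : C_L1 T F -> cont_on T (fun t => \int[vol R]_x `|F t x|).
Proof.
move=> CF t tT e e0; have [iF cF] := CF t tT.
have [d d0 hd] := cF e e0.
exists d => // r rT rd; have [iFr _] := CF r rT; apply: le_trans (hd r rT rd).
rewrite -(RintegralB measurableT (integrable_norm iFr) (integrable_norm iF)).
apply: (le_trans (le_normr_Rintegral measurableT (integrable_sub (integrable_norm iFr) (integrable_norm iF)))).
apply: le_Rintegral => //.
- exact: integrable_norm (integrable_sub (integrable_norm iFr) (integrable_norm iF)).
- exact: integrable_norm (integrable_sub iFr iF).
- by move=> x _; exact: ler_dist_dist.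
Qed.

Lemma cont_on_bounded T (m : R -> R) : cont_on T m ->
  exists2 K, 0 <= K & forall r, r \in `[0, T] -> `|m r| <= K.
Proof.
move=> /cont_onP cm.
have /compact_bounded [C [_ hC]] : compact (m @` `[0, T]).
  by apply: continuous_compact => //; exact: segment_compact.
exists (`|C| + 1) => [|x xT]; first by rewrite addr_ge0.
by apply: (hC (`|C| + 1)); [rewrite (le_lt_trans (ler_norm C))// ltrDl|exists x].
Qed.

End CL1.

Section Cutoff.
Context {R : realType}.

(** A smooth function equal to 1 on [-1, 1] and supported in [-2, 2]. *)
Definition plateau (y : R) : R := step (1 * y + 2) * step (-1 * y + 2).

Lemma plateau_smooth : smooth plateau.
Proof. by apply: smoothM; apply: smooth_affine; exact: step_smooth. Qed.

Lemma plateau_01 y : 0 <= plateau y <= 1.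
Proof.
rewrite /plateau; have /andP[a0 a1] := step_01 (1 * y + 2).
have /andP[b0 b1] := step_01 (-1 * y + 2).
by apply/andP; split; [exact: mulr_ge0|exact: mulr_ile1].
Qed.

Lemma plateau1 y : `|y| <= 1 -> plateau y = 1.
Proof.
by rewrite ler_norml => /andP[? ?]; rewrite /plateau !step_ge1 ?mulr1//; lra.
Qed.

Lemma plateau_supported : supported 2 plateau.
Proof.
move=> y; rewrite ltr_normr => /orP[h|h]; rewrite /plateau.
  by rewrite [X in _ * X]step_le0 ?mulr0//; lra.
by rewrite [X in X * _]step_le0 ?mul0r//; lra.
Qed.

Definition cut (n : nat) (y : R) : R := plateau (n.+1%:R^-1 * y + 0).

Lemma cut_smooth n : smooth (cut n).
Proof. by apply: smooth_affine; exact: plateau_smooth. Qed.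

Lemma derive_cut n y : 'D_1 (cut n) y = n.+1%:R^-1 * 'D_1 plateau (n.+1%:R^-1 * y + 0).
Proof.
have h := smooth_is_derive (n.+1%:R^-1 * y + 0) 1 plateau_smooth.
by have [_ ->] := is_derive_affine h.
Qed.

Lemma cut_supported n : supported (2 * n.+1%:R) (cut n).
Proof.
move=> y hy; apply: plateau_supported; rewrite addr0 normrM gtr0_norm ?invr_gt0//.
by rewrite mulrC ltr_pdivlMr.
Qed.

Definition cut3 n : space3 R -> R := tens (fun=> cut n).

Lemma cut3_test n : test_fun setT (cut3 n).
Proof. by apply: (@test_fun_tens _ (2 * n.+1%:R)) => _; [exact: cut_smooth|exact: cut_supported]. Qed.

Lemma cut_norm_le1 n y : `|cut n y| <= 1.
Proof. by have /andP[h0 h1] := plateau_01 (n.+1%:R^-1 * y + 0); rewrite ger0_norm. Qed.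

Lemma cut3_le1 n x : `|cut3 n x| <= 1.
Proof.
have := @tens_norm_le _ (fun=> cut n) x (fun=> 1).
by rewrite !mulr1; apply => i; exact: cut_norm_le1.
Qed.

Lemma cut3_cvg x : cut3 n x @[n --> \oo] --> (1 : R).
Proof.
apply: cvg_near_cst; have [N hN] := ccube_exhaust x.
exists N => // n /= Nn; have /in_ccube xn := hN n.+1 (leq_trans Nn (leqnSn n)).
have c1 i : cut n (coord3 x i) = 1.
  rewrite /cut plateau1// addr0 normrM gtr0_norm ?invr_gt0// mulrC ler_pdivrMr// mul1r.
  exact: xn.
by rewrite /cut3 /tens (c1 o0) (c1 o1) (c1 o2) !mulr1.
Qed.

(** The cut-off is dilated by n + 1, which divides its derivatives by n + 1. *)
Lemma derive_cut3_bounded : exists2 C, 0 < C & forall n j x,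
  `|'D_(basis3 j) (cut3 n) x| <= C * n.+1%:R^-1.
Proof.
have [C C0 hC] : exists2 C, 0 < C & forall x, `|'D_1 plateau x| <= C.
  apply: (@smooth_bounded _ _ 2); first by apply: smooth_derive; exact: plateau_smooth.
  exact/supported_derive/plateau_supported.
exists C => // n j x; rewrite derive_tens; last by move=> _; exact: cut_smooth.
have hd y : `|'D_1 (cut n) y| <= C * n.+1%:R^-1.
  by rewrite derive_cut normrM gtr0_norm ?invr_gt0// mulrC ler_wpM2r// invr_ge0.
have := @tens_norm_le _ (upd (fun=> cut n) j ('D_1 (cut n))) x (upd (fun=> 1) j (C * n.+1%:R^-1)).
move=> /(_ _)/le_trans; apply.
  by move=> i; rewrite /upd; case: ifP => // _; exact: cut_norm_le1.
by elim/ord3_ind: j; rewrite /upd /= ?mulr1 ?mul1r.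
Qed.

End Cutoff.

(** * Integrating a distributional conservation law *)

Section Conservation.
Context {R : realType}.
Implicit Types (q : timeline R -> space3 R -> R) (J : 'I_3 -> timeline R -> space3 R -> R).
Implicit Types (eta : R -> R) (psi : space3 R -> R) (T : R).

Definition sep eta psi : timeline R * space3 R -> R := fun w => eta w.1 * psi w.2.

Lemma test_fun_sep T eta psi : test_fun `]0, T[%classic eta -> test_fun setT psi ->
  test_fun (open_slab T) (sep eta psi).
Proof.
move=> [se [K [cK KT K0]]] [sp [L [cL _ L0]]]; split.
  have c1 : continuous (fst : timeline R * space3 R -> R) by move=> x; exact: cvg_fst.
  have c2 : continuous (snd : timeline R * space3 R -> space3 R) by move=> x; exact: cvg_snd.
  apply: smoothM.
    exact: (@smooth_comp_linear R (timeline R * space3 R)%type R fst eta c1 se).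
  exact: (@smooth_comp_linear R (timeline R * space3 R)%type (space3 R) snd psi c2 sp).
exists (K `*` L); split.
- exact: compact_setX.
- by move=> [t x] [/= /KT].
- move=> [t x] /not_andP[Kt|Lx]; rewrite /sep /=; first by rewrite K0 ?mul0r.
  by rewrite L0 ?mulr0.
Qed.

Lemma is_derive_sep eta psi w v : smooth eta -> smooth psi ->
  'D_v (sep eta psi) w = eta w.1 * 'D_(v.2) psi w.2 + psi w.2 * 'D_(v.1) eta w.1.
Proof.
move=> se sp.
have d1 : is_derive w v (fun w : timeline R * space3 R => eta w.1) ('D_(v.1) eta w.1).
  have [h1 h2] := @derive_comp_affine R (timeline R * space3 R)%type R fst 0 eta w v.
  have e : (fun w : timeline R * space3 R => eta w.1) = (fun y => eta (y.1 + 0)).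
    by apply/funext => y; rewrite addr0.
  rewrite e; rewrite addr0 in h1 h2; apply: DeriveDef => //.
  by apply: h1; have [] := smooth_is_derive w.1 v.1 se.
have d2 : is_derive w v (fun w : timeline R * space3 R => psi w.2) ('D_(v.2) psi w.2).
  have [h1 h2] := @derive_comp_affine R (timeline R * space3 R)%type (space3 R) snd 0 psi w v.
  have e : (fun w : timeline R * space3 R => psi w.2) = (fun y => psi (y.2 + 0)).
    by apply/funext => y; rewrite addr0.
  rewrite e; rewrite addr0 in h1 h2; apply: DeriveDef => //.
  by apply: h1; have [] := smooth_is_derive w.2 v.2 sp.
by have [_ ->] := is_deriveM d1 d2.
Qed.

Lemma dt_sep eta psi t x : smooth eta -> smooth psi ->
  dt (sep eta psi) t x = 'D_1 eta t * psi x.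
Proof. by move=> se sp; rewrite /dt is_derive_sep//= derive0 mulr0 add0r mulrC. Qed.

Lemma dx_sep eta psi j t x : smooth eta -> smooth psi ->
  dx j (sep eta psi) t x = eta t * 'D_(basis3 j) psi x.
Proof. by move=> se sp; rewrite /dx is_derive_sep//= derive0 mulr0 addr0. Qed.

(** Test the equation with a product of a function of time and the cut-off of
index n. The integral of q against the cut-off is continuous in time and its
distributional derivative, the pairing of J with the gradient of the cut-off,
is O(1/n) because J is bounded in L^1. Hence it varies by O(1/n) between two
positive times; let n tend to infinity. Time 0 is reached by continuity in L^1. *)
Lemma conservation T q J : 0 < T -> C_L1 T q -> (forall j, C_L1 T (J j)) ->
  (forall phi, test_fun (open_slab T) phi -> spacetime_int T (fun t x =>
     q t x * dt phi t x + \sum_j J j t x * dx j phi t x) = 0) ->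
  forall t : R, 0 < t < T -> \int[vol R]_x q t x = \int[vol R]_x q 0 x.
Proof.
move=> T0 Cq CJ weak.
have [C C0 hC] := @derive_cut3_bounded R.
pose m n (t : R) := \int[vol R]_x (q t x * cut3 n x).
pose c n (t : R) := \sum_j \int[vol R]_x (J j t x * 'D_(basis3 j) (cut3 n) x).
have scut n : smooth (@cut3 R n) by have [] := @cut3_test R n.
have mcut n : measurable_fun setT (@cut3 R n) := test_fun_measurable (cut3_test n).
have mdcut n j : measurable_fun setT ('D_(basis3 j) (@cut3 R n)).
  exact: test_fun_measurable (test_fun_derive (basis3 j) (cut3_test n)).
have cm n : cont_on T (m n) by apply: C_L1_pairing Cq (mcut n) (cut3_le1 n).
have cpair n j : cont_on T (fun t => \int[vol R]_x (J j t x * 'D_(basis3 j) (cut3 n) x)).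
  exact: C_L1_pairing (CJ j) (mdcut n j) (hC n j).
have cc n : cont_on T (c n).
  move=> t tT e e0; have e3 : 0 < e / 3 by rewrite divr_gt0.
  have [d0 d00 h0] := cpair n o0 t tT _ e3.
  have [d1 d10 h1] := cpair n o1 t tT _ e3.
  have [d2 d20 h2] := cpair n o2 t tT _ e3.
  exists (Num.min d0 (Num.min d1 d2)); first by rewrite !lt_min d00 d10 d20.
  move=> r rT; rewrite !lt_min => /and3P[r0 r1 r2].
  rewrite /c -sumrB; apply: (le_trans (ler_norm_sum _ _ _)).
  apply: (@le_trans _ _ (\sum_(j < 3) (e / 3))).
    by apply: ler_sum => j _; elim/ord3_ind: j; [exact: h0|exact: h1|exact: h2].
  by rewrite sumr_const card_ord -mulr_natr; lra.
have [K K0 hK] : exists2 K, 0 <= K & forall n t, t \in `[0, T] -> `|c n t| <= K * n.+1%:R^-1.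
  have [K0 K00 h0] := cont_on_bounded (C_L1_norm (CJ o0)).
  have [K1 K10 h1] := cont_on_bounded (C_L1_norm (CJ o1)).
  have [K2 K20 h2] := cont_on_bounded (C_L1_norm (CJ o2)).
  pose KK := K0 + K1 + K2.
  have KK0 : 0 <= KK by rewrite !addr_ge0.
  exists (\sum_(j < 3) C * KK); first by apply: sumr_ge0 => j _; rewrite mulr_ge0// ltW.
  move=> n t tT; rewrite mulr_suml; apply: (le_trans (ler_norm_sum _ _ _)).
  apply: ler_sum => j _; have [iJ _] := CJ j t tT.
  apply: (le_trans (Rintegral_mul_le iJ (mdcut n j) (hC n j))).
  rewrite mulrAC ler_wpM2r ?invr_ge0//; apply: ler_wpM2l; first exact: ltW.
  apply: (le_trans (ler_norm _)).
  have kk : [/\ K0 <= KK, K1 <= KK & K2 <= KK] by rewrite /KK; split; lra.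
  case: kk => k0 k1 k2.
  by elim/ord3_ind: j {iJ}; [exact: le_trans (h0 t tT) k0|exact: le_trans (h1 t tT) k1|
    exact: le_trans (h2 t tT) k2].
have lip n s t : 0 < s -> s <= t -> t < T -> `|m n t - m n s| <= K * n.+1%:R^-1 * T.
  apply: (weak_lipschitz (cm n) (cc n) (hK n)) => eta te.
  have se := te.1.
  apply: (etrans _ (weak _ (test_fun_sep te (cut3_test n)))).
  rewrite /spacetime_int; apply: eq_Rintegral => r.
  rewrite inE /= in_itv /= => /andP[r0 rT].
  have rI : r \in `[0, T] by rewrite in_itv /= !ltW.
  have [iq _] := Cq r rI.
  have i1 := integrable_mul_bounded iq (mcut n) (cut3_le1 n).
  have i1' : (vol R).-integrable setT (EFin \o (fun x => 'D_1 eta r * (q r x * cut3 n x))).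
    by have := integrableZl measurableT ('D_1 eta r) i1; apply: eq_integrable.
  have i2 j := integrable_mul_bounded (CJ j r rI).1 (mdcut n j) (hC n j).
  have i2' j : (vol R).-integrable setT (EFin \o (fun x => eta r * (J j r x * 'D_(basis3 j) (cut3 n) x))).
    by have := integrableZl measurableT (eta r) (i2 j); apply: eq_integrable.
  rewrite /m /c -(RintegralZl _ measurableT i1) mulr_sumr.
  under eq_bigr => j _ do rewrite -(RintegralZl _ measurableT (i2 j)).
  rewrite -Rintegral_sum// -RintegralD//; last exact: integrable_sum_real.
  apply: eq_Rintegral => x _; rewrite (dt_sep _ _ se (scut n)).
  congr (_ + _); first by ring.
  by apply: eq_bigr => j _; rewrite (dx_sep _ _ _ se (scut n)); ring.
have mcvg t : t \in `[0, T] -> m n t @[n --> \oo] --> \int[vol R]_x q t x.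
  move=> tT; have [iq _] := Cq t tT.
  apply: (@Rintegral_dct _ _ _ (vol R) _ _ (fun x => `|q t x|) _ _ _ _).2.
  - by move=> n; apply: measurable_funM => //; exact: integrable_measurable.
  - by move=> x; rewrite -[X in _ --> X]mulr1; apply: cvgM; [exact: cvg_cst|exact: cut3_cvg].
  - exact: integrable_norm.
  - by move=> n x; rewrite normrM ler_piMr// cut3_le1.
have const s t : 0 < s -> s <= t -> t < T -> \int[vol R]_x q t x = \int[vol R]_x q s x.
  move=> s0 st tT.
  have tI : t \in `[0, T] by rewrite in_itv /= (ltW tT) andbT (le_trans (ltW s0)).
  have sI : s \in `[0, T] by rewrite in_itv /= (ltW s0) (le_trans st)// ltW.
  have c1 : `|m n t - m n s| @[n --> \oo] --> `|\int[vol R]_x q t x - \int[vol R]_x q s x|.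
    by apply: cvg_norm; apply: cvgB; exact: mcvg.
  have c2 : K * n.+1%:R^-1 * T @[n --> \oo] --> (0 : R).
    rewrite -[X in _ --> X](mul0r T); apply: cvgMl.
    by rewrite -[X in _ --> X](mulr0 K); apply: cvgMr; exact: cvg_harmonic.
  have : `|\int[vol R]_x q t x - \int[vol R]_x q s x| <= 0.
    apply: ler_cvg_to c1 c2 _; apply: nearW => n; exact: lip.
  by rewrite normr_le0 subr_eq0 => /eqP.
move=> t /andP[t0 tT].
have I0 : (0 : R) \in `[0, T] by rewrite in_itv /= lexx ltW.
apply/eqP; rewrite -subr_eq0 -normr_le0; apply/ler_addgt0Pr => e e0; rewrite add0r.
have [i0 c0] := Cq 0 I0; have [d d0 hd] := c0 e e0.
pose s := Num.min t (d / 2).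
have s0 : 0 < s by rewrite lt_min t0 divr_gt0.
have st : s <= t by rewrite ge_min lexx.
have sI : s \in `[0, T] by rewrite in_itv /= (ltW s0) (le_trans st)// ltW.
have sd : `|s - 0| < d.
  rewrite subr0 gtr0_norm//; apply: (@le_lt_trans _ _ (d / 2)); last lra.
  by rewrite ge_min lexx orbT.
rewrite (const s t s0 st tT); have [is_ _] := Cq s sI.
rewrite -(RintegralB measurableT is_ i0).
apply: (le_trans (le_normr_Rintegral measurableT (integrable_sub is_ i0))).
exact: hd.
Qed.

End Conservation.

(** * Products and powers of functions continuous in time *)

Section PowerLipschitz.
Context {R : realType}.

(** This is the inequality of Young for t and 1, with exponent p. *)
Lemma powR_bernoulli (t p : R) : 0 <= t -> 1 <= p -> 1 + p * (t - 1) <= t `^ p.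
Proof.
move=> t0; rewrite le_eqVlt => /predU1P[<-|p1]; first by rewrite powRr1//; lra.
have p0 : 0 < p by exact: lt_trans p1.
pose q := p / (p - 1); have pm : 0 < p - 1 by rewrite subr_gt0.
have q0 : 0 < q by rewrite divr_gt0.
have pq : p^-1 + q^-1 = 1 by rewrite /q; field; rewrite !gt_eqF.
have := @conjugate_powR _ t 1 p q t0 ler01 p0 q0 pq.
rewrite mulr1 powR1 mul1r => h.
have qE : q^-1 = 1 - p^-1 by rewrite -pq; ring.
rewrite qE in h.
have : p * t <= p * (t `^ p / p + (1 - p^-1)) by rewrite ler_pM2l.
rewrite mulrDr mulrBr mulr1 divff ?gt_eqF// mulrCA divff ?gt_eqF// mulr1; lra.
Qed.

(** For b <= a the inequality of Bernoulli at b / a, multiplied by a^p, says that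
the graph of the power lies above its tangent at a. *)
Lemma powR_lipschitz (a b M p : R) : 0 <= a <= M -> 0 <= b <= M -> 1 <= p ->
  `|a `^ p - b `^ p| <= p * M `^ (p - 1) * `|a - b|.
Proof.
wlog ba : a b / b <= a.
  move=> h aM bM p1; have [ba|/ltW ab] := leP b a; first exact: h.
  by rewrite distrC [X in _ * X]distrC; exact: h.
move=> /andP[a0 aM] /andP[b0 bM] p1.
have p0 : 0 < p by exact: lt_le_trans p1.
have [a0'|] := ltP 0 a; last first.
  move=> a0'; have -> : a = 0 by apply/eqP; rewrite eq_le a0'.
  have -> : b = 0 by apply/eqP; rewrite eq_le b0 (le_trans ba).
  by rewrite !subrr !normr0 mulr0.
have mono : b `^ p <= a `^ p by rewrite ge0_ler_powR// ?nnegrE// ltW.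
rewrite !ger0_norm ?subr_ge0//.
have : a `^ p * (1 + p * (b / a - 1)) <= a `^ p * (b / a) `^ p.
  by rewrite ler_pM2l ?powR_gt0// powR_bernoulli// divr_ge0.
rewrite -powRM ?divr_ge0// [a * _]mulrC divfK ?gt_eqF// => h.
have e : a `^ p = a * a `^ (p - 1) by rewrite mulr_powRB1.
have h2 : a `^ p - b `^ p <= p * a `^ (p - 1) * (a - b).
  have -> : p * a `^ (p - 1) * (a - b) = a `^ p - a `^ p * (1 + p * (b / a - 1)).
    by rewrite e; field; rewrite gt_eqF.
  by rewrite lerD2l lerN2.
apply: (le_trans h2); rewrite ler_wpM2r ?subr_ge0//; apply: ler_wpM2l; first exact: ltW.
by rewrite ge0_ler_powR ?subr_ge0// nnegrE (le_trans a0).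
Qed.

End PowerLipschitz.

Section Classes.
Context {R : realType}.
Implicit Types (F G : timeline R -> space3 R -> R) (T : R).

(** The space C([0, T]; L^2). *)
Definition C_L2 T F := forall t : R, t \in `[0, T] ->
  L2 (F t) /\
  forall e : R, 0 < e -> exists2 d : R, 0 < d & forall r : R, r \in `[0, T] -> `|r - t| < d ->
    \int[vol R]_x (F r x - F t x) ^+ 2 <= e.

(** The space C([0, T]; L^oo). *)
Definition C_Loo T F := forall t : R, t \in `[0, T] ->
  [/\ measurable_fun setT (F t),
    (exists2 M : R, 0 <= M & \forall x \ae vol R, `|F t x| <= M) &
  forall e : R, 0 < e -> exists2 d : R, 0 < d & forall r : R, r \in `[0, T] -> `|r - t| < d ->
    \forall x \ae vol R, `|F r x - F t x| <= e].

Lemma C_L1_restrict T F G : (forall t x, t \in `[0, T] -> F t x = G t x) -> C_L1 T F -> C_L1 T G.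
Proof.
move=> FG CF t tT; have E r : r \in `[0, T] -> G r = F r.
  by move=> rT; apply/funext => x; rewrite FG.
have [iF cF] := CF t tT; rewrite E//; split => // e e0; have [d d0 hd] := cF e e0.
by exists d => // r rT rd; rewrite E//; exact: hd.
Qed.

Lemma C_L2_restrict T F G : (forall t x, t \in `[0, T] -> F t x = G t x) -> C_L2 T F -> C_L2 T G.
Proof.
move=> FG CF t tT; have E r : r \in `[0, T] -> G r = F r.
  by move=> rT; apply/funext => x; rewrite FG.
have [iF cF] := CF t tT; rewrite E//; split => // e e0; have [d d0 hd] := cF e e0.
by exists d => // r rT rd; rewrite E//; exact: hd.
Qed.

Lemma C_Loo_restrict T F G : (forall t x, t \in `[0, T] -> F t x = G t x) -> C_Loo T F -> C_Loo T G.
Proof.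
move=> FG CF t tT; have E r : r \in `[0, T] -> G r = F r.
  by move=> rT; apply/funext => x; rewrite FG.
have [mF bF cF] := CF t tT; rewrite E//; split => // e e0; have [d d0 hd] := cF e e0.
by exists d => // r rT rd; rewrite E//; exact: hd.
Qed.

Lemma L2P (f : space3 R -> R) : measurable_fun setT f ->
  (vol R).-integrable setT (EFin \o (fun x => f x ^+ 2)) -> L2 f.
Proof.
move=> mf /integrableP[_ H]; split => //; apply: le_lt_trans H.
rewrite le_eqVlt; apply/orP; left; apply/eqP; apply: eq_integral => x _ /=.
by rewrite ger0_norm ?sqr_ge0.
Qed.

Lemma integrable_le_ae (f g : space3 R -> R) : measurable_fun setT f ->
  (vol R).-integrable setT (EFin \o g) -> (\forall x \ae vol R, `|f x| <= g x) ->
  (vol R).-integrable setT (EFin \o f).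
Proof.
move=> mf ig fg; apply/integrableP; split; first exact/measurable_EFinP.
have /integrableP[mg] := ig; apply: le_lt_trans.
apply: ae_ge0_le_integral => //.
- by apply: measurableT_comp => //; exact/measurable_EFinP.
- exact: measurableT_comp.
- by apply: filterS fg => x h _ /=; rewrite lee_fin (le_trans h)// ler_norm.
Qed.

Lemma le_Rintegral_ae (f g : space3 R -> R) : (forall x, 0 <= f x) -> (forall x, 0 <= g x) ->
  measurable_fun setT f ->
  (vol R).-integrable setT (EFin \o g) -> (\forall x \ae vol R, f x <= g x) ->
  \int[vol R]_x f x <= \int[vol R]_x g x.
Proof.
move=> f0 g0 mf ig fg.
have fi : (vol R).-integrable setT (EFin \o f).
  by apply: integrable_le_ae ig _ => //; apply: filterS fg => x; rewrite ger0_norm.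
apply: fine_le; [exact: integrable_fin_num fi|exact: integrable_fin_num ig|].
apply: ae_ge0_le_integral => //.
- by move=> x _; rewrite lee_fin.
- exact/measurable_EFinP.
- by move=> x _; rewrite lee_fin.
- by have /measurable_int := ig.
- by apply: filterS fg => x h _; rewrite lee_fin.
Qed.

Lemma integrableD_real (f g : space3 R -> R) :
  (vol R).-integrable setT (EFin \o f) -> (vol R).-integrable setT (EFin \o g) ->
  (vol R).-integrable setT (EFin \o (fun x => f x + g x)).
Proof. by move=> h1 h2; have := integrableD measurableT h1 h2; apply: eq_integrable. Qed.

Lemma integrableZ_real (a : R) (f : space3 R -> R) :
  (vol R).-integrable setT (EFin \o f) ->
  (vol R).-integrable setT (EFin \o (fun x => a * f x)).
Proof. by move=> h1; have := integrableZl measurableT a h1; apply: eq_integrable. Qed.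

Lemma normM_le_weighted (u v k : R) : 0 < k -> `|u * v| <= k^-1 * u ^+ 2 + k * v ^+ 2.
Proof.
move=> k0; rewrite -(ler_pM2l k0).
have -> : k * (k^-1 * u ^+ 2 + k * v ^+ 2) = u ^+ 2 + (k * v) ^+ 2.
  by field; rewrite gt_eqF.
have -> : k * `|u * v| = `|u * (k * v)|.
  by rewrite -[k in LHS]gtr0_norm// -normrM; congr `|_|; ring.
exact: normM_le_sqrD.
Qed.

(** In the application a - b and c - d are small while b and d are fixed: k will be
chosen small first, and the differences small with respect to k afterwards. *)
Lemma dist_prod_le (a b c d k : R) : 0 < k ->
  `|a * c - b * d| <= (1 + k^-1) * ((a - b) ^+ 2 + (c - d) ^+ 2) + k * (b ^+ 2 + d ^+ 2).
Proof.
move=> k0.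
have -> : a * c - b * d = (a - b) * (c - d) + (a - b) * d + (c - d) * b by ring.
have -> : (1 + k^-1) * ((a - b) ^+ 2 + (c - d) ^+ 2) + k * (b ^+ 2 + d ^+ 2) =
    ((a - b) ^+ 2 + (c - d) ^+ 2) + (k^-1 * (a - b) ^+ 2 + k * d ^+ 2) +
    (k^-1 * (c - d) ^+ 2 + k * b ^+ 2) by ring.
apply: (le_trans (ler_normD _ _)); apply: lerD; last exact: normM_le_weighted.
apply: (le_trans (ler_normD _ _)); apply: lerD; last exact: normM_le_weighted.
exact: normM_le_sqrD.
Qed.

Lemma C_L2_mul T F G : C_L2 T F -> C_L2 T G -> C_L1 T (fun t x => F t x * G t x).
Proof.
move=> CF CG t tT; have [LF cF] := CF t tT; have [LG cG] := CG t tT.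
split; first exact: L2_mul.
move=> e e0.
have sq0 (f : space3 R -> R) : 0 <= \int[vol R]_x (f x ^+ 2).
  by apply: Rintegral_ge0 => x _; exact: sqr_ge0.
set A := \int[vol R]_x (F t x ^+ 2); have A0 : 0 <= A by exact: sq0.
set B := \int[vol R]_x (G t x ^+ 2); have B0 : 0 <= B by exact: sq0.
pose k := e / (2 * (A + B + 1)).
have k0 : 0 < k by rewrite divr_gt0// mulr_gt0// ltr_wpDl// addr_ge0.
pose eta := e / (4 * (1 + k^-1)).
have kV : 0 < k^-1 by rewrite invr_gt0.
have eta0 : 0 < eta by rewrite divr_gt0// mulr_gt0// addr_gt0.
have [d1 d10 h1] := cF eta eta0; have [d2 d20 h2] := cG eta eta0.
exists (Num.min d1 d2); first by rewrite lt_min d10.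
move=> r rT; rewrite lt_min => /andP[r1 r2].
have [LFr _] := CF r rT; have [LGr _] := CG r rT.
have Da := L2B LFr LF; have Db := L2B LGr LG.
have ia := L2_sqr Da; have ib := L2_sqr Db; have iF := L2_sqr LF; have iG := L2_sqr LG.
pose g x := (1 + k^-1) * ((F r x - F t x) ^+ 2 + (G r x - G t x) ^+ 2) + k * (F t x ^+ 2 + G t x ^+ 2).
have iab := integrableD_real ia ib; have iFG := integrableD_real iF iG.
have i1 := integrableZ_real (1 + k^-1) iab; have i2 := integrableZ_real k iFG.
have ig : (vol R).-integrable setT (EFin \o g) by exact: integrableD_real.
have iprod := integrable_sub (L2_mul LFr LGr) (L2_mul LF LG).
apply: (@le_trans _ _ (\int[vol R]_x g x)).
  apply: le_Rintegral => //; first exact: integrable_norm.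
  by move=> x _; exact: dist_prod_le.
rewrite /g (RintegralD measurableT i1 i2) (RintegralZl _ measurableT iab) (RintegralZl _ measurableT iFG).
rewrite (RintegralD measurableT ia ib) (RintegralD measurableT iF iG) -/A -/B.
have s1 := h1 r rT r1; have s2 := h2 r rT r2.
have kV1 : 0 < 1 + k^-1 by rewrite addr_gt0.
have AB : 0 < A + B + 1 by rewrite ltr_wpDl// addr_ge0.
have b1 : (1 + k^-1) * (\int[vol R]_x (F r x - F t x) ^+ 2 + \int[vol R]_x (G r x - G t x) ^+ 2) <= e / 2.
  apply: (@le_trans _ _ ((1 + k^-1) * (eta + eta))); first by rewrite ler_pM2l// lerD.
  have half (v : R) : 0 < v -> v * (e / (4 * v) + e / (4 * v)) = e / 2.
    by move=> v0; field; rewrite gt_eqF.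
  by rewrite /eta half.
have b2 : k * (A + B) <= e / 2.
  apply: (@le_trans _ _ (k * (A + B + 1))); first by rewrite ler_pM2l// lerDl.
  have half (v : R) : 0 < v -> e / (2 * v) * v = e / 2.
    by move=> v0; field; rewrite gt_eqF.
  by rewrite /k half.
by rewrite [leRHS]splitr lerD.
Qed.

(** Write F_r G_r - F_t G_t as a sum of three products, in each of which one factor
is small in its space and the other one is bounded. *)
Lemma C_Loo_L2 T F G : C_Loo T F -> C_L2 T G -> C_L2 T (fun t x => F t x * G t x).
Proof.
have L2M (f g : space3 R -> R) M : measurable_fun setT f -> (\forall x \ae vol R, `|f x| <= M) ->
    L2 g -> L2 (fun x => f x * g x).
  move=> mf fM Lg; apply: L2P; first by apply: measurable_funM => //; case: Lg.
  apply: (integrable_le_ae _ (integrableZ_real (M ^+ 2) (L2_sqr Lg))).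
    by apply: measurable_funX; apply: measurable_funM => //; case: Lg.
  apply: filterS fM => x xM; rewrite (ger0_norm (sqr_ge0 _)) exprMn.
  apply: ler_wpM2r; first exact: sqr_ge0.
  rewrite -(real_normK (num_real (f x))) lerXn2r ?nnegrE//.
  exact: le_trans xM.
move=> CF CG t tT; have [mF [M M0 FM] cF] := CF t tT; have [LG cG] := CG t tT.
split; first exact: L2M FM LG.
move=> e e0; set B := \int[vol R]_x (G t x ^+ 2).
have B0 : 0 <= B by apply: Rintegral_ge0 => x _; exact: sqr_ge0.
pose eta := Num.min 1 (e / (6 * (B + 1))).
have B1 : 0 < B + 1 by rewrite ltr_wpDl.
have eta0 : 0 < eta by rewrite lt_min ltr01 divr_gt0// mulr_gt0.
pose dl := e / (6 * (1 + M ^+ 2)).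
have M1 : 0 < 1 + M ^+ 2 by rewrite ltr_pwDl// sqr_ge0.
have dl0 : 0 < dl by rewrite divr_gt0// mulr_gt0.
have [d1 d10 h1] := cF eta eta0; have [d2 d20 h2] := cG dl dl0.
exists (Num.min d1 d2); first by rewrite lt_min d10.
move=> r rT; rewrite lt_min => /andP[r1 r2].
have [mFr _ _] := CF r rT; have [LGr _] := CG r rT.
have Db := L2B LGr LG; have ib := L2_sqr Db; have iG := L2_sqr LG.
pose g x := 3 * eta * G t x ^+ 2 + 3 * (1 + M ^+ 2) * (G r x - G t x) ^+ 2.
have i1 := integrableZ_real (3 * eta) iG; have i2 := integrableZ_real (3 * (1 + M ^+ 2)) ib.
have ig : (vol R).-integrable setT (EFin \o g) by exact: integrableD_real.
apply: (@le_trans _ _ (\int[vol R]_x g x)).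
  apply: le_Rintegral_ae ig _.
  - by move=> x; exact: sqr_ge0.
  - by move=> x; rewrite /g addr_ge0// mulr_ge0 ?sqr_ge0// mulr_ge0// ltW.
  - apply: measurable_funX; apply: measurable_funB; apply: measurable_funM => //.
      by case: LGr.
    by case: LG.
  have := h1 r rT r1; apply: filterS2 FM => x; rewrite /g.
  move: (F r x) (F t x) (G r x) (G t x) => a b c d' bM abe.
  have eta1 : eta <= 1 by rewrite ge_min lexx.
  have -> : a * c - b * d' = (a - b) * d' + (a - b) * (c - d') + b * (c - d') by ring.
  have s3 (u v w : R) : (u + v + w) ^+ 2 <= 3 * u ^+ 2 + 3 * v ^+ 2 + 3 * w ^+ 2.
    have z1 := sqr_ge0 (u - v); have z2 := sqr_ge0 (u - w); have z3 := sqr_ge0 (v - w).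
    nra.
  apply: (le_trans (s3 _ _ _)); rewrite !exprMn.
  have ab1 : (a - b) ^+ 2 <= eta.
    rewrite -real_normK ?num_real// (le_trans _ (_ : eta ^+ 2 <= eta))//.
      by rewrite lerXn2r ?nnegrE// ltW.
    by rewrite expr2 ler_piMl// ltW.
  have b2 : b ^+ 2 <= M ^+ 2.
    by rewrite -real_normK ?num_real// lerXn2r ?nnegrE.
  have t1 : (a - b) ^+ 2 * d' ^+ 2 <= eta * d' ^+ 2 by rewrite ler_wpM2r ?sqr_ge0.
  have t2 : (a - b) ^+ 2 * (c - d') ^+ 2 <= 1 * (c - d') ^+ 2.
    by rewrite ler_wpM2r ?sqr_ge0// (le_trans ab1).
  have t3 : b ^+ 2 * (c - d') ^+ 2 <= M ^+ 2 * (c - d') ^+ 2 by rewrite ler_wpM2r ?sqr_ge0.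
  by move: t1 t2 t3; lra.
rewrite /g (RintegralD measurableT i1 i2) (RintegralZl _ measurableT iG) (RintegralZl _ measurableT ib) -/B.
have s2 := h2 r rT r2.
have b1 : 3 * eta * B <= e / 2.
  apply: (@le_trans _ _ (3 * (e / (6 * (B + 1))) * (B + 1))).
    apply: ler_pM => //; [by rewrite mulr_ge0// ltW| |by rewrite lerDl].
    by rewrite ler_pM2l// ge_min lexx orbT.
  by rewrite le_eqVlt; apply/orP; left; apply/eqP; field; rewrite !gt_eqF.
have b2 : 3 * (1 + M ^+ 2) * \int[vol R]_x (G r x - G t x) ^+ 2 <= e / 2.
  apply: (@le_trans _ _ (3 * (1 + M ^+ 2) * dl)); first by rewrite ler_wpM2l// mulr_ge0// ltW.
  by rewrite /dl le_eqVlt; apply/orP; left; apply/eqP; field; rewrite !gt_eqF.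
by rewrite [leRHS]splitr lerD.
Qed.

End Classes.

Section Powers.
Context {R : realType}.
Implicit Types (F : timeline R -> space3 R -> R) (T p : R).

Lemma measurable_powR_comp (f : space3 R -> R) p : measurable_fun setT f ->
  measurable_fun setT (fun x => f x `^ p).
Proof. by move=> mf; apply: (@measurableT_comp _ _ _ _ _ _ (@powR R ^~ p)) => //; exact: measurable_powR. Qed.

(** If F_t is bounded by M, then F_r is bounded by M + 1 for r near t, and the
power is Lipschitz on [0, M + 1]. *)
Lemma powR_locally_lipschitz T F p : 1 <= p ->
  (forall t x, t \in `[0, T] -> 0 <= F t x) -> C_Loo T F ->
  forall t : R, t \in `[0, T] -> exists2 K : R, 0 < K & exists2 d : R, 0 < d &
    forall r : R, r \in `[0, T] -> `|r - t| < d -> \forall x \ae vol R,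
      `|F r x `^ p - F t x `^ p| <= K * `|F r x - F t x| /\ `|F t x `^ p| <= K * `|F t x|.
Proof.
move=> p1 F0 CF t tT; have [mF [M M0 FM] cF] := CF t tT.
have p0 : 0 < p by exact: lt_le_trans p1.
have M1 : 0 < M + 1 by rewrite ltr_wpDl.
exists (p * (M + 1) `^ (p - 1)); first by rewrite mulr_gt0// powR_gt0.
have [d d0 hd] := cF 1 ltr01; exists d => // r rT rd.
have := hd r rT rd; apply: filterS2 FM => x xM x1.
have a0 := F0 t x tT; have b0 := F0 r x rT.
have aM : 0 <= F t x <= M + 1.
  by rewrite a0 -[leLHS]ger0_norm// (le_trans xM)// lerDl.
have bM : 0 <= F r x <= M + 1.
  rewrite b0 (_ : F r x = F t x + (F r x - F t x)); last by ring.
  by apply: lerD; [rewrite -[leLHS]ger0_norm|exact: le_trans (ler_norm _) x1].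
split; first exact: powR_lipschitz.
have := @powR_lipschitz _ (F t x) 0 (M + 1) p aM _ p1.
by rewrite powR0 ?gt_eqF// !subr0 lexx ltW// => /(_ isT).
Qed.

Lemma C_Loo_powR T F p : 1 <= p ->
  (forall t x, t \in `[0, T] -> 0 <= F t x) -> C_Loo T F ->
  C_Loo T (fun t x => F t x `^ p).
Proof.
move=> p1 F0 CF t tT; have [mF [M M0 FM] cF] := CF t tT.
have [K K0 [d d0 hd]] := powR_locally_lipschitz p1 F0 CF tT.
split; first exact: measurable_powR_comp.
  exists (K * M); first by rewrite mulr_ge0// ltW.
  have := hd t tT; rewrite subrr normr0 => /(_ d0); apply: filterS2 FM => x xM [_ xK].
  by apply: (le_trans xK); rewrite ler_pM2l.
move=> e e0; have [d' d'0 hd'] := cF (e / K) (divr_gt0 e0 K0).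
exists (Num.min d d'); first by rewrite lt_min d0.
move=> r rT; rewrite lt_min => /andP[r1 r2].
have := hd' r rT r2; apply: filterS2 (hd r rT r1) => x [xK _] xe.
by apply: (le_trans xK); rewrite mulrC -ler_pdivlMr.
Qed.

Lemma C_L2_powR T F p : 1 <= p ->
  (forall t x, t \in `[0, T] -> 0 <= F t x) -> C_Loo T F -> C_L2 T F ->
  C_L2 T (fun t x => F t x `^ p).
Proof.
move=> p1 F0 CF CF2 t tT; have [LF cF] := CF2 t tT.
have [K K0 [d d0 hd]] := powR_locally_lipschitz p1 F0 CF tT.
have sqK (u v : R) : `|u| <= K * `|v| -> u ^+ 2 <= K ^+ 2 * v ^+ 2.
  move=> uv; rewrite -(real_normK (num_real u)) -(real_normK (num_real v)) -exprMn.
  by rewrite lerXn2r ?nnegrE// mulr_ge0// ltW.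
have mF := L2_measurable LF; have mFp := measurable_powR_comp p mF.
split.
  apply: L2P => //; apply: (integrable_le_ae _ (integrableZ_real (K ^+ 2) (L2_sqr LF))).
    exact: measurable_funX.
  have := hd t tT; rewrite subrr normr0 => /(_ d0); apply: filterS => x [_ xK].
  by rewrite (ger0_norm (sqr_ge0 _)) sqK.
have K2 : 0 < K ^+ 2 by rewrite exprn_gt0.
move=> e e0; have [d' d'0 hd'] := cF (e / K ^+ 2) (divr_gt0 e0 K2).
exists (Num.min d d'); first by rewrite lt_min d0.
move=> r rT; rewrite lt_min => /andP[r1 r2]; have [LFr _] := CF2 r rT.
have iD := L2_sqr (L2B LFr LF).
apply: (@le_trans _ _ (\int[vol R]_x (K ^+ 2 * (F r x - F t x) ^+ 2))).
  apply: le_Rintegral_ae (integrableZ_real _ iD) _.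
  - by move=> x; exact: sqr_ge0.
  - by move=> x; rewrite mulr_ge0 ?sqr_ge0.
  - apply: measurable_funX; apply: measurable_funB => //.
    by apply: measurable_powR_comp; exact: L2_measurable LFr.
  - by apply: filterS (hd r rT r1) => x [xK _]; exact: sqK.
by rewrite (RintegralZl _ measurableT iD) mulrC -ler_pdivlMr// hd'.
Qed.

End Powers.

Section Embeddings.
Context {R : realType}.
Implicit Types (f : timeline R -> space3 R -> R) (T : R).

Lemma Rintegral_sqr_le (f : space3 R -> R) (e : R) : L2 f -> (sqint f <= e%:E)%E ->
  \int[vol R]_x (f x ^+ 2) <= e.
Proof.
move=> Lf fe; rewrite -[leRHS]/(fine e%:E); apply: fine_le => //.
exact: integrable_fin_num (L2_sqr Lf).
Qed.

Lemma C_H_C_L2 T (k : nat) f : in_C_H T k%:R f -> C_L2 T f.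
Proof.
move=> /in_C_H_nat Cf t tT; have [Hf cf] := Cf t tT; split; first exact: Hk_mem_L2 Hf.
move=> e e0; have [d d0 hd] := cf e e0; exists d => // r rT rd; have [Hr _] := Cf r rT.
apply: Rintegral_sqr_le; first exact: L2B (Hk_mem_L2 Hr) (Hk_mem_L2 Hf).
exact: le_trans (sqint_le_Hk_sq _ _) (hd r rT rd).
Qed.

Lemma C_H_weak_partial T (k : nat) f j : in_C_H T k.+1%:R f ->
  C_L2 T (fun t => weak_partial j (f t)).
Proof.
move=> /in_C_H_nat Cf t tT; have [Hf cf] := Cf t tT.
have Lf := Hk_mem_L2 (Hk_mem_weak_partial j Hf); split => //.
move=> e e0; have [d d0 hd] := cf e e0; exists d => // r rT rd; have [Hr _] := Cf r rT.
have Lr := Hk_mem_L2 (Hk_mem_weak_partial j Hr).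
apply: Rintegral_sqr_le; first exact: L2B.
have [_ h] := weak_partialB (Hk_mem_wp j Hr) (Hk_mem_wp j Hf).
have LB := Hk_mem_L2 (Hk_mem_weak_partial j (Hk_memB Hr Hf)).
rewrite -(sqint_ae (L2_measurable LB) (L2_measurable (L2B Lr Lf)) h).
apply: le_trans (hd r rT rd); apply: le_trans (Hk_sq_weak_partial _ _ _).
exact: sqint_le_Hk_sq.
Qed.

(** The Sobolev bound, applied to F_t for the boundedness and to F_r - F_t for the
continuity. *)
Lemma C_H3_C_Loo T f : in_C_H T 3 f -> C_Loo T f.
Proof.
have [C C0 hC] := @sobolev_Linfty R.
move=> /(@in_C_H_nat _ _ 3) Cf t tT; have [Hf cf] := Cf t tT.
split; first exact: L2_measurable (Hk_mem_L2 Hf).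
  pose e := Num.sqrt (fine (Hk_sq 3 (f t))) + 1.
  have e0 : 0 < e by rewrite ltr_wpDl// sqrtr_ge0.
  exists (C * e); first by rewrite mulr_ge0 ?ltW.
  apply: hC => //; have fin : Hk_sq 3 (f t) \is a fin_num.
    by rewrite ge0_fin_numE ?Hk_sq_ge0 ?Hk_sq_fin.
  rewrite -(fineK fin) lee_fin -[leLHS]sqr_sqrtr ?fine_ge0 ?Hk_sq_ge0//.
  by rewrite lerXn2r ?nnegrE ?sqrtr_ge0 ?(ltW e0)// lerDl.
move=> e e0; have eC : 0 < e / C by rewrite divr_gt0.
have [d d0 hd] := cf ((e / C) ^+ 2) (exprn_gt0 2 eC).
exists d => // r rT rd; have [Hr _] := Cf r rT.
have := hC _ _ (Hk_memB Hr Hf) eC (hd r rT rd).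
by apply: filterS => x; rewrite mulrC divfK ?gt_eqF.
Qed.

End Embeddings.

(** * Mass and momentum of a regular solution *)

Section Combinations.
Context {R : realType}.
Implicit Types (F G : timeline R -> space3 R -> R) (T : R).

Lemma C_L1_0 T : C_L1 T (fun (_ : timeline R) (_ : space3 R) => 0 : R).
Proof.
move=> t tT; split; first exact: integrable0.
move=> e e0; exists 1 => // r _ _.
by under eq_Rintegral do rewrite subrr normr0; rewrite Rintegral_cst// mul0r ltW.
Qed.

Lemma C_L1D T F G : C_L1 T F -> C_L1 T G -> C_L1 T (fun t x => F t x + G t x).
Proof.
move=> CF CG t tT; have [iF cF] := CF t tT; have [iG cG] := CG t tT.
split; first exact: integrableD_real.
move=> e e0; have e2 : 0 < e / 2 by rewrite divr_gt0.
have [d1 d10 h1] := cF _ e2; have [d2 d20 h2] := cG _ e2.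
exists (Num.min d1 d2); first by rewrite lt_min d10.
move=> r rT; rewrite lt_min => /andP[r1 r2].
have [iFr _] := CF r rT; have [iGr _] := CG r rT.
have i1 := integrable_norm (integrable_sub iFr iF); have i2 := integrable_norm (integrable_sub iGr iG).
apply: (@le_trans _ _ (\int[vol R]_x (`|F r x - F t x| + `|G r x - G t x|))).
  apply: le_Rintegral => //.
  - by apply/integrable_norm/integrable_sub; exact: integrableD_real.
  - exact: integrableD_real.
  - by move=> x _; rewrite opprD addrACA ler_normD.
by rewrite (RintegralD measurableT i1 i2) [leRHS]splitr lerD ?h1 ?h2.
Qed.

Lemma C_L1Z T a F : C_L1 T F -> C_L1 T (fun t x => a * F t x).
Proof.
move=> CF t tT; have [iF cF] := CF t tT.
split; first exact: integrableZ_real.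
have a1 : 0 < `|a| + 1 by rewrite ltr_wpDl.
move=> e e0; have [d d0 hd] := cF (e / (`|a| + 1)) (divr_gt0 e0 a1).
exists d => // r rT rd; have [iFr _] := CF r rT.
have i1 := integrable_norm (integrable_sub iFr iF).
under eq_Rintegral do rewrite -mulrBr normrM.
rewrite (RintegralZl _ measurableT i1).
apply: (@le_trans _ _ (`|a| * (e / (`|a| + 1)))); first by rewrite ler_wpM2l// hd.
by rewrite mulrA ler_pdivrMr// mulrC ler_pM2l// lerDl.
Qed.

Lemma C_L1_sum T (F : 'I_3 -> timeline R -> space3 R -> R) :
  (forall k, C_L1 T (F k)) -> C_L1 T (fun t x => \sum_k F k t x).
Proof.
move=> CF; apply: (@C_L1_restrict _ _ (fun t x => F ord0 t x + (F (lift ord0 ord0) t x +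
  (F (lift ord0 (lift ord0 ord0)) t x + 0)))).
  by move=> t x _; rewrite !big_ord_recl big_ord0.
by do 3!apply: C_L1D => //; exact: C_L1_0.
Qed.

End Combinations.

Section Solutions.
Context {R : realType}.
Implicit Types (rho : timeline R -> space3 R -> R)
  (u : 'I_3 -> timeline R -> space3 R -> R) (T : R).

(** Let f = rho^((m-1)/2). Then rho^s = f^q with q = 2 s / (m - 1) >= 2 because
m <= 2 and s >= 1. For the space L^1 split off one factor: f and f^(q-1) are
both in L^2, as q - 1 >= 1. *)
Lemma density_classes (m T s : R) rho : 1 < m <= 2 ->
  (forall t x, t \in `[0, T] -> 0 <= rho t x) ->
  in_C_H T 3 (fun t x => rho t x `^ ((m - 1) / 2)) -> 1 <= s ->
  [/\ C_L1 T (fun t x => rho t x `^ s), C_L2 T (fun t x => rho t x `^ s) &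
      C_Loo T (fun t x => rho t x `^ s)].
Proof.
move=> /andP[m1 m2] rho0 Cf s1.
have m0 : 0 < m - 1 by rewrite subr_gt0.
pose f t x := rho t x `^ ((m - 1) / 2); pose q := 2 * s / (m - 1).
have f0 t x : t \in `[0, T] -> 0 <= f t x by move=> _; exact: powR_ge0.
have q2 : 2 <= q by rewrite /q ler_pdivlMr//; lra.
have q1 : 1 <= q by lra.
have q11 : 1 <= q - 1 by lra.
have rhoE t x : rho t x `^ s = f t x `^ q.
  by rewrite /f -powRrM /q; congr (_ `^ _); field; rewrite gt_eqF.
have f2 := C_H_C_L2 (k := 3) Cf; have foo := C_H3_C_Loo Cf.
have -> : (fun t x => rho t x `^ s) = (fun t x => f t x `^ q).
  by apply/funext => t; apply/funext => x; exact: rhoE.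
split; [|exact: C_L2_powR|exact: C_Loo_powR].
apply: (C_L1_restrict _ (C_L2_mul f2 (C_L2_powR q11 f0 foo f2))) => t x _.
by rewrite mulr_powRB1// ?powR_ge0//; lra.
Qed.

Section Conservation.
Context (A alpha beta gamma delta T : R) (rho0 : space3 R -> R) (u0 : 'I_3 -> space3 R -> R).
Context (rho : timeline R -> space3 R -> R) (u : 'I_3 -> timeline R -> space3 R -> R).
Context (exponents : 1 < Num.min gamma delta <= 2) (T0 : 0 < T).
Context (sol : regular_solution A alpha beta gamma delta rho0 u0 T rho u).

(** The smaller of the two exponents gamma and delta satisfies the bounds under
which a power of rho in H^3 controls rho. *)
Lemma solution_density_powers s : 1 <= s ->
  [/\ C_L1 T (fun t x => rho t x `^ s), C_L2 T (fun t x => rho t x `^ s) &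
      C_Loo T (fun t x => rho t x `^ s)].
Proof.
have rho_ge0 := rs_rho_ge0 sol.
move: exponents; rewrite /Num.min; case: ifP => _ hm.
  exact: density_classes hm rho_ge0 (rs_rho_gamma sol).
exact: density_classes hm rho_ge0 (rs_rho_delta sol).
Qed.

Lemma solution_velocity i : C_L2 T (u i) /\ forall j, C_L2 T (fun t => weak_partial j (u i t)).
Proof.
have h : in_C_H T 2 (u i) by apply: (rs_u_C sol); rewrite lexx ltr_nat.
by split => [|j]; [exact: (C_H_C_L2 (k := 2) h)|exact: (C_H_weak_partial (k := 1) j h)].
Qed.

Lemma solution_density : [/\ C_L1 T rho, C_L2 T rho & C_Loo T rho].
Proof.
have E t x : t \in `[0, T] -> rho t x `^ 1 = rho t x by move=> tT; rewrite powRr1// (rs_rho_ge0 sol).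
have [h1 h2 h3] := solution_density_powers (lexx 1).
split; [exact: C_L1_restrict h1|exact: C_L2_restrict h2|exact: C_Loo_restrict h3].
Qed.

Lemma momentum_density_C_L2 i : C_L2 T (fun t x => rho t x * u i t x).
Proof. by have [_ _ h] := solution_density; apply: C_Loo_L2 => //; case: (solution_velocity i). Qed.

Lemma momentum_density_C_L1 i : C_L1 T (fun t x => rho t x * u i t x).
Proof. by have [_ h _] := solution_density; apply: C_L2_mul => //; case: (solution_velocity i). Qed.

Lemma mass_conserved t : 0 < t < T -> \int[vol R]_x rho t x = \int[vol R]_x rho 0 x.
Proof.
have [h _ _] := solution_density.
apply: (conservation (J := fun j t x => rho t x * u j t x)) => //.
  exact: momentum_density_C_L1.
exact: (rs_continuity sol).
Qed.

Lemma stress_C_L1 i j : C_L1 T (stress alpha beta delta rho u i j).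
Proof.
have d1 : 1 <= delta by move: exponents; rewrite lt_min => /andP[/andP[_ /ltW]].
have [_ hd _] := solution_density_powers d1.
have w k l : C_L1 T (fun t x => rho t x `^ delta * weak_partial k (u l t) x).
  by apply: C_L2_mul => //; case: (solution_velocity l).
pose b := beta * (i == j)%:R.
apply: (C_L1_restrict _ (C_L1D (C_L1D (C_L1Z alpha (w j i)) (C_L1Z alpha (w i j)))
  (C_L1Z b (C_L1_sum (fun k => w k k))))) => t x _.
rewrite /stress /divergence -mulr_sumr /b.
move: (\sum_k _) (rho t x `^ delta) (weak_partial j _ x) (weak_partial i _ x) (i == j)%:R.
by move=> *; ring.
Qed.

Lemma momentum_flux_C_L1 i j : C_L1 T (fun t x => rho t x * u i t x * u j t x
  + A * (i == j)%:R * rho t x `^ gamma - stress alpha beta delta rho u i j t x).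
Proof.
have g1 : 1 <= gamma by move: exponents; rewrite lt_min => /andP[/andP[/ltW]].
have [hg _ _] := solution_density_powers g1.
have [uj _] := solution_velocity j.
apply: (C_L1_restrict _ (C_L1D (C_L1D (C_L2_mul (momentum_density_C_L2 i) uj)
  (C_L1Z (A * (i == j)%:R) hg)) (C_L1Z (-1) (stress_C_L1 i j)))) => t x _.
by rewrite mulN1r.
Qed.

(** The pressure and the stress belong to the flux of the momentum. *)
Lemma momentum_conserved i t : 0 < t < T ->
  total_momentum (rho t) (u^~ t) i = total_momentum (rho 0) (u^~ 0) i.
Proof.
apply: (conservation T0 (momentum_density_C_L1 i) (momentum_flux_C_L1 i)) => phi hphi.
rewrite -[RHS](rs_momentum sol i hphi); congr (spacetime_int T).
apply/funext => t'; apply/funext => x; rewrite -!addrA; congr (_ + _).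
under eq_bigr do rewrite !mulrDl mulNr.
rewrite !big_split /= sumrN -!addrA; congr (_ + (_ + _)).
rewrite (bigD1 i)//= eqxx mulr1 big1 ?addr0// => j ji.
by rewrite eq_sym (negPf ji) mulr0 !mul0r.
Qed.

End Conservation.
End Solutions.

(** * Decay of the velocity *)

Section Decay.
Context {R : realType}.
Implicit Types (u : 'I_3 -> timeline R -> space3 R -> R).

Lemma norm_le_enorm (v : 'I_3 -> R) i : `|v i| <= enorm v.
Proof.
rewrite -sqrtr_sqr; apply: ler_wsqrtr; rewrite (bigD1 i)//= lerDl.
by apply: sumr_ge0 => j _; exact: sqr_ge0.
Qed.

Lemma speed_Linfty_ae u (t : R) (e : R) : (speed_Linfty u t <= e%:E)%E ->
  forall i, \forall x \ae vol R, `|u i t x| <= e.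
Proof.
rewrite /speed_Linfty unlock; case: ifPn => [_ /ess_supP h i|].
  apply: filterS h => x /=; rewrite lee_fin; apply: le_trans.
  by rewrite [leRHS]ger0_norm ?sqrtr_ge0// (norm_le_enorm (fun i => u i t x)).
rewrite -leNgt => h _ i; exists setT; split => //.
by apply/eqP; rewrite eq_le h measure_ge0.
Qed.

Lemma limf_esup0_witness (f : R -> \bar R) (e : R) : limf_esup f (pinfty_nbhs R) = 0%E ->
  0 < e -> exists2 t, 0 < t & (f t <= e%:E)%E.
Proof.
move=> f0 e0; have : (limf_esup f (pinfty_nbhs R) < e%:E)%E by rewrite f0 lte_fin.
rewrite limf_esupE => /ereal_inf_lt[_ [V [M [_ MV]] <-] Ve].
exists (Num.max M 0 + 1); first by rewrite ltr_wpDl// le_max lexx orbT.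
apply: le_trans (ltW Ve); apply: ereal_sup_ubound; exists (Num.max M 0 + 1) => //.
by apply: MV; rewrite (@le_lt_trans _ _ (Num.max M 0)) ?le_max ?lexx// ltrDl.
Qed.

Lemma momentum_le_mass (r v : space3 R -> R) (e : R) : (forall x, 0 <= r x) ->
  (vol R).-integrable setT (EFin \o r) -> (vol R).-integrable setT (EFin \o (fun x => r x * v x)) ->
  (\forall x \ae vol R, `|v x| <= e) ->
  `|\int[vol R]_x (r x * v x)| <= e * \int[vol R]_x r x.
Proof.
move=> r0 ir irv ve; have [e0|e0] := leP 0 e; last first.
  (* a negative bound holds almost everywhere only for the zero measure *)
  have E x : `|v x| <= e -> False by move=> h; have := le_lt_trans (le_trans (normr_ge0 _) h) e0; rewrite ltxx.
  have z (f : space3 R -> R) : measurable_fun setT f -> \int[vol R]_x f x = 0.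
    move=> mf; rewrite (@Rintegral_ae_eq _ f (cst 0))//; first by rewrite Rintegral_cst// mul0r.
    by apply: filterS ve => x /E.
  by rewrite !z ?normr0 ?mulr0//; exact: integrable_measurable.
apply: (le_trans (le_normr_Rintegral measurableT irv)).
rewrite -(RintegralZl _ measurableT ir).
apply: le_Rintegral_ae.
- by move=> x; exact: normr_ge0.
- by move=> x; exact: mulr_ge0.
- exact: integrable_measurable (integrable_norm irv).
- exact: integrableZ_real.
- by apply: filterS ve => x ve; rewrite normrM ger0_norm// mulrC ler_wpM2r.
Qed.

End Decay.

Theorem theorem1p2 (R : realType) (A alpha beta gamma delta : R)
  (rho0 : space3 R -> R) (u0 : 'I_3 -> space3 R -> R)
  (A_gt0 : 0 < A) (alpha_gt0 : 0 < alpha)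
  (viscosity : 0 <= 2 * alpha + 3 * beta)
  (exponents : 1 < Num.min gamma delta <= 2)
  (rho0_ge0 : forall x, 0 <= rho0 x)
  (rho0_gamma : in_H 3 (fun x => rho0 x `^ ((gamma - 1) / 2)))
  (rho0_delta : in_H 3 (fun x => rho0 x `^ ((delta - 1) / 2)))
  (u0_H3 : forall i, in_H 3 (u0 i))
  (momentum_neq0 : 0 < enorm (total_momentum rho0 u0)) :
  ~ exists (rho : timeline R -> space3 R -> R) (u : 'I_3 -> timeline R -> space3 R -> R),
      (forall T : R, 0 < T ->
         regular_solution A alpha beta gamma delta rho0 u0 T rho u) /\
      limf_esup (speed_Linfty u) (pinfty_nbhs R) = 0%E.
Proof.
move=> [rho [u [sol decay]]].
suff P0 i : total_momentum rho0 u0 i = 0.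
  by move: momentum_neq0; rewrite /enorm big1 ?sqrtr0 ?ltxx// => i _; rewrite P0 expr0n.
have L1P T (T0 : 0 < T) := momentum_density_C_L1 exponents (sol T T0) i.
(* rho0 is recovered from its power in H^3 *)
have mrho0 : measurable_fun setT rho0.
  have g1 : 0 < gamma - 1 by rewrite subr_gt0; move: exponents; rewrite lt_min => /andP[/andP[]].
  have -> : rho0 = fun x => (rho0 x `^ ((gamma - 1) / 2)) `^ (2 / (gamma - 1)).
    apply/funext => x; rewrite -powRrM (_ : _ / _ * _ = 1) ?powRr1//.
    by field; rewrite gt_eqF.
  apply: measurable_powR_comp; apply: L2_measurable.
  by apply: (@Hk_mem_L2 _ 3); rewrite -in_H_nat.
have P_init : total_momentum (rho 0) (u^~ 0) i = total_momentum rho0 u0 i.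
  have t01 : 0 \in `[0, 1 : R] by rewrite in_itv /= lexx ler01.
  have [h0 _] := L1P 1 ltr01 0 t01; apply: Rintegral_ae_eq.
  - exact: integrable_measurable h0.
  - apply: measurable_funM => //; apply: L2_measurable.
    by apply: (@Hk_mem_L2 _ 3); rewrite -in_H_nat.
  - have := rs_init_rho (sol 1 ltr01); apply: filterS2 (rs_init_u (sol 1 ltr01) i) => x.
    by move=> -> ->.
pose m0 := \int[vol R]_x rho 0 x.
(* the solution is used on an interval that contains a time at which the speed
   is at most e *)
have bound e : 0 < e -> `|total_momentum rho0 u0 i| <= e * m0.
  move=> e0; have [t t0 te] := limf_esup0_witness decay e0.
  have T0 : 0 < t + 1 by rewrite addr_gt0.
  have tT : 0 < t < t + 1 by rewrite t0 ltrDl /=.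
  have tT' : t \in `[0, t + 1] by rewrite in_itv /= ltW// lerDl /=.
  have [Crho _ _] := solution_density exponents (sol _ T0).
  have [irho _] := Crho t tT'; have [iP _] := L1P _ T0 t tT'.
  rewrite -P_init -(momentum_conserved exponents T0 (sol _ T0) i tT).
  rewrite /m0 -(mass_conserved exponents T0 (sol _ T0) tT).
  apply: momentum_le_mass => //; last exact: speed_Linfty_ae.
  by move=> x; exact: (rs_rho_ge0 (sol _ T0)).
have m0_ge0 : 0 <= m0.
  by have := bound 1 ltr01; rewrite mul1r; exact: le_trans.
apply/normr0_eq0/eqP; rewrite eq_le normr_ge0 andbT; apply/ler_addgt0Pl => e e0.
have m1 : 0 < m0 + 1 by rewrite ltr_wpDl.
apply: (le_trans (bound (e / (m0 + 1)) (divr_gt0 e0 m1))); rewrite addr0.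
by rewrite mulrAC ler_pdivrMr// ler_pM2l// lerDl.
Qed.
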